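(* Let $\nu=e^{-f}$ on $\mathbb{R}^n$ with $\|\nabla^2 f\|_{\mathrm{op}}\le L$ everywhere, let $0<\epsilon<\min\{\frac1L,\frac{1}{2\beta}\}$, and suppose the biased limit $\nu_\epsilon$ of PLA with step size $\epsilon$ satisfies the log-Sobolev inequality with constant $\beta>0$. Let $q>1$. Then along PLA with step size $\epsilon$, for all $k\ge0$, \[ R_{q,\nu}(\rho_k) \le \Big(\frac{q-\frac12}{q-1}\Big) R_{2q,\nu_\epsilon}(\rho_0)\, e^{-\frac{\beta\epsilon k}{2q}} + R_{2q-1,\nu}(\nu_\epsilon). \]
   Context: Proximal Langevin Algorithm (PLA) with step size $\epsilon>0$ for $\nu=e^{-f}$: starting from a random $x_0\in\mathbb{R}^n$, set $x_{k+1} = x_k - \epsilon \nabla f(x_{k+1}) + \sqrt{2\epsilon}\, z_k$ with $z_k\sim\mathcal{N}(0,I)$ independent; equivalently $\rho_{k+1} = (I+\epsilon\nabla f)^{-1}_\#\big(\rho_k * \mathcal{N}(0,2\epsilon I)\big)$, where $\rho_k$ is the law of $x_k$ and $T_\#\rho$ is the law of $T(x)$ for $x\sim\rho$. The biased limit $\nu_\epsilon$ is the stationary distribution of PLA, i.e. $\nu_\epsilon = (I+\epsilon\nabla f)^{-1}_\#(\nu_\epsilon * \mathcal{N}(0,2\epsilon I))$ (assumed to exist). Rényi divergence of order $q>0,q\ne1$: $R_{q,\nu}(\rho) = \frac{1}{q-1}\log\int \frac{\rho(x)^q}{\nu(x)^{q-1}}dx$. $\nu$ satisfies the log-Sobolev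 inequality with constant $\beta>0$ if $\int\rho\log\frac{\rho}{\nu}dx\le\frac{1}{2\beta}\int\rho\|\nabla\log\frac{\rho}{\nu}\|^2dx$ for all $\rho$. Densities are assumed smooth. *)

(* Defs.v *)
From HB Require Import structures.
From mathcomp Require Import all_boot all_order all_algebra.
From mathcomp Require Import all_classical all_reals all_analysis.
Set Implicit Arguments. Unset Strict Implicit. Unset Printing Implicit Defensive.
Import Order.TTheory GRing.Theory Num.Theory.
Import numFieldNormedType.Exports.
Local Open Scope classical_set_scope.
Local Open Scope ring_scope.

Section PLA.
Variable R : realType.

(* Nonnegative integral over R^n = 'rV[R]_n w.r.t. n-dimensional Lebesgue
   measure, realised as the iterated integral of 1-dimensional Lebesgue
   integrals (Tonelli: equal to the product-measure integral for
   nonnegative measurable integrands). R^0 is a point (counting measure). *)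
Fixpoint iint (n : nat) : ('rV[R]_n -> \bar R) -> \bar R :=
  match n return ('rV[R]_n -> \bar R) -> \bar R with
  | 0 => fun g => g 0
  | m.+1 => fun g =>
      (\int[@lebesgue_measure R]_t iint (fun x : 'rV[R]_m => g (row_mx (\row_(_ < 1) t) x)))%E
  end.

Definition Lint (n : nat) (g : 'rV[R]_n -> R) : \bar R :=
  (iint (fun x => (Num.max (g x) 0)%:E) - iint (fun x => (Num.max (- g x) 0)%:E))%E.

Definition enorm (n : nat) (v : 'rV[R]_n) : R := Num.sqrt (\sum_i v 0 i ^+ 2).

Definition pderiv (n : nat) (g : 'rV[R]_n -> R) (i : 'I_n) (x : 'rV[R]_n) : R :=
  derive g x (delta_mx 0 i).
Definition grad (n : nat) (g : 'rV[R]_n -> R) (x : 'rV[R]_n) : 'rV[R]_n :=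
  \row_i pderiv g i x.
Definition grad_sqnorm (n : nat) (g : 'rV[R]_n -> R) (x : 'rV[R]_n) : R :=
  \sum_i (pderiv g i x) ^+ 2.

(* density of N(0, 2 eps I) on R^n *)
Definition gauss_density (n : nat) (eps : R) (z : 'rV[R]_n) : R :=
  (Num.sqrt (4 * pi * eps)) ^- n * expR (- (enorm z ^+ 2) / (4 * eps)).

Definition is_density (n : nat) (rho : 'rV[R]_n -> R) : Prop :=
  (forall x, 0 <= rho x) /\ iint (fun x => (rho x)%:E) = 1%E.

(* One PLA step at the level of laws: sigma = (I + eps grad f)^{-1}_# (rho * N(0,2 eps I)),
   stated as: T(X') has the law of X + sqrt(2 eps) Z (X ~ rho, Z ~ N(0,I) independent),
   where X' ~ sigma and T = I + eps grad f, i.e. T_# sigma = rho * N(0, 2 eps I),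
   tested against all continuous nonnegative test functions. *)
Definition pla_step (n : nat) (f : 'rV[R]_n -> R) (eps : R)
    (rho sigma : 'rV[R]_n -> R) : Prop :=
  forall phi : 'rV[R]_n -> R, continuous phi -> (forall y, 0 <= phi y) ->
    iint (fun x => (phi (x + eps *: grad f x) * sigma x)%:E)
    = iint (fun x => iint (fun z => (phi (x + z) * rho x * gauss_density eps z)%:E)).

Definition renyi (n : nat) (q : R) (rho nu : 'rV[R]_n -> R) : \bar R :=
  match iint (fun x => (rho x `^ q * nu x `^ (1 - q))%:E) with
  | (r%:E)%E => ((q - 1)^-1 * ln r)%:E
  | (+oo)%E => (+oo)%E
  | (-oo)%E => (-oo)%E
  end.

Definition KL (n : nat) (rho nu : 'rV[R]_n -> R) : \bar R :=
  Lint (fun x => rho x * ln (rho x / nu x)).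
Definition fisher (n : nat) (rho nu : 'rV[R]_n -> R) : \bar R :=
  iint (fun x => (rho x * grad_sqnorm (fun y => ln (rho y / nu y)) x)%:E).

(* nu satisfies the log-Sobolev inequality with constant beta, for all smooth
   (here: everywhere differentiable) positive probability densities rho. *)
Definition LSI (n : nat) (nu : 'rV[R]_n -> R) (beta : R) : Prop :=
  forall rho : 'rV[R]_n -> R,
    (forall x, 0 < rho x) -> (forall x, differentiable rho x) -> is_density rho ->
    (KL rho nu <= ((2 * beta)^-1)%:E * fisher rho nu)%E.

End PLA.

(* Main.v *)
(** Write [T = I + eps grad f] and [P_t] for the heat semigroup, whose kernel is [N(0, 2 t I)].
    As [eps L < 1], the map [T] is expanding, so testing a step against bumps around [T x] gives a
    pointwise formula: by stationarity of [nu_eps], the density ratio of the next iterate to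
    [nu_eps] is the ratio of the Gaussian convolutions of the current iterate and of [nu_eps],
    composed with [T].  Gross' argument turns the log-Sobolev inequality of [nu_eps] into
    hypercontractivity of [P_t], from [L^a] of the convolved measure to [L^b] of [nu_eps] with
    [b > a].  By duality, the [p]-th moment [A] of the density ratio becomes at most
    [A ^ (p / (theta + p - 1))] after one step, with [theta > 1]; this is the exponential decay of
    the divergence from [nu_eps] of order [p = 2 q].  Cauchy-Schwarz under [nu_eps] exchanges this
    divergence for the one of order [q] from [exp (- f)]. *)

Require Import Defs.
From HB Require Import structures.
From mathcomp Require Import all_boot all_order all_algebra.
From mathcomp Require Import all_classical all_reals all_analysis.
From mathcomp Require Import measurable_realfun ring lra.
Import Order.TTheory GRing.Theory Num.Theory.
Import numFieldNormedType.Exports.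
Local Open Scope ring_scope.
Set Implicit Arguments.
Unset Strict Implicit.
Unset Printing Implicit Defensive.
Local Open Scope classical_set_scope.

(** * Lebesgue measure on row vectors *)

Section measurable_rV.
Context {R : realType}.

Definition row_tuple n (v : 'rV[R]_n) : n.-tuple (measurableTypeR R) :=
  [tuple v 0 i | i < n].

HB.instance Definition _ n :=
  Measurable.copy 'rV[R]_n (g_sigma_algebra_preimageType (@row_tuple n)).

Lemma measurable_rVP d (X : measurableType d) n (F : X -> 'rV[R]_n) :
  (forall i, measurable_fun setT (fun x => F x 0 i)) -> measurable_fun setT F.
Proof.
move=> mF; have mT : measurable_fun setT (@row_tuple n \o F).
  apply/measurable_fun_tnthP => i.
  have -> : @tnth n (measurableTypeR R) ^~ i \o (@row_tuple n \o F) = (fun x => F x 0 i).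
    by apply/funext => x /=; rewrite tnth_mktuple.
  exact: mF.
by move=> _ _ [B mB <-]; rewrite setTI -comp_preimage; exact: mT.
Qed.

Lemma measurable_coord n (i : 'I_n) : measurable_fun setT (fun v : 'rV[R]_n => v 0 i).
Proof.
have -> : (fun v : 'rV[R]_n => v 0 i) = @tnth n (measurableTypeR R) ^~ i \o @row_tuple n.
  by apply/funext => v /=; rewrite tnth_mktuple.
apply: measurableT_comp; first exact: measurable_tnth.
by move=> _ B mB; exists B.
Qed.

Lemma measurable_fun_coord d (X : measurableType d) n (F : X -> 'rV[R]_n) i :
  measurable_fun setT F -> measurable_fun setT (fun x => F x 0 i).
Proof. by move=> mF; exact: (measurableT_comp (measurable_coord i) mF). Qed.

Lemma measurable_funD_rV d (X : measurableType d) n (F G : X -> 'rV[R]_n) :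
  measurable_fun setT F -> measurable_fun setT G ->
  measurable_fun setT (fun x => F x + G x).
Proof.
move=> mF mG; apply: measurable_rVP => i; under eq_fun do rewrite mxE.
by apply: measurable_funD; exact: measurable_fun_coord.
Qed.

Lemma measurable_funB_rV d (X : measurableType d) n (F G : X -> 'rV[R]_n) :
  measurable_fun setT F -> measurable_fun setT G ->
  measurable_fun setT (fun x => F x - G x).
Proof.
move=> mF mG; apply: measurable_rVP => i; under eq_fun do rewrite !mxE.
by apply: measurable_funB; exact: measurable_fun_coord.
Qed.

Lemma ball_rVE n (x : 'rV[R]_n) r : 0 < r ->
  ball x r = \bigcap_(i in [set: 'I_n]) [set y : 'rV[R]_n | ball (x 0 i) r (y 0 i)].
Proof.
move=> r0; apply/seteqP; split=> y /=; first by move=> [_ xy] i _; exact: xy.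
by move=> xy; split=> // i j; rewrite ord1; exact: xy.
Qed.

Lemma measurable_ball_rV n (x : 'rV[R]_n) r : 0 < r -> measurable (ball x r).
Proof.
move=> r0; rewrite ball_rVE//; apply: fin_bigcap_measurable => // i _.
rewrite -[X in measurable X]setTI.
exact: (measurable_coord i measurableT (measurable_ball (x 0 i) r)).
Qed.

Definition rational_ball n (p : 'rV[rat]_n * rat) : set 'rV[R]_n :=
  ball (map_mx ratr p.1 : 'rV[R]_n) (ratr p.2).

Lemma rational_ballP n (U : set 'rV[R]_n) x : open U -> U x ->
  exists p, [/\ 0 < ratr p.2 :> R, rational_ball p x & rational_ball p `<=` U].
Proof.
rewrite openE => /(_ x) /[apply] /nbhs_ballP[e /= e0 xU].
have [r r0e] : exists r : rat, ratr r \in `]0, e / 2[%R.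
  by apply: rat_in_itvoo; rewrite divr_gt0.
move: r0e; rewrite in_itv/= => /andP[r0 re].
have near_x (i : 'I_n) : {q : rat | ratr q \in `]x 0 i - ratr r, x 0 i + ratr r[%R}.
  apply: cid; apply: rat_in_itvoo.
  by rewrite (@lt_trans _ _ (x 0 i)) ?ltrBlDr ?ltrDl.
exists (\row_i sval (near_x i), r).
have qx : rational_ball (\row_i sval (near_x i), r) x.
  rewrite /rational_ball ball_rVE// => i _ /=; rewrite !mxE; apply: ball_sym.
  by rewrite -ball_normE/=; case: (near_x i) => /= q; rewrite in_itv/= ltr_distlC.
split=> // y qy; apply: xU; apply: (@le_ball _ _ _ (ratr r + ratr r)).
  by rewrite (splitr e) lerD// ltW.
by apply: ball_triangle qy; exact: ball_sym.
Qed.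

Lemma open_measurable_rV n (U : set 'rV[R]_n) : open U -> measurable U.
Proof.
move=> oU; pose good p := `[< 0 < ratr p.2 :> R /\ rational_ball p `<=` U >].
have -> : U = \bigcup_p (if good p then rational_ball p else set0).
  apply/seteqP; split=> x.
    move=> /(rational_ballP oU)[p [p0 px pU]].
    by exists p => //; rewrite /good asboolT.
  by move=> [p _]; rewrite /good; case: asboolP => // -[_ +] => /[apply].
apply: countable_bigcupT_measurable; first exact: countableP.
move=> p; rewrite /good; case: asboolP => // -[p0 _].
exact: measurable_ball_rV.
Qed.

Lemma continuous_measurable_fun_rV n (g : 'rV[R]_n -> R) :
  continuous g -> measurable_fun setT g.
Proof.
move=> /continuousP cg; apply: (measurability _ (RGenOpens.measurableE R)).
move=> _ [_ [a [b ->] <-]]; rewrite setTI; apply: open_measurable_rV.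
exact/cg/interval_open.
Qed.

Lemma measurable_fun_continuous_comp_rV d (X : measurableType d) n (g : 'rV[R]_n -> R)
    (F : X -> 'rV[R]_n) :
  continuous g -> measurable_fun setT F -> measurable_fun setT (fun x => g (F x)).
Proof. by move=> cg; exact: (measurableT_comp (continuous_measurable_fun_rV cg)). Qed.

End measurable_rV.

Section lebesgue_rV.
Context {R : realType}.

Definition row_cons m (p : measurableTypeR R * 'rV[R]_m) : 'rV[R]_m.+1 :=
  row_mx (\row_(_ < 1) p.1) p.2.

Lemma row_cons0 m (p : measurableTypeR R * 'rV[R]_m) : row_cons p 0 ord0 = p.1.
Proof.
have -> : ord0 = lshift m (ord0 : 'I_1) by exact: val_inj.
by rewrite [LHS](row_mxEl (\row__ p.1)) mxE.
Qed.

Lemma row_consS m (p : measurableTypeR R * 'rV[R]_m) i : row_cons p 0 (lift ord0 i) = p.2 0 i.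
Proof.
have -> : lift ord0 i = rshift 1 i by exact: val_inj.
exact: (row_mxEr (\row__ p.1)).
Qed.

Lemma ord_consP m (P : 'I_m.+1 -> Prop) : P ord0 -> (forall i, P (lift ord0 i)) ->
  forall i, P i.
Proof. by move=> P0 PS i; have [j ->|->] := unliftP ord0 i. Qed.

Definition row_uncons m (v : 'rV[R]_m.+1) : measurableTypeR R * 'rV[R]_m :=
  (v 0 ord0, \row_i v 0 (lift ord0 i)).

Lemma row_consK m : cancel (@row_cons m) (@row_uncons m).
Proof.
move=> [t x]; rewrite /row_uncons row_cons0; congr pair.
by apply/rowP => i; rewrite mxE row_consS.
Qed.

Lemma row_unconsK m : cancel (@row_uncons m) (@row_cons m).
Proof.
move=> v; apply/rowP; elim/ord_consP => [|i]; first by rewrite row_cons0.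
by rewrite row_consS mxE.
Qed.

Lemma row_consD m (p q : measurableTypeR R * 'rV[R]_m) :
  row_cons p + row_cons q = row_cons (p.1 + q.1, p.2 + q.2).
Proof.
apply/rowP; elim/ord_consP => [|i]; first by rewrite mxE !row_cons0.
by rewrite mxE !row_consS mxE.
Qed.

Lemma measurable_row_cons m : measurable_fun setT (@row_cons m).
Proof.
apply: measurable_rVP; elim/ord_consP => [|i].
  by under eq_fun do rewrite row_cons0; exact: measurable_fst.
under eq_fun do rewrite row_consS.
by apply: measurable_fun_coord; exact: measurable_snd.
Qed.

Lemma measurable_row_cons1 m t : measurable_fun setT (fun x : 'rV[R]_m => row_cons (t, x)).
Proof. exact: (measurableT_comp (@measurable_row_cons m) (pair1_measurable t)). Qed.

Lemma measurable_row_uncons m : measurable_fun setT (@row_uncons m).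
Proof.
apply: measurable_fun_pair; first exact: measurable_coord.
by apply: measurable_rVP => i; under eq_fun do rewrite /= mxE; exact: measurable_coord.
Qed.

Section row_cons_measure.
Variables (m : nat) (mu : {sigma_finite_measure set 'rV[R]_m -> \bar R}).

Definition row_cons_measure : set 'rV[R]_m.+1 -> \bar R :=
  pushforward (@lebesgue_measure R \x mu)%E (@row_cons m).

Let row_cons_measure0 : row_cons_measure set0 = 0%E.
Proof. by rewrite /row_cons_measure /pushforward preimage_set0 measure0. Qed.

Let row_cons_measure_ge0 A : (0 <= row_cons_measure A)%E.
Proof. exact: (measure_ge0 (@lebesgue_measure R \x mu)%E). Qed.

Let row_cons_measure_sigma_additive : semi_sigma_additive row_cons_measure.
Proof.
have := @measure_semi_sigma_additive _ _ _
  (pushforward (@lebesgue_measure R \x mu)%E (@row_cons m)).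
by apply; exact: measurable_row_cons.
Qed.

HB.instance Definition _ := isMeasure.Build _ _ _ row_cons_measure
  row_cons_measure0 row_cons_measure_ge0 row_cons_measure_sigma_additive.

Let row_cons_measure_sigma_finite : sigma_finite setT row_cons_measure.
Proof.
have /sigma_finiteP[F [TF ndF Foo]] := sigma_finiteT (@lebesgue_measure R).
have /sigma_finiteP[G [TG ndG Goo]] := sigma_finiteT mu.
exists (fun k => @row_uncons m @^-1` (F k `*` G k)).
  apply/seteqP; split=> // v _.
  have [i _ Fi] : (\bigcup_i F i) (row_uncons v).1 by rewrite -TF.
  have [j _ Gj] : (\bigcup_i G i) (row_uncons v).2 by rewrite -TG.
  exists (maxn i j) => //; split=> /=.
    by move: Fi; exact/subsetPset/ndF/leq_maxl.
  by move: Gj; exact/subsetPset/ndG/leq_maxr.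
move=> k; have [mF Fk] := Foo k; have [mG Gk] := Goo k; split.
  rewrite -[X in measurable X]setTI.
  by apply: measurable_row_uncons => //; exact: measurableX.
rewrite /row_cons_measure /pushforward -comp_preimage.
have -> : @row_uncons m \o @row_cons m = id by apply/funext => p; exact: row_consK.
by rewrite preimage_id product_measure1E// lte_mul_pinfty// ge0_fin_numE.
Qed.

HB.instance Definition _ := Measure_isSigmaFinite.Build _ _ _ row_cons_measure
  row_cons_measure_sigma_finite.

End row_cons_measure.

Fixpoint lebesgue_rV n : {sigma_finite_measure set 'rV[R]_n -> \bar R} :=
  match n with
  | 0 => \d_(0 : 'rV[R]_0)
  | m.+1 => row_cons_measure (lebesgue_rV m)
  end.

Lemma ge0_integral_row_cons m (g : 'rV[R]_m.+1 -> \bar R) :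
  measurable_fun setT g -> (forall v, 0 <= g v)%E ->
  (\int[lebesgue_rV m.+1]_v g v =
   \int[lebesgue_measure]_t \int[lebesgue_rV m]_x g (row_cons (t, x)))%E.
Proof.
move=> mg g0; have mr := @measurable_row_cons m.
transitivity (\int[pushforward (@lebesgue_measure R \x lebesgue_rV m) (@row_cons m)]_v g v)%E.
  by apply: eq_measure_integral.
rewrite (ge0_integral_pushforward mr)// preimage_setT.
have mgr : measurable_fun setT (g \o @row_cons m) by exact: measurableT_comp.
by rewrite fubini_tonelli1// => p; exact: g0.
Qed.

Lemma iintE n (g : 'rV[R]_n -> \bar R) :
  measurable_fun setT g -> (forall v, 0 <= g v)%E -> iint g = (\int[lebesgue_rV n]_v g v)%E.
Proof.
elim: n => [|m ih] in g * => mg g0; first by rewrite /= integral_dirac// diracT mul1e.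
rewrite ge0_integral_row_cons//; apply: eq_integral => t _; apply: ih => //.
exact: (measurableT_comp mg (measurable_row_cons1 t)).
Qed.

Lemma ge0_integral_addr (c : R) (h : R -> \bar R) :
  measurable_fun setT h -> (forall t, 0 <= h t)%E ->
  (\int[lebesgue_measure]_t h (t + c)%R = \int[lebesgue_measure]_t h t)%E.
Proof.
move=> mh h0; pose s : measurableTypeR R -> measurableTypeR R := fun t => t + c.
have ms : measurable_fun setT s.
  exact: (measurable_funD (@measurable_id _ _ setT) (measurable_cst c)).
rewrite -[LHS]/(\int[lebesgue_measure]_(t in setT) (h \o s) t)%E -(preimage_setT s).
rewrite -(ge0_integral_pushforward ms)//.
apply: eq_measure_integral => //= A mA _; apply/esym/lebesgue_measure_unique => //= _ [[a b]] _ <-.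
have s_itv : s @^-1` `]a, b] = `]a - c, b - c]%classic.
  by apply/seteqP; split=> x /=; rewrite !in_itv/= ltrBlDr lerBrDr.
rewrite /pushforward s_itv !lebesgue_measure_itv/= !lte_fin ltrD2r.
by case: ifP => // _; congr (_%:E); ring.
Qed.

Lemma ge0_integral_rV_addr n (c : 'rV[R]_n) (g : 'rV[R]_n -> \bar R) :
  measurable_fun setT g -> (forall x, 0 <= g x)%E ->
  (\int[lebesgue_rV n]_x g (x + c)%R = \int[lebesgue_rV n]_x g x)%E.
Proof.
elim: n => [|m ih] in c g * => mg g0.
  by apply: eq_integral => x _; rewrite [c]thinmx0 addr0.
have mgc : measurable_fun setT (fun x : 'rV[R]_m.+1 => g (x + c)).
  by apply: (measurableT_comp mg); exact: measurable_funD_rV.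
apply: (etrans (ge0_integral_row_cons mgc (fun x => g0 _))).
apply/esym/(etrans (ge0_integral_row_cons mg g0))/esym.
pose G t : \bar R := (\int[lebesgue_rV m]_x g (row_cons (t, x)))%E.
have mG : measurable_fun setT G.
  apply: (@measurable_fun_fubini_tonelli_F _ _ _ _ R (lebesgue_rV m)
    (fun p : measurableTypeR R * 'rV[R]_m => g (row_cons p))) => //.
  by apply: (measurableT_comp mg); exact: measurable_row_cons.
rewrite -/(G _) -(ge0_integral_addr (row_uncons c).1 mG); last first.
  by move=> t; exact: integral_ge0.
apply: eq_integral => t _; pose gt x := g (row_cons (t + (row_uncons c).1, x)).
rewrite /G -(ih (row_uncons c).2 gt) => [||x]; last exact: g0.
  by apply: eq_integral => x _; rewrite -[in LHS](row_unconsK c) row_consD.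
exact: (measurableT_comp mg (measurable_row_cons1 _)).
Qed.

Lemma Rintegral_rV_addr n (c : 'rV[R]_n) (g : 'rV[R]_n -> R) : measurable_fun setT g ->
  (\int[lebesgue_rV n]_x g (x + c) = \int[lebesgue_rV n]_x g x)%R.
Proof.
move=> mg; rewrite /Rintegral [in LHS]integralE [in RHS]integralE.
have mEg : measurable_fun setT (EFin \o g) by exact/measurable_EFinP.
rewrite -(ge0_integral_rV_addr c (measurable_funepos mEg))//.
rewrite -(ge0_integral_rV_addr c (measurable_funeneg mEg))//.
by congr (fine (_ - _))%E; apply: eq_integral => x _; rewrite ?funeposE ?funenegE.
Qed.

Lemma lebesgue_rV_ball_gt0 n (x : 'rV[R]_n) r : 0 < r -> (0 < lebesgue_rV n (ball x r))%E.
Proof.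
move=> r0; elim: n => [|m ih] in x *.
  by rewrite /= diracE mem_set// ; split=> // i [].
rewrite /= /row_cons_measure /pushforward.
have -> : @row_cons m @^-1` ball x r = ball (row_uncons x).1 r `*` ball (row_uncons x).2 r.
  apply/seteqP; split=> -[t y] /=.
    move=> [_ near_tail]; split; first by have := near_tail 0 ord0; rewrite row_cons0.
    by split=> // i j; have := near_tail 0 (lift ord0 j); rewrite row_consS mxE ord1.
  move=> [near_head [_ near_tail]]; split=> // i; rewrite ord1; elim/ord_consP => [|j].
    by rewrite row_cons0.
  by rewrite row_consS; have := near_tail 0 j; rewrite mxE.
rewrite product_measure1E//; [|exact: measurable_ball|exact: measurable_ball_rV].
apply: mule_gt0 (ih _).
suff : (0 < @lebesgue_measure R (ball (row_uncons x).1 r))%E by [].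
by rewrite lebesgue_measure_ball ?ltW// lte_fin mulrn_wgt0.
Qed.

Lemma integral_continuous_gt0 n (g : 'rV[R]_n -> R) : continuous g -> (forall x, 0 <= g x) ->
  (exists x, 0 < g x) -> (0 < \int[lebesgue_rV n]_x (g x)%:E)%E.
Proof.
move=> cg g0 [x gx]; have mg := continuous_measurable_fun_rV cg.
have : nbhs x (g @^-1` [set y | g x / 2 < y]).
  apply: cg; apply: open_nbhs_nbhs; split; first exact: open_gt.
  by rewrite /= ltr_pdivrMr// ltr_pMr// ltr1n.
move=> /nbhs_ballP[r /= r0 gr].
have g20 : 0 < g x / 2 by rewrite divr_gt0.
apply: (@lt_le_trans _ _ ((g x / 2)%:E * lebesgue_rV n (ball x r))%E).
  by rewrite mule_gt0 ?lte_fin// lebesgue_rV_ball_gt0.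
have mB := measurable_ball_rV x r0.
rewrite -integral_cst//; apply: (@le_trans _ _ (\int[lebesgue_rV n]_(y in ball x r) (g y)%:E)%E).
  apply: ge0_le_integral => //=.
  - by move=> y _; rewrite lee_fin ltW.
  - by apply/measurable_EFinP; exact: measurable_funTS.
  - by move=> y /gr /ltW; rewrite lee_fin.
apply: ge0_subset_integral => //; last by move=> y _; rewrite lee_fin.
exact/measurable_EFinP.
Qed.

End lebesgue_rV.

(** * Means under a continuous density *)

Section continuous_functions.
Context {R : realType} {T : topologicalType}.
Implicit Types f g : T -> R.

Lemma continuous_funD f g : continuous f -> continuous g -> continuous (fun x => f x + g x).
Proof. by move=> cf cg x; exact: (continuousD (cf x) (cg x)). Qed.

Lemma continuous_funN f : continuous f -> continuous (fun x => - f x).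
Proof. by move=> cf x; exact: (continuousN (cf x)). Qed.

Lemma continuous_funM f g : continuous f -> continuous g -> continuous (fun x => f x * g x).
Proof. by move=> cf cg x; exact: (continuousM (cf x) (cg x)). Qed.

Lemma continuous_funZ c f : continuous f -> continuous (fun x => c * f x).
Proof. by move=> cf; apply: continuous_funM => //; exact: cst_continuous. Qed.

Lemma continuous_fun_comp (h : R -> R) f : continuous f ->
  (forall x, {for f x, continuous h}) -> continuous (fun x => h (f x)).
Proof. by move=> cf ch x; apply: continuous_comp; [exact: cf|exact: ch]. Qed.

Lemma continuous_fun_norm f : continuous f -> continuous (fun x => `|f x|).
Proof. by move=> cf; apply: continuous_fun_comp => // x; exact: norm_continuous. Qed.

Lemma continuous_funX f k : continuous f -> continuous (fun x => f x ^+ k).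
Proof.
move=> cf; apply: (continuous_fun_comp (h := fun t => t ^+ k)) => // x.
exact: exprn_continuous.
Qed.

Lemma continuous_fun_expR f : continuous f -> continuous (fun x => expR (f x)).
Proof. by move=> cf; apply: continuous_fun_comp => // x; exact: continuous_expR. Qed.

Lemma continuous_funV f : continuous f -> (forall x, 0 < f x) -> continuous (fun x => (f x)^-1).
Proof. by move=> cf f0 x; apply: continuousV; [rewrite gt_eqF|exact: cf]. Qed.

Lemma continuous_fun_div f g : continuous f -> continuous g -> (forall x, 0 < g x) ->
  continuous (fun x => f x / g x).
Proof. by move=> cf cg g0; apply: continuous_funM => //; exact: continuous_funV. Qed.

Lemma continuous_fun_max f g : continuous f -> continuous g ->
  continuous (fun x => Num.max (f x) (g x)).
Proof. by move=> cf cg x; exact: (continuous_max (cf x) (cg x)). Qed.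

Lemma continuous_fun_min f g : continuous f -> continuous g ->
  continuous (fun x => Num.min (f x) (g x)).
Proof. by move=> cf cg x; exact: (continuous_min (cf x) (cg x)). Qed.

Lemma continuous_fun_sum (I : Type) (r : seq I) (F : I -> T -> R) :
  (forall i, continuous (F i)) -> continuous (fun x => \sum_(i <- r) F i x).
Proof.
move=> cF; elim: r => [|i r ih].
  by under eq_fun do rewrite big_nil; exact: cst_continuous.
by under eq_fun do rewrite big_cons; exact: continuous_funD.
Qed.

Lemma continuous_norm_powR (p : R) : 0 < p -> continuous (fun t : R => `|t| `^ p).
Proof.
move=> p0 a; have pn : p != 0 by rewrite gt_eqF.
have [->|a0] := eqVneq a 0; last first.
  apply: (@continuous_comp _ _ _ (fun t : R => `|t|) (fun t : R => t `^ p)).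
    exact: norm_continuous.
  apply/differentiable_continuous/derivable1_diffP; apply: derivable_powR.
  by rewrite in_itv/= andbT normr_gt0.
apply/(@cvgrPdist_lt _ _ _ (nbhs (0 : R))) => e e0.
apply/nbhs_ballP; exists (e `^ p^-1) => /=; first exact: powR_gt0.
move=> t; rewrite -ball_normE /= sub0r normrN normr0 powR0// sub0r normrN => te.
rewrite ger0_norm ?powR_ge0// -[ltRHS]powRr1 ?(ltW e0)// -(mulVf pn) powRrM.
by rewrite gt0_ltr_powR// nnegrE powR_ge0.
Qed.

Lemma continuous_fun_powR (p : R) f : 0 < p -> continuous f -> (forall x, 0 <= f x) ->
  continuous (fun x => f x `^ p).
Proof.
move=> p0 cf f0; have -> : (fun x => f x `^ p) = (fun x => `|f x| `^ p).
  by apply/funext => x; rewrite ger0_norm.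
by apply: (continuous_fun_comp (h := fun t => `|t| `^ p) cf) => x; exact: continuous_norm_powR.
Qed.

Lemma continuous_fun_powR_gt0 (p : R) f : continuous f -> (forall x, 0 < f x) ->
  continuous (fun x => f x `^ p).
Proof.
move=> cf f0; apply: (continuous_fun_comp (h := fun t => t `^ p) cf) => x.
apply/differentiable_continuous/derivable1_diffP; apply: derivable_powR.
by rewrite in_itv/= andbT.
Qed.

End continuous_functions.

Section continuous_rV.
Context {R : realType}.

Lemma continuous_coord n (i : 'I_n) : continuous (fun v : 'rV[R]_n => v 0 i).
Proof. exact: coord_continuous. Qed.

Lemma continuous_addl n (g : 'rV[R]_n -> R) x : continuous g -> continuous (fun z => g (x + z)).
Proof.
move=> cg z; apply: continuous_comp; last exact: cg.
exact: (@continuousD _ _ _ (cst x) id z (@cst_continuous _ _ x z) (@cvg_id _ (nbhs z))).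
Qed.

Lemma continuous_addr n (g : 'rV[R]_n -> R) x : continuous g -> continuous (fun z => g (z + x)).
Proof. by move=> cg; under eq_fun do rewrite addrC; exact: continuous_addl. Qed.

End continuous_rV.

Section density_mean.
Context {R : realType} {n : nat}.
Local Notation V := 'rV[R]_n.
Local Notation leb := (lebesgue_rV n).

Definition density (w : V -> R) : Prop := continuous w /\ is_density w.

Definition dintegrable (w g : V -> R) : Prop :=
  continuous g /\ leb.-integrable setT (fun x => (g x * w x)%:E).

Definition dmean (w g : V -> R) : R := \int[leb]_x (g x * w x).

Lemma continuous_measurable_EFin (g : V -> R) : continuous g ->
  measurable_fun setT (fun x => (g x)%:E).
Proof. by move=> cg; exact/measurable_EFinP/continuous_measurable_fun_rV. Qed.

Lemma ge0_integral_continuousZl c (g : V -> R) : 0 <= c -> continuous g ->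
  (forall x, 0 <= g x) ->
  (\int[leb]_x (c * g x)%:E = c%:E * \int[leb]_x (g x)%:E)%E.
Proof.
move=> c0 cg g0; under eq_integral do rewrite EFinM.
rewrite ge0_integralZl ?lee_fin//; first exact: continuous_measurable_EFin.
by move=> x _; rewrite lee_fin.
Qed.

Lemma ge0_integral_continuous_addr c (g : V -> R) : continuous g -> (forall x, 0 <= g x) ->
  (\int[leb]_x (g (x + c)%R)%:E = \int[leb]_x (g x)%:E)%E.
Proof.
move=> cg g0; apply: (ge0_integral_rV_addr c (g := EFin \o g)); last by move=> x; rewrite lee_fin.
exact: continuous_measurable_EFin.
Qed.

Lemma iint_continuous (g : V -> R) : continuous g -> (forall x, 0 <= g x) ->
  iint (fun x => (g x)%:E) = (\int[leb]_x (g x)%:E)%E.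
Proof.
by move=> cg g0; rewrite iintE//; exact: continuous_measurable_EFin.
Qed.

Section fixed_density.
Variable w : V -> R.
Hypothesis dw : density w.

Lemma density_continuous : continuous w. Proof. by case: dw. Qed.
Let cw := density_continuous.

Lemma density_ge0 x : 0 <= w x. Proof. by case: dw => _ []. Qed.
Let w0 := density_ge0.

Lemma integral_density : (\int[leb]_x (w x)%:E = 1)%E.
Proof. by case: dw => _ [_ <-]; rewrite -iint_continuous. Qed.

Lemma density_gt0_exists : exists x, 0 < w x.
Proof.
apply: contrapT => w_le0; have w_eq0 x : w x = 0.
  by apply/eqP; rewrite eq_le w0 andbT leNgt; apply/negP => wx; apply: w_le0; exists x.
have := integral_density; under eq_integral do rewrite w_eq0.
by rewrite integral0 => -[/esym/eqP]; rewrite oner_eq0.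
Qed.

Lemma measurable_mul_density (g : V -> R) : continuous g ->
  measurable_fun setT (fun x => (g x * w x)%:E).
Proof. by move=> cg; apply: continuous_measurable_EFin; exact: continuous_funM. Qed.

Lemma dintegrable_le (g h : V -> R) : continuous g -> (forall x, `|g x| <= h x) ->
  dintegrable w h -> dintegrable w g.
Proof.
move=> cg gh [_ ih]; split=> //; apply: le_integrable ih => //.
  exact: measurable_mul_density.
move=> x _; rewrite lee_fin !normrM ler_wpM2r//.
by rewrite (le_trans (gh _))// ler_norm.
Qed.

Lemma dintegrable_of_lty (g : V -> R) : continuous g -> (forall x, 0 <= g x) ->
  (\int[leb]_x (g x * w x)%:E < +oo)%E -> dintegrable w g.
Proof.
move=> cg g0 gy; split=> //; apply/integrableP; split; first exact: measurable_mul_density.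
by under eq_integral do rewrite gee0_abs ?lee_fin ?mulr_ge0//.
Qed.

Lemma dintegrable_cst c : dintegrable w (fun=> c).
Proof.
split; first exact: cst_continuous.
under eq_fun do rewrite EFinM.
apply: integrableZl => //; apply/integrableP; split.
  exact: continuous_measurable_EFin.
under eq_integral do rewrite gee0_abs ?lee_fin//.
by rewrite integral_density ltry.
Qed.

Lemma dintegrable_bounded (g : V -> R) (C : R) : continuous g ->
  (forall x, `|g x| <= C) -> dintegrable w g.
Proof. by move=> cg gC; apply: (dintegrable_le cg gC); exact: dintegrable_cst. Qed.

Lemma dintegrableD (g h : V -> R) : dintegrable w g -> dintegrable w h ->
  dintegrable w (fun x => g x + h x).
Proof.
move=> [cg ig] [ch ih]; split; first exact: continuous_funD.
under eq_fun do rewrite mulrDl EFinD.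
exact: (integrableD measurableT ig ih).
Qed.

Lemma dintegrableZ c (g : V -> R) : dintegrable w g -> dintegrable w (fun x => c * g x).
Proof.
move=> [cg ig]; split; first exact: continuous_funZ.
under eq_fun do rewrite -mulrA EFinM.
exact: integrableZl.
Qed.

Lemma dintegrable_sum (I : Type) (r : seq I) (F : I -> V -> R) :
  (forall i, dintegrable w (F i)) -> dintegrable w (fun x => \sum_(i <- r) F i x).
Proof.
move=> cF; elim: r => [|i r ih].
  by under eq_fun do rewrite big_nil; exact: dintegrable_cst.
by under eq_fun do rewrite big_cons; exact: dintegrableD.
Qed.

Lemma dintegrable_norm (g : V -> R) : dintegrable w g -> dintegrable w (fun x => `|g x|).
Proof.
move=> [cg ig]; split; first exact: continuous_fun_norm.
have := integrable_norm ig; apply: eq_integrable => // x _ /=.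
by rewrite normrM (ger0_norm (w0 _)).
Qed.

Lemma dmeanD (g h : V -> R) : dintegrable w g -> dintegrable w h ->
  dmean w (fun x => g x + h x) = dmean w g + dmean w h.
Proof.
move=> [cg ig] [ch ih]; rewrite /dmean -RintegralD//.
by apply: eq_Rintegral => x _; rewrite mulrDl.
Qed.

Lemma dmeanZ c (g : V -> R) : dintegrable w g -> dmean w (fun x => c * g x) = c * dmean w g.
Proof.
move=> [cg ig]; rewrite /dmean -RintegralZl//.
by apply: eq_Rintegral => x _; rewrite mulrA.
Qed.

Lemma dmean_EFin (g : V -> R) : dintegrable w g ->
  (\int[leb]_x (g x * w x)%:E = (dmean w g)%:E)%E.
Proof.
by move=> [cg ig]; rewrite /dmean /Rintegral fineK//; exact: integrable_fin_num ig.
Qed.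

Lemma dmean_cst c : dmean w (fun=> c) = c.
Proof.
have := dmeanZ c (dintegrable_cst 1); under eq_fun do rewrite mulr1.
move=> ->; rewrite /dmean /Rintegral.
by under eq_integral do rewrite mul1r; rewrite integral_density mulr1.
Qed.

Lemma dmean_sum (I : Type) (r : seq I) (F : I -> V -> R) :
  (forall i, dintegrable w (F i)) ->
  dmean w (fun x => \sum_(i <- r) F i x) = \sum_(i <- r) dmean w (F i).
Proof.
move=> cF; elim: r => [|i r ih].
  by under eq_fun do rewrite big_nil; rewrite big_nil dmean_cst.
under eq_fun do rewrite big_cons.
by rewrite dmeanD ?big_cons ?ih//; exact: dintegrable_sum.
Qed.

Lemma dmean_le (g h : V -> R) : dintegrable w g -> dintegrable w h ->
  (forall x, g x <= h x) -> dmean w g <= dmean w h.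
Proof.
by move=> [cg ig] [ch ih] gh; apply: le_Rintegral => // x _; exact: ler_wpM2r.
Qed.

Lemma dmean_ge0 (g : V -> R) : (forall x, 0 <= g x) -> 0 <= dmean w g.
Proof. by move=> g0; apply: Rintegral_ge0 => x _; exact: mulr_ge0. Qed.

Lemma dmean_norm (g : V -> R) : dintegrable w g -> `|dmean w g| <= dmean w (fun x => `|g x|).
Proof.
move=> [cg ig]; apply: (le_trans (le_normr_Rintegral measurableT ig)).
rewrite (_ : dmean _ _ = \int[leb]_x `|g x * w x|)//.
by apply: eq_Rintegral => x _; rewrite normrM (ger0_norm (w0 _)).
Qed.

Lemma dmean_norm_le (g h : V -> R) : dintegrable w g -> dintegrable w h ->
  (forall x, `|g x| <= h x) -> `|dmean w g| <= dmean w h.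
Proof.
by move=> ig ih gh; apply: le_trans (dmean_norm ig) (dmean_le (dintegrable_norm ig) ih gh).
Qed.

End fixed_density.

Lemma Lnorm_density w (g : V -> R) p : density w -> 0 < p -> (forall x, 0 <= g x) ->
  dintegrable w (fun x => g x `^ p) ->
  Lnorm leb p%:E (EFin \o (fun x => g x * w x `^ p^-1)) =
  (dmean w (fun x => g x `^ p) `^ p^-1)%:E.
Proof.
move=> dw p0 g0 ig; rewrite unlock /= -poweR_EFin -(dmean_EFin ig); congr poweR.
apply: eq_integral => x _; rewrite ger0_norm ?mulr_ge0 ?powR_ge0//.
rewrite powRM ?powR_ge0// -powRrM mulVf ?gt_eqF// powRr1//.
exact: density_ge0.
Qed.

Lemma dintegrable_hoelder w (g h : V -> R) p q :
  density w -> 0 < p -> 0 < q -> p^-1 + q^-1 = 1 ->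
  continuous g -> continuous h -> (forall x, 0 <= g x) -> (forall x, 0 <= h x) ->
  dintegrable w (fun x => g x `^ p) -> dintegrable w (fun x => h x `^ q) ->
  dintegrable w (fun x => g x * h x).
Proof.
move=> dw p0 q0 pq cg ch g0 h0 ig ih.
apply: (dintegrable_le dw (continuous_funM cg ch) _
  (dintegrableD (dintegrableZ p^-1 ig) (dintegrableZ q^-1 ih))) => x.
by rewrite ger0_norm ?mulr_ge0// (mulrC p^-1) (mulrC q^-1) conjugate_powR.
Qed.

Lemma dmean_hoelder w (g h : V -> R) p q :
  density w -> 0 < p -> 0 < q -> p^-1 + q^-1 = 1 ->
  continuous g -> continuous h -> (forall x, 0 <= g x) -> (forall x, 0 <= h x) ->
  dintegrable w (fun x => g x `^ p) -> dintegrable w (fun x => h x `^ q) ->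
  dmean w (fun x => g x * h x) <=
  dmean w (fun x => g x `^ p) `^ p^-1 * dmean w (fun x => h x `^ q) `^ q^-1.
Proof.
move=> dw p0 q0 pq cg ch g0 h0 ig ih.
have w0 := density_ge0 dw; have cw := density_continuous dw.
have m_root (f : V -> R) (r : R) : 0 < r -> continuous f ->
    measurable_fun setT (fun x => f x * w x `^ r^-1).
  move=> r0 cf; apply: continuous_measurable_fun_rV; apply: continuous_funM => //.
  by apply: continuous_fun_powR => //; rewrite invr_gt0.
have igh := dintegrable_hoelder dw p0 q0 pq cg ch g0 h0 ig ih.
have := hoelder leb (m_root g p p0 cg) (m_root h q q0 ch) p0 q0 pq.
rewrite (Lnorm_density dw p0 g0 ig) (Lnorm_density dw q0 h0 ih) -EFinM.
suff -> : Lnorm leb 1 (EFin \o (fun x => (g x * w x `^ p^-1) * (h x * w x `^ q^-1))) =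
    (dmean w (fun x => g x * h x))%:E by [].
rewrite Lnorm1 -(dmean_EFin igh); apply: eq_integral => x _.
rewrite /= ger0_norm ?mulr_ge0 ?powR_ge0//; congr (_%:E).
by rewrite mulrACA -powRD ?pq ?oner_eq0// powRr1.
Qed.

Lemma dmean_powR_ge w (g : V -> R) p : density w -> 1 < p -> (forall x, 0 <= g x) ->
  continuous g -> dintegrable w (fun x => g x `^ p) ->
  dmean w g `^ p <= dmean w (fun x => g x `^ p).
Proof.
move=> dw p1 g0 cg igp; have p0 : 0 < p := lt_trans ltr01 p1.
have q0 : 0 < p / (p - 1) by rewrite divr_gt0// subr_gt0.
have pq : p^-1 + (p / (p - 1))^-1 = 1 by field; rewrite !gt_eqF ?subr_gt0.
have i1 : dintegrable w (fun=> 1 `^ (p / (p - 1))) by exact: dintegrable_cst.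
have c1 : continuous (fun _ : V => 1 : R) by exact: cst_continuous.
have := dmean_hoelder dw p0 q0 pq cg c1 g0 (fun=> ler01) igp i1.
under eq_fun do rewrite mulr1; under [in X in _ * X]eq_fun do rewrite powR1.
rewrite dmean_cst// powR1 mulr1 => gle.
have m0 : 0 <= dmean w g by exact: dmean_ge0.
have mp0 : 0 <= dmean w (fun x => g x `^ p) by apply: dmean_ge0 => // x; exact: powR_ge0.
have := ge0_ler_powR (ltW p0) m0 (powR_ge0 _ _) gle.
by rewrite -powRrM mulVf ?gt_eqF// powRr1.
Qed.

End density_mean.

(** * Taylor estimates in one variable *)

Section mean_value.
Context {R : realType}.
Implicit Types (f df : R -> R) (a b m M K x y : R).

Lemma MVT_between f df a b :
  (forall x, Num.min a b <= x <= Num.max a b -> is_derive x 1 f (df x)) ->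
  exists2 c, Num.min a b <= c <= Num.max a b & f b - f a = df c * (b - a).
Proof.
move=> fd; wlog ab : a b fd / a <= b.
  move=> MVT_le; have /orP[ab|ba] := le_total a b; first exact: MVT_le.
  have [|c cba fE] := MVT_le b a _ ba; first by rewrite minC maxC.
  exists c; first by rewrite minC maxC.
  by rewrite -[LHS]opprB fE; ring.
rewrite (min_idPl ab) (max_idPr ab) in fd *.
have fd_cc x : x \in `[a, b]%R -> is_derive x 1 f (df x) by rewrite in_itv/= => /fd.
have fd_oo x : x \in `]a, b[%R -> is_derive x 1 f (df x).
  by move=> xab; apply: fd_cc; apply: subset_itv_oo_cc xab.
have cf : {within `[a, b], continuous f}.
  by apply: derivable_within_continuous => x /fd_cc fx; exact: ex_derive.
by have [c cab fE] := MVT_segment ab fd_oo cf; exists c => //; move: cab; rewrite in_itv.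
Qed.

Lemma is_derive_continuous f x d : is_derive x 1 f d -> {for x, continuous f}.
Proof.
by move=> fx; apply/differentiable_continuous/derivable1_diffP; exact: ex_derive.
Qed.

Lemma lipschitz_of_derive f df a b K :
  (forall x, Num.min a b <= x <= Num.max a b -> is_derive x 1 f (df x)) ->
  (forall x, Num.min a b <= x <= Num.max a b -> `|df x| <= K) ->
  `|f b - f a| <= K * `|b - a|.
Proof.
move=> fd dK; have [c cab ->] := MVT_between fd.
by rewrite normrM ler_wpM2r// dK.
Qed.

Lemma le_of_derive_ge0 f df a b : a <= b ->
  (forall x, a <= x <= b -> is_derive x 1 f (df x)) ->
  (forall x, a <= x <= b -> 0 <= df x) -> f a <= f b.
Proof.
move=> ab fd df_ge0; have [|c] := @MVT_between f df a b.
  by rewrite (min_idPl ab) (max_idPr ab).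
rewrite (min_idPl ab) (max_idPr ab) => /df_ge0 dfc fE.
by rewrite -subr_ge0 fE mulr_ge0// subr_ge0.
Qed.

Lemma continuous_bounded_segment f m M :
  (forall x, m <= x <= M -> {for x, continuous f}) ->
  exists K, forall x, m <= x <= M -> `|f x| <= K.
Proof.
move=> cf; have [mM|Mm] := leP m M; last first.
  by exists 0 => x /andP[mx xM]; have := le_trans mx xM; rewrite leNgt Mm.
have cnf : {within `[m, M], continuous (fun x => `|f x|)}.
  apply: continuous_in_subspaceT => x; rewrite inE/= in_itv/= => mxM.
  by apply: continuous_comp; [exact: cf|exact: norm_continuous].
have [c _ fc] := EVT_max mM cnf.
by exists `|f c| => x mxM; apply: fc; rewrite in_itv.
Qed.

End mean_value.

Section C3_on.
Context {R : realType}.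
Implicit Types (f : R -> R) (a b m M K x : R).

Record C3_on m M K f f1 f2 f3 : Prop := C3On {
  C3_on_derive0 : forall x, m <= x <= M -> is_derive x 1 f (f1 x);
  C3_on_derive1 : forall x, m <= x <= M -> is_derive x 1 f1 (f2 x);
  C3_on_derive2 : forall x, m <= x <= M -> is_derive x 1 f2 (f3 x);
  C3_on_bound1 : forall x, m <= x <= M -> `|f1 x| <= K;
  C3_on_bound2 : forall x, m <= x <= M -> `|f2 x| <= K;
  C3_on_bound3 : forall x, m <= x <= M -> `|f3 x| <= K }.

Lemma C3_on_exists m M f f1 f2 f3 :
  (forall x, m <= x <= M -> is_derive x 1 f (f1 x)) ->
  (forall x, m <= x <= M -> is_derive x 1 f1 (f2 x)) ->
  (forall x, m <= x <= M -> is_derive x 1 f2 (f3 x)) ->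
  (forall x, m <= x <= M -> {for x, continuous f3}) ->
  exists K, C3_on m M K f f1 f2 f3.
Proof.
move=> d0 d1 d2 cf3.
have [K1 bound1] := continuous_bounded_segment (fun x xmM => is_derive_continuous (d1 x xmM)).
have [K2 bound2] := continuous_bounded_segment (fun x xmM => is_derive_continuous (d2 x xmM)).
have [K3 bound3] := continuous_bounded_segment cf3.
exists (Num.max K1 (Num.max K2 K3)); split=> // x xmM; rewrite !le_max.
- by rewrite bound1.
- by rewrite bound2// orbT.
- by rewrite bound3// !orbT.
Qed.

Lemma C3_onN m M K f f1 f2 f3 : C3_on m M K f f1 f2 f3 ->
  C3_on m M K (fun x => - f x) (fun x => - f1 x) (fun x => - f2 x) (fun x => - f3 x).
Proof.
move=> [d0 d1 d2 b1 b2 b3]; split=> x xmM; rewrite ?normrN.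
- by have := d0 x xmM => fx; exact: is_deriveN.
- by have := d1 x xmM => fx; exact: is_deriveN.
- by have := d2 x xmM => fx; exact: is_deriveN.
- exact: b1.
- exact: b2.
- exact: b3.
Qed.

Let between_itv m M a b x : m <= a <= M -> m <= b <= M ->
  Num.min a b <= x <= Num.max a b -> m <= x <= M.
Proof.
move=> /andP[ma aM] /andP[mb bM] /andP[abx xab]; apply/andP; split.
  by rewrite (le_trans _ abx)// le_min ma mb.
by rewrite (le_trans xab)// ge_max aM bM.
Qed.

Let between_dist a b x : Num.min a b <= x <= Num.max a b -> `|x - a| <= `|b - a|.
Proof.
have /orP[ab|ba] := le_total a b.
  rewrite (min_idPl ab) (max_idPr ab) => /andP[ax xb].
  by rewrite !ger0_norm ?subr_ge0// lerD2r.
rewrite (min_idPr ba) (max_idPl ba) => /andP[bx xa].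
by rewrite !ler0_norm ?subr_le0// !opprB lerD2l lerN2.
Qed.

Lemma lipschitz_segment m M K f f1 a b :
  (forall x, m <= x <= M -> is_derive x 1 f (f1 x)) ->
  (forall x, m <= x <= M -> `|f1 x| <= K) ->
  m <= a <= M -> m <= b <= M -> `|f b - f a| <= K * `|b - a|.
Proof.
move=> d0 b1 aI bI; apply: (lipschitz_of_derive (df := f1)) => x xab.
  by apply: d0; exact: between_itv xab.
by apply: b1; exact: between_itv xab.
Qed.

Lemma taylor1_le m M K f f1 f2 a b :
  (forall x, m <= x <= M -> is_derive x 1 f (f1 x)) ->
  (forall x, m <= x <= M -> is_derive x 1 f1 (f2 x)) ->
  (forall x, m <= x <= M -> `|f2 x| <= K) ->
  m <= a <= M -> m <= b <= M ->
  `|f b - f a - f1 a * (b - a)| <= K * `|b - a| ^+ 2.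
Proof.
move=> d0 d1 b2 aI bI; have K0 : 0 <= K by exact: le_trans (b2 _ aI).
pose g x := f x - f1 a * x.
have -> : f b - f a - f1 a * (b - a) = g b - g a by rewrite /g; ring.
rewrite expr2 mulrA.
apply: (lipschitz_of_derive (df := fun x => f1 x - f1 a)) => x xab;
  have xI := between_itv aI bI xab.
  have := d0 x xI => fx.
  by apply: is_derive_eq; rewrite /GRing.scale/=; ring.
rewrite (le_trans (lipschitz_segment d1 b2 aI xI))// ler_wpM2l//.
exact: between_dist.
Qed.

Lemma taylor2_le m M K f f1 f2 f3 a b : C3_on m M K f f1 f2 f3 ->
  m <= a <= M -> m <= b <= M ->
  `|f b - f a - f1 a * (b - a) - f2 a / 2 * (b - a) ^+ 2| <= K * `|b - a| ^+ 3.
Proof.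
move=> [d0 d1 d2 _ _ b3] aI bI; have K0 : 0 <= K by exact: le_trans (b3 _ aI).
pose g x := f x - f1 a * x - f2 a / 2 * (x - a) ^+ 2.
have -> : f b - f a - f1 a * (b - a) - f2 a / 2 * (b - a) ^+ 2 = g b - g a.
  by rewrite /g; ring.
rewrite exprSr mulrA.
apply: (lipschitz_of_derive (df := fun x => f1 x - f1 a - f2 a * (x - a))) => x xab;
  have xI := between_itv aI bI xab.
  have := d0 x xI => fx.
  by apply: is_derive_eq; rewrite /GRing.scale/=; field.
rewrite (le_trans (taylor1_le d1 d2 b3 aI xI))// ler_wpM2l//.
by rewrite ler_sqr ?nnegrE//; exact: between_dist.
Qed.

End C3_on.

Section exponential_inequalities.
Context {R : realType}.
Implicit Types x y t : R.

Lemma expR_le_quadratic y : 0 <= y -> y <= 2^-1 -> expR y <= 1 + y + 2 * y ^+ 2.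
Proof.
move=> y0 y2; have y1 : 0 < 1 - y by lra.
have : expR y <= (1 - y)^-1.
  rewrite -[leRHS]mul1r ler_pdivlMr// -[leRHS](expRxMexpNx_1 y) ler_wpM2l ?expR_ge0//.
  exact: expR_ge1Dx.
move=> /le_trans; apply; rewrite -[leLHS]mul1r ler_pdivrMr//; nra.
Qed.

Lemma expR_taylor1_le x : `|expR x - 1 - x| <= expR `|x| * x ^+ 2.
Proof.
have ex y : - `|x| <= y <= `|x| -> is_derive y 1 (@expR R) (expR y).
  by move=> _; exact: is_derive_expR.
have bound y : - `|x| <= y <= `|x| -> `|expR y| <= expR `|x|.
  by move=> /andP[_ yx]; rewrite ger0_norm ?expR_ge0// ler_expR.
have xI : - `|x| <= x <= `|x| by rewrite -ler_norml.
have oI : - `|x| <= 0 <= `|x| by rewrite oppr_le0 normr_ge0.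
have := taylor1_le ex ex bound oI xI.
by rewrite expR0 !subr0 mul1r real_normK ?num_real.
Qed.

Lemma ge_sinh x : 0 <= x -> 2 * x <= expR x - expR (- x).
Proof.
move=> x0; pose f y := expR y - expR (- y) - 2 * y.
have : f 0 <= f x.
  apply: (@le_of_derive_ge0 _ f (fun y => expR y + expR (- y) - 2)) => // y _.
    by apply: is_derive_eq; rewrite /GRing.scale/=; ring.
  have := expR_gt0 y; have := expRxMexpNx_1 y; have := expR_gt0 (- y).
  set a := expR y; set b := expR (- y) => b0 ab a0.
  by have := sqr_ge0 (a - 1); nra.
by rewrite /f oppr0 expR0; lra.
Qed.

Lemma sinh_le_mul_cosh x : 0 <= x -> expR x - expR (- x) <= x * (expR x + expR (- x)).
Proof.
move=> x0; pose f y := y * (expR y + expR (- y)) - (expR y - expR (- y)).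
have : f 0 <= f x.
  apply: (@le_of_derive_ge0 _ f (fun y => y * (expR y - expR (- y)))) => // y /andP[y0 _].
    by apply: is_derive_eq; rewrite /GRing.scale/=; ring.
  by rewrite mulr_ge0// (le_trans _ (ge_sinh y0))// mulr_ge0.
by rewrite /f oppr0 expR0; lra.
Qed.

(* [2 * (cosh t - 1)]: a smooth stand-in for [t ^+ 2] whose Gaussian mean is explicit. *)
Definition cosh_excess t : R := expR t + expR (- t) - 2.

Lemma cosh_excessN t : cosh_excess (- t) = cosh_excess t.
Proof. by rewrite /cosh_excess opprK [expR (- t) + _]addrC. Qed.

Lemma cosh_excessE t : cosh_excess t = (expR (t / 2) - expR (- (t / 2))) ^+ 2.
Proof.
have := expRxMexpNx_1 (t / 2); rewrite /cosh_excess {3 4}(splitr t) opprD !expRD.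
by move: (expR (t / 2)) (expR _) => a b ab; lra.
Qed.

Lemma sqr_le_cosh_excess t : t ^+ 2 <= cosh_excess t.
Proof.
wlog t0 : t / 0 <= t.
  move=> le_ge0; case: (leP 0 t) => [|/ltW]; first exact: le_ge0.
  by rewrite -oppr_ge0 => /le_ge0; rewrite sqrrN cosh_excessN.
have sinh_ge : 2 * (t / 2) <= _ := @ge_sinh (t / 2) ltac:(lra).
by rewrite cosh_excessE ler_sqr ?nnegrE//; lra.
Qed.

Lemma cosh_excess_le t : cosh_excess t <= t ^+ 2 + 4^-1 * cosh_excess t ^+ 2.
Proof.
wlog t0 : t / 0 <= t.
  move=> le_ge0; case: (leP 0 t) => [|/ltW]; first exact: le_ge0.
  by rewrite -oppr_ge0 => /le_ge0; rewrite sqrrN cosh_excessN.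
suff tanh_sq : cosh_excess t <= t ^+ 2 * (1 + 4^-1 * cosh_excess t) by nra.
have y0 : 0 <= t / 2 by lra.
move: (y0) (ge_sinh y0) (sinh_le_mul_cosh y0) (expRxMexpNx_1 (t / 2)).
rewrite cosh_excessE (_ : t ^+ 2 = 4 * (t / 2) ^+ 2); last by field.
set a := expR _; set b := expR _; set y := t / 2 => {}y0 sinh_ge tanh_le ab.
have sumE : 4 + (a - b) ^+ 2 = (a + b) ^+ 2 by lra.
have -> : 4 * y ^+ 2 * (1 + 4^-1 * (a - b) ^+ 2) = y ^+ 2 * (4 + (a - b) ^+ 2) by field.
by rewrite sumE -exprMn ler_sqr ?nnegrE; lra.
Qed.

End exponential_inequalities.

Section small_parameter.
Context {R : realType}.

Lemma le_of_forall_small (A B K s0 : R) : 0 < s0 ->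
  (forall s, 0 < s -> s <= s0 -> A <= B + K * s) -> A <= B.
Proof.
move=> s0_gt0 AB; apply/ler_addgt0Pr => e e0.
pose s := Num.min s0 (e / (`|K| + 1)).
have s_gt0 : 0 < s by rewrite lt_min s0_gt0 divr_gt0.
apply: (le_trans (AB s s_gt0 _)); first by rewrite ge_min lexx.
rewrite lerD2l (@le_trans _ _ ((`|K| + 1) * s))//.
  by rewrite ler_wpM2r ?(ltW s_gt0)// (le_trans (ler_norm _))// lerDl.
by rewrite mulrC -ler_pdivlMr// ge_min lexx orbT.
Qed.

End small_parameter.

(** * Gaussian moments *)

Section euclidean.
Context {R : realType}.

Definition sqnorm n (z : 'rV[R]_n) : R := \sum_i z 0 i ^+ 2.
Definition dot n (v z : 'rV[R]_n) : R := \sum_i v 0 i * z 0 i.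

Lemma sqnorm_ge0 n (z : 'rV[R]_n) : 0 <= sqnorm z.
Proof. by apply: sumr_ge0 => i _; exact: sqr_ge0. Qed.

Lemma sqr_enorm n (z : 'rV[R]_n) : enorm z ^+ 2 = sqnorm z.
Proof. by rewrite sqr_sqrtr// sqnorm_ge0. Qed.

Lemma dot_self n (z : 'rV[R]_n) : dot z z = sqnorm z.
Proof. by apply: eq_bigr => i _; rewrite expr2. Qed.

Lemma dotC n (v z : 'rV[R]_n) : dot v z = dot z v.
Proof. by apply: eq_bigr => i _; rewrite mulrC. Qed.

Lemma dotZr n (a : R) (v z : 'rV[R]_n) : dot v (a *: z) = a * dot v z.
Proof. by rewrite mulr_sumr; apply: eq_bigr => i _; rewrite mxE mulrCA. Qed.

Lemma dotZl n (a : R) (v z : 'rV[R]_n) : dot (a *: v) z = a * dot v z.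
Proof. by rewrite dotC dotZr dotC. Qed.

Lemma dotDr n (v y z : 'rV[R]_n) : dot v (y + z) = dot v y + dot v z.
Proof. by rewrite /dot -big_split/=; apply: eq_bigr => i _; rewrite mxE mulrDr. Qed.

Lemma dotBr n (v y z : 'rV[R]_n) : dot v (y - z) = dot v y - dot v z.
Proof. by rewrite dotDr -scaleN1r dotZr mulN1r. Qed.

Lemma dot_delta n (i : 'I_n) (z : 'rV[R]_n) : dot (delta_mx 0 i) z = z 0 i.
Proof.
rewrite /dot (bigD1 i)//= mxE !eqxx mul1r big1 ?addr0// => j ji.
by rewrite mxE eqxx (negbTE ji) mul0r.
Qed.

Lemma sqnormD n (v z : 'rV[R]_n) : sqnorm (v + z) = sqnorm v + 2 * dot v z + sqnorm z.
Proof.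
rewrite /sqnorm /dot mulr_sumr -!big_split/=; apply: eq_bigr => i _.
by rewrite mxE; ring.
Qed.

Lemma sqnormZ n (a : R) (z : 'rV[R]_n) : sqnorm (a *: z) = a ^+ 2 * sqnorm z.
Proof. by rewrite mulr_sumr; apply: eq_bigr => i _; rewrite mxE exprMn. Qed.

Lemma sqnormB n (v z : 'rV[R]_n) : sqnorm (z - v) = sqnorm z - 2 * dot v z + sqnorm v.
Proof. by rewrite sqnormD -scaleN1r sqnormZ dotZr dotC; ring. Qed.

Lemma sqnorm_delta n (i : 'I_n) : sqnorm (delta_mx 0 i : 'rV[R]_n) = 1.
Proof. by rewrite -dot_self dot_delta mxE !eqxx. Qed.

Lemma norm_coord_le n (z : 'rV[R]_n) i : `|z 0 i| <= `|z|.
Proof.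
rewrite [in leRHS]/Num.Def.normr/= mx_normrE.
exact: (@le_bigmax _ _ _ 0 (fun i => `|z i.1 i.2|) (0, i)).
Qed.

Lemma fun_norm_le_sum n (f : R -> R) (z : 'rV[R]_n) : (forall t, 0 <= f t) ->
  f `|z| <= f 0 + \sum_i f `|z 0 i|.
Proof.
move=> f0; have [->|] := eqVneq z 0; first by rewrite normr0 lerDl sumr_ge0.
rewrite -normr_eq0 => /mx_norm_neq0[[i j]]/=; rewrite ord1 => zE.
have -> : `|z| = `|z 0 j| by [].
by rewrite (bigD1 j)//= addrCA lerDl addr_ge0// sumr_ge0.
Qed.

Lemma sqr_norm_le_sqnorm n (z : 'rV[R]_n) : `|z| ^+ 2 <= sqnorm z.
Proof.
have := @fun_norm_le_sum n (fun t => t ^+ 2) z (@sqr_ge0 R).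
rewrite expr0n add0r => /le_trans; apply.
by under eq_bigr do rewrite real_normK ?num_real//.
Qed.

Lemma sqnorm_le n (z : 'rV[R]_n) (B : R) : (forall i, `|z 0 i| <= B) ->
  sqnorm z <= n%:R * B ^+ 2.
Proof.
move=> zB; have -> : n%:R * B ^+ 2 = \sum_(i < n) B ^+ 2.
  by rewrite sumr_const card_ord -[RHS]mulr_natl.
apply: ler_sum => i _; rewrite -[leLHS]real_normK ?num_real//.
by rewrite ler_sqr ?nnegrE// (le_trans _ (zB i)).
Qed.

Lemma norm_dot_le n (v z : 'rV[R]_n) (B : R) : (forall i, `|v 0 i| <= B) ->
  `|dot v z| <= n%:R * B * `|z|.
Proof.
move=> vB; apply: (le_trans (ler_norm_sum _ _ _)).
have -> : n%:R * B * `|z| = \sum_(i < n) B * `|z|.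
  by rewrite sumr_const card_ord -[RHS]mulr_natl mulrA.
by apply: ler_sum => i _; rewrite normrM ler_pM// norm_coord_le.
Qed.

Lemma continuous_dot n (v : 'rV[R]_n) : continuous (dot v).
Proof.
apply: continuous_fun_sum => i; apply: continuous_funZ; exact: continuous_coord.
Qed.

Lemma continuous_sqnorm n : continuous (@sqnorm n).
Proof. by apply: continuous_fun_sum => i; apply: continuous_funX; exact: continuous_coord. Qed.

End euclidean.

Section gaussian.
Context {R : realType}.

Lemma gauss_densityE n t (z : 'rV[R]_n) :
  gauss_density t z = Num.sqrt (4 * pi * t) ^- n * expR (- sqnorm z / (4 * t)).
Proof. by rewrite /gauss_density sqr_enorm. Qed.

Lemma continuous_gauss n t : continuous (@gauss_density R n t).
Proof.
rewrite (funext (@gauss_densityE n t)).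
apply: continuous_funZ; apply: continuous_fun_expR.
apply: continuous_funM; last exact: cst_continuous.
by apply: continuous_funN; exact: continuous_sqnorm.
Qed.

Lemma gauss_gt0 n t (z : 'rV[R]_n) : 0 < t -> 0 < gauss_density t z.
Proof.
move=> t0; rewrite mulr_gt0 ?expR_gt0// invr_gt0 exprn_gt0// sqrtr_gt0.
by rewrite !mulr_gt0// pi_gt0.
Qed.

Lemma gaussN n t (z : 'rV[R]_n) : gauss_density t (- z) = gauss_density t z.
Proof. by rewrite !gauss_densityE -(scaleN1r z) sqnormZ sqrrN expr1n mul1r. Qed.

Lemma gauss_density_shift n t (h z : 'rV[R]_n) : t != 0 ->
  gauss_density t (z - h) = gauss_density t z * expR ((2 * dot h z - sqnorm h) / (4 * t)).
Proof.
move=> t0; rewrite !gauss_densityE -[RHS]mulrA -expRD; congr (_ * expR _).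
by rewrite sqnormB; field.
Qed.

Lemma sqnorm_row_cons m (p : measurableTypeR R * 'rV[R]_m) :
  sqnorm (row_cons p) = p.1 ^+ 2 + sqnorm p.2.
Proof.
rewrite /sqnorm big_ord_recl row_cons0; congr (_ + _).
by apply: eq_bigr => i _; rewrite row_consS.
Qed.

Lemma gauss_row_cons m t (p : measurableTypeR R * 'rV[R]_m) : 0 < t ->
  gauss_density t (row_cons p) = normal_pdf 0 (Num.sqrt (2 * t)) p.1 * gauss_density t p.2.
Proof.
move=> t0; rewrite normal_pdfE ?gt_eqF ?sqrtr_gt0 ?mulr_gt0//.
rewrite /normal_peak /normal_fun subr0 sqr_sqrtr ?mulr_ge0 ?ltW//.
rewrite !gauss_densityE sqnorm_row_cons exprS invfM.
have -> : 2 * t * pi *+ 2 = 4 * pi * t by ring.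
have -> : - (p.1 ^+ 2 + sqnorm p.2) / (4 * t) =
    - p.1 ^+ 2 / (2 * t *+ 2) + - sqnorm p.2 / (4 * t).
  by field; rewrite gt_eqF.
by rewrite expRD; ring.
Qed.

Lemma density_gauss n t : 0 < t -> density (@gauss_density R n t).
Proof.
move=> t0; split; first exact: continuous_gauss.
split=> [x|]; first exact/ltW/gauss_gt0.
elim: n => [|m ih] /=.
  by rewrite gauss_densityE /sqnorm big_ord0 oppr0 mul0r expR0 expr0 invr1 mulr1.
rewrite -(integral_normal_pdf 0 (Num.sqrt (2 * t))); apply: eq_integral => s _.
transitivity (iint (fun x : 'rV_m => (normal_pdf 0 (Num.sqrt (2 * t)) s * gauss_density t x)%:E)).
  by congr iint; apply/funext => x; rewrite -(gauss_row_cons (s, x) t0).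
have gauss_ge0 x : 0 <= @gauss_density R m t x by exact/ltW/gauss_gt0.
rewrite iint_continuous; last 2 first.
- exact/continuous_funZ/continuous_gauss.
- by move=> x; rewrite mulr_ge0// normal_pdf_ge0.
rewrite ge0_integral_continuousZl ?normal_pdf_ge0//; last exact: continuous_gauss.
by rewrite -iint_continuous ?ih ?mule1//; exact: continuous_gauss.
Qed.

Lemma dmean_gauss_expR_dot n t (v : 'rV[R]_n) : 0 < t ->
  dintegrable (gauss_density t) (fun z => expR (dot v z)) /\
  dmean (gauss_density t) (fun z => expR (dot v z)) = expR (t * sqnorm v).
Proof.
move=> t0; have dg := density_gauss n t0.
have cv : continuous (fun z => expR (dot v z)).
  by apply: continuous_fun_expR; exact: continuous_dot.
have tilt z : expR (dot v z) * gauss_density t z =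
    expR (t * sqnorm v) * gauss_density t (z - (2 * t) *: v).
  rewrite gauss_density_shift ?gt_eqF// sqnormZ dotZl [RHS]mulrCA -expRD [LHS]mulrC.
  by congr (_ * expR _); field; rewrite gt_eqF.
have mgf : (\int[lebesgue_rV n]_x (expR (dot v x) * gauss_density t x)%:E =
    (expR (t * sqnorm v))%:E)%E.
  have g0 (z : 'rV[R]_n) : 0 <= gauss_density t z by exact/ltW/gauss_gt0.
  have cg := @continuous_gauss n t.
  under eq_integral do rewrite tilt.
  rewrite ge0_integral_continuousZl ?expR_ge0//; last exact: continuous_addr.
  by rewrite ge0_integral_continuous_addr// integral_density// mule1.
have ig : dintegrable (gauss_density t) (fun z => expR (dot v z)).
  by apply: dintegrable_of_lty => //; rewrite mgf ltry.
by split=> //; apply: EFin_inj; rewrite -dmean_EFin.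
Qed.

End gaussian.

Section gaussian_moments.
Context {R : realType} {n : nat}.
Variable t : R.
Hypothesis t0 : 0 < t.
Implicit Types v z : 'rV[R]_n.

Local Notation gam := (@gauss_density R n t).

Let dg : density gam := density_gauss n t0.

Let mgf c v : dintegrable gam (fun z => expR (c * dot v z)) /\
  dmean gam (fun z => expR (c * dot v z)) = expR (c ^+ 2 * (t * sqnorm v)).
Proof.
have := dmean_gauss_expR_dot (c *: v) t0; rewrite sqnormZ mulrCA.
by under eq_fun do rewrite dotZl.
Qed.

Let continuous_dotX v k : continuous (fun z => dot v z ^+ k).
Proof. by apply: continuous_funX; exact: continuous_dot. Qed.

Let cosh_mean v : dintegrable gam (fun z => cosh_excess (dot v z)) /\
  dmean gam (fun z => cosh_excess (dot v z)) = 2 * (expR (t * sqnorm v) - 1).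
Proof.
have [i1 m1] := mgf 1 v; have [iN mN] := mgf (-1) v; have ic := dintegrable_cst dg (-2).
have -> : (fun z => cosh_excess (dot v z)) =
    (fun z => (expR (1 * dot v z) + expR (-1 * dot v z)) + -2).
  by apply/funext => z; rewrite mul1r mulN1r.
have iS := dintegrableD i1 iN; split; first exact: dintegrableD.
by rewrite (dmeanD iS ic) (dmeanD i1 iN) (dmean_cst dg) m1 mN sqrrN expr1n mul1r; ring.
Qed.

Let cosh_sqr_mean v : dintegrable gam (fun z => cosh_excess (dot v z) ^+ 2) /\
  dmean gam (fun z => cosh_excess (dot v z) ^+ 2) =
  2 * expR (4 * (t * sqnorm v)) - 8 * expR (t * sqnorm v) + 6.
Proof.
have [i2 m2] := mgf 2 v; have [iN mN] := mgf (-2) v; have [ich mch] := cosh_mean v.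
have ic := dintegrable_cst dg (-2).
have -> : (fun z => cosh_excess (dot v z) ^+ 2) =
    (fun z => (expR (2 * dot v z) + expR (-2 * dot v z)) + (-4 * cosh_excess (dot v z) + -2)).
  apply/funext => z; have := expRxMexpNx_1 (dot v z); rewrite /cosh_excess.
  rewrite (_ : 2 * dot v z = dot v z + dot v z); last by ring.
  rewrite (_ : -2 * dot v z = - dot v z - dot v z); last by ring.
  by rewrite !expRD; move: (expR (dot v z)) (expR _) => a b ab; lra.
have iZ := dintegrableZ (-4) ich; have i2N := dintegrableD i2 iN; have iZc := dintegrableD iZ ic.
split; first exact: dintegrableD.
rewrite (dmeanD i2N iZc) (dmeanD i2 iN) (dmeanD iZ ic) (dmeanZ _ ich) (dmean_cst dg) m2 mN mch.
by rewrite sqrrN (_ : 2 ^+ 2 = 4 :> R)//; ring.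
Qed.

Lemma dintegrable_gauss_dot2 v : dintegrable gam (fun z => dot v z ^+ 2).
Proof.
apply: (dintegrable_le dg) (cosh_mean v).1 => // z.
by rewrite ger0_norm ?sqr_ge0// sqr_le_cosh_excess.
Qed.

Lemma dintegrable_gauss_dot v : dintegrable gam (dot v).
Proof.
apply: (dintegrable_le dg) (dintegrableD (dintegrable_cst dg 1) (dintegrable_gauss_dot2 v)).
  exact: continuous_dot.
move=> z; rewrite -[dot v z ^+ 2]real_normK ?num_real//.
by have := sqr_ge0 (`|dot v z| - 1); nra.
Qed.

Let dot4_le_cosh v z : dot v z ^+ 4 <= cosh_excess (dot v z) ^+ 2.
Proof.
have dot2_le := sqr_le_cosh_excess (dot v z); have dot2_ge0 := sqr_ge0 (dot v z).
by rewrite -[4%N]/(2 * 2)%N exprM ler_sqr ?nnegrE// (le_trans dot2_ge0).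
Qed.

Lemma dintegrable_gauss_dot4 v : dintegrable gam (fun z => dot v z ^+ 4).
Proof.
apply: (dintegrable_le dg) (cosh_sqr_mean v).1 => // z.
by rewrite ger0_norm ?dot4_le_cosh// -[4%N]/(2 * 2)%N exprM sqr_ge0.
Qed.

(* The moments are read off the generating function up to an error of higher order in [v], which
   disappears when [v] is scaled to [0]. *)
Let small_scaling v : exists2 s0 : R, 0 < s0 <= 1 &
  forall s, 0 < s -> s <= s0 -> 4 * (s ^+ 2 * (t * sqnorm v)) <= 2^-1.
Proof.
set a := t * sqnorm v; have a0 : 0 <= a by rewrite mulr_ge0 ?sqnorm_ge0// ltW.
have k0 : 0 < 8 * a + 1 by lra.
exists (8 * a + 1)^-1; first by rewrite invr_gt0 k0 invf_le1//; lra.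
move=> s s0; rewrite -[leRHS]mul1r ler_pdivlMr// => sk; nra.
Qed.

Let cosh_sqr_mean_le v : 4 * (t * sqnorm v) <= 2^-1 ->
  dmean gam (fun z => cosh_excess (dot v z) ^+ 2) <= 64 * (t * sqnorm v) ^+ 2.
Proof.
move=> small; rewrite (cosh_sqr_mean v).2; set a := t * sqnorm v in small *.
have a0 : 0 <= a by rewrite mulr_ge0 ?sqnorm_ge0// ltW.
have exp4_le := @expR_le_quadratic _ (4 * a) ltac:(lra) ltac:(lra).
by have exp_ge := expR_ge1Dx a; lra.
Qed.

Lemma dmean_gauss_dot v : dmean gam (dot v) = 0.
Proof.
suff mean_le0 u : dmean gam (dot u) <= 0.
  apply/le_anti; rewrite mean_le0 /= -oppr_le0; have := mean_le0 (-1 *: v).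
  by rewrite (funext (dotZl (-1) v)) (dmeanZ _ (dintegrable_gauss_dot v)) mulN1r.
have [s0 /andP[s0_gt0 _] small] := small_scaling u.
apply: (le_of_forall_small (K := 2 * (t * sqnorm u)) s0_gt0) => s s_gt0 ss0; rewrite add0r.
have {}small := small s s_gt0 ss0.
have [ie me] := mgf s u; have i1 := dintegrable_cst dg (-1).
have := dmean_le dg (dintegrableZ s (dintegrable_gauss_dot u)) (dintegrableD ie i1).
rewrite (dmeanZ _ (dintegrable_gauss_dot u)) (dmeanD ie i1) me (dmean_cst dg).
move=> /(_ (fun z => ltac:(rewrite lerBrDl; exact: expR_ge1Dx))).
set a := t * sqnorm u in small *; have a0 : 0 <= a by rewrite mulr_ge0 ?sqnorm_ge0// ltW.
have sa0 : 0 <= s ^+ 2 * a by rewrite mulr_ge0 ?sqr_ge0.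
have exp_le := @expR_le_quadratic _ (s ^+ 2 * a) sa0 ltac:(lra).
move=> mean_le; rewrite -(ler_pM2l s_gt0); nra.
Qed.

Lemma dmean_gauss_dot2 v : dmean gam (fun z => dot v z ^+ 2) = 2 * (t * sqnorm v).
Proof.
set a := t * sqnorm v; have a0 : 0 <= a by rewrite mulr_ge0 ?sqnorm_ge0// ltW.
have [s0 /andP[s0_gt0 s0_le1]] := small_scaling v; rewrite -/a => small.
suff near s : 0 < s -> s <= s0 ->
    `|dmean gam (fun z => dot v z ^+ 2) - 2 * a| <= 16 * a ^+ 2 * s.
  apply/le_anti/andP; split; apply: (le_of_forall_small (K := 16 * a ^+ 2) s0_gt0) => s s1 s2;
    by have := near s s1 s2; rewrite ler_norml => /andP[]; lra.
move=> s_gt0 ss0; have {}small := small s s_gt0 ss0.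
pose u := s *: v; have uE : t * sqnorm u = s ^+ 2 * a by rewrite sqnormZ mulrCA.
have i2 := dintegrable_gauss_dot2 u; have [ich mch] := cosh_mean u.
have [ich2 _] := cosh_sqr_mean u; have i4 := dintegrableZ 4^-1 ich2.
have upper : dmean gam (fun z => dot u z ^+ 2) <= 2 * (expR (s ^+ 2 * a) - 1).
  by rewrite -uE -mch; apply: (dmean_le dg) => // z; exact: sqr_le_cosh_excess.
have lower : 2 * (expR (s ^+ 2 * a) - 1) - 16 * (s ^+ 2 * a) ^+ 2 <=
    dmean gam (fun z => dot u z ^+ 2).
  have := dmean_le dg ich (dintegrableD i2 i4) (fun z => cosh_excess_le (dot u z)).
  rewrite mch (dmeanD i2 i4) (dmeanZ _ ich2) uE.
  by have := cosh_sqr_mean_le (v := u); rewrite uE => /(_ small); lra.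
move: upper lower.
rewrite (_ : (fun z => dot u z ^+ 2) = (fun z => s ^+ 2 * dot v z ^+ 2)); last first.
  by apply/funext => z; rewrite dotZl exprMn.
rewrite (dmeanZ _ (dintegrable_gauss_dot2 v)); move: (dmean _ _) => m upper lower.
have exp_ge := expR_ge1Dx (s ^+ 2 * a).
have sa0 : 0 <= s ^+ 2 * a by rewrite mulr_ge0 ?sqr_ge0.
have exp_le := @expR_le_quadratic _ (s ^+ 2 * a) sa0 ltac:(lra).
have s2 : 0 < s ^+ 2 by rewrite exprn_gt0.
have near_s2 : `|m - 2 * a| <= 16 * a ^+ 2 * s ^+ 2.
  by rewrite ler_norml; apply/andP; split; rewrite -(ler_pM2l s2); nra.
have s2_le : s ^+ 2 <= s by rewrite expr2 ler_piMl ?(ltW s_gt0)// (le_trans ss0).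
by apply: (le_trans near_s2); have := sqr_ge0 a; nra.
Qed.

Lemma dmean_gauss_dot4_le v : dmean gam (fun z => dot v z ^+ 4) <= 64 * (t * sqnorm v) ^+ 2.
Proof.
have [s /andP[s_gt0 _] small] := small_scaling v; have {}small := small s s_gt0 (lexx s).
pose u := s *: v; have uE : t * sqnorm u = s ^+ 2 * (t * sqnorm v) by rewrite sqnormZ mulrCA.
have i4 := dintegrable_gauss_dot4 u; have [ich2 _] := cosh_sqr_mean u.
have := le_trans (dmean_le dg i4 ich2 (dot4_le_cosh u)) (cosh_sqr_mean_le _).
rewrite uE => /(_ small).
rewrite (_ : (fun z => dot u z ^+ 4) = (fun z => s ^+ 4 * dot v z ^+ 4)); last first.
  by apply/funext => z; rewrite dotZl exprMn.
rewrite (dmeanZ _ (dintegrable_gauss_dot4 v)) exprMn -exprM mulrCA.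
by rewrite ler_pM2l ?exprn_gt0.
Qed.

End gaussian_moments.

Section gaussian_norm_moments.
Context {R : realType} {n : nat}.
Variable e : R.
Hypothesis e0 : 0 < e.

Local Notation gam := (@gauss_density R n (e ^+ 2)).

Let t0 : 0 < e ^+ 2. Proof. exact: exprn_gt0. Qed.
Let dg : density gam := density_gauss n t0.

Let continuous_normX k : continuous (fun z : 'rV[R]_n => `|z| ^+ k).
Proof. by apply: continuous_funX; exact: norm_continuous. Qed.

Let coordX_le_sum k (z : 'rV[R]_n) : (0 < k)%N -> ~~ odd k ->
  `|z| ^+ k <= \sum_(i < n) dot (delta_mx 0 i) z ^+ k.
Proof.
move=> k0 ek; have := fun_norm_le_sum z (fun s => exprn_even_ge0 s ek).
rewrite expr0n gtn_eqF// add0r => /le_trans; apply; apply: ler_sum => i _.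
by rewrite dot_delta -normrX ger0_norm// exprn_even_ge0.
Qed.

Lemma dmean_gauss_norm2_le : dintegrable gam (fun z => `|z| ^+ 2) /\
  dmean gam (fun z => `|z| ^+ 2) <= 2 * n%:R * e ^+ 2.
Proof.
have iS : dintegrable gam (fun z => \sum_(i < n) dot (delta_mx 0 i) z ^+ 2).
  by apply: dintegrable_sum => // i; exact: dintegrable_gauss_dot2.
have i2 : dintegrable gam (fun z => `|z| ^+ 2).
  by apply: (dintegrable_le dg) iS => // z; rewrite ger0_norm ?exprn_ge0// coordX_le_sum.
split=> //; apply: (le_trans (dmean_le dg i2 iS (fun z => coordX_le_sum _ _ _))) => //.
rewrite dmean_sum//; last by move=> i; exact: dintegrable_gauss_dot2.
under eq_bigr do rewrite dmean_gauss_dot2// sqnorm_delta mulr1.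
by rewrite sumr_const card_ord -mulr_natl; lra.
Qed.

Let dmean_gauss_norm4_le : dintegrable gam (fun z => `|z| ^+ 4) /\
  dmean gam (fun z => `|z| ^+ 4) <= 64 * n%:R * e ^+ 4.
Proof.
have iS : dintegrable gam (fun z => \sum_(i < n) dot (delta_mx 0 i) z ^+ 4).
  by apply: dintegrable_sum => // i; exact: dintegrable_gauss_dot4.
have i4 : dintegrable gam (fun z => `|z| ^+ 4).
  by apply: (dintegrable_le dg) iS => // z; rewrite ger0_norm ?exprn_ge0// coordX_le_sum.
split=> //; apply: (le_trans (dmean_le dg i4 iS (fun z => coordX_le_sum _ _ _))) => //.
rewrite dmean_sum//; last by move=> i; exact: dintegrable_gauss_dot4.
apply: (@le_trans _ _ (\sum_(i < n) 64 * e ^+ 4)).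
  apply: ler_sum => i _; have := dmean_gauss_dot4_le t0 (delta_mx 0 i).
  by rewrite sqnorm_delta mulr1 -exprM.
by rewrite sumr_const card_ord -mulr_natl; lra.
Qed.

(* Odd moments are interpolated between even ones: [2 s <= e + s^2 / e]. *)
Let interpolate (s : R) k : 0 <= s -> s ^+ k.+1 <= e * s ^+ k + e^-1 * s ^+ k.+2.
Proof.
move=> s0; rewrite -(ler_pM2l e0) mulrDr [e * (e^-1 * _)]mulrA mulfV ?gt_eqF// mul1r !exprS.
have -> : e * (s * s ^+ k) = s ^+ k * (e * s) by ring.
have -> : e * (e * s ^+ k) + s * (s * s ^+ k) = s ^+ k * (e ^+ 2 + s ^+ 2) by ring.
by rewrite ler_wpM2l ?exprn_ge0//; have := sqr_ge0 (e - s); nra.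
Qed.

Let odd_moment (k : nat) (A B : R) :
  dintegrable gam (fun z => `|z| ^+ k) /\ dmean gam (fun z => `|z| ^+ k) <= A * e ^+ k ->
  dintegrable gam (fun z => `|z| ^+ k.+2) /\ dmean gam (fun z => `|z| ^+ k.+2) <= B * e ^+ k.+2 ->
  dintegrable gam (fun z => `|z| ^+ k.+1) /\
  dmean gam (fun z => `|z| ^+ k.+1) <= (A + B) * e ^+ k.+1.
Proof.
move=> [ik mk] [ik2 mk2]; have iS := dintegrableD (dintegrableZ e ik) (dintegrableZ e^-1 ik2).
have i1 : dintegrable gam (fun z => `|z| ^+ k.+1).
  by apply: (dintegrable_le dg) iS => // z; rewrite ger0_norm ?exprn_ge0// interpolate.
split=> //; apply: (le_trans (dmean_le dg i1 iS (fun z => interpolate _ (normr_ge0 z)))).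
rewrite (dmeanD (dintegrableZ e ik) (dintegrableZ e^-1 ik2)) (dmeanZ _ ik) (dmeanZ _ ik2).
have -> : (A + B) * e ^+ k.+1 = e * (A * e ^+ k) + e^-1 * (B * e ^+ k.+2).
  by rewrite !exprS; field; rewrite gt_eqF.
by rewrite lerD// ler_wpM2l ?invr_ge0// ltW.
Qed.

Lemma dmean_gauss_norm_le : dintegrable gam (fun z => `|z|) /\
  dmean gam (fun z => `|z|) <= (1 + 2 * n%:R) * e.
Proof.
apply: (@odd_moment 0 1 (2 * n%:R)) dmean_gauss_norm2_le.
by split; [exact: dintegrable_cst|rewrite dmean_cst// mul1r].
Qed.

Lemma dmean_gauss_norm3_le : dintegrable gam (fun z => `|z| ^+ 3) /\
  dmean gam (fun z => `|z| ^+ 3) <= 66 * n%:R * e ^+ 3.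
Proof.
have := odd_moment dmean_gauss_norm2_le dmean_gauss_norm4_le.
by have -> : 2 * n%:R + 64 * n%:R = 66 * n%:R :> R by ring.
Qed.

End gaussian_norm_moments.

(** * Mean functionals and functions with Lipschitz gradient *)

Section bounded_continuous.
Context {R : realType} {n : nat}.
Local Notation V := 'rV[R]_n.
Implicit Types (g h : V -> R) (x y : V).

Definition bounded_continuous g : Prop := continuous g /\ exists C, forall x, `|g x| <= C.

Lemma bounded_continuous_cst c : bounded_continuous (fun=> c).
Proof. by split; [exact: cst_continuous|exists `|c|]. Qed.

Lemma bounded_continuousD g h : bounded_continuous g -> bounded_continuous h ->
  bounded_continuous (fun x => g x + h x).
Proof.
move=> [cg [C gC]] [ch [D hD]]; split; first exact: continuous_funD.
by exists (C + D) => x; rewrite (le_trans (ler_normD _ _))// lerD.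
Qed.

Lemma bounded_continuousM g h : bounded_continuous g -> bounded_continuous h ->
  bounded_continuous (fun x => g x * h x).
Proof.
move=> [cg [C gC]] [ch [D hD]]; split; first exact: continuous_funM.
by exists (C * D) => x; rewrite normrM ler_pM.
Qed.

Lemma bounded_continuousZ c g : bounded_continuous g -> bounded_continuous (fun x => c * g x).
Proof. exact/bounded_continuousM/bounded_continuous_cst. Qed.

Lemma bounded_continuousB g h : bounded_continuous g -> bounded_continuous h ->
  bounded_continuous (fun x => g x - h x).
Proof.
move=> bg bh; under eq_fun do rewrite -mulN1r.
by apply: bounded_continuousD => //; exact: bounded_continuousZ.
Qed.

Lemma bounded_continuous_sum (I : Type) (r : seq I) (F : I -> V -> R) :
  (forall i, bounded_continuous (F i)) -> bounded_continuous (fun x => \sum_(i <- r) F i x).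
Proof.
move=> cF; elim: r => [|i r ih].
  by under eq_fun do rewrite big_nil; exact: bounded_continuous_cst.
by under eq_fun do rewrite big_cons; exact: bounded_continuousD.
Qed.

Lemma bounded_continuous_addr g y : bounded_continuous g ->
  bounded_continuous (fun x => g (x + y)).
Proof. by move=> [cg [C gC]]; split; [exact: continuous_addr|exists C]. Qed.

Lemma bounded_continuous_addl g y : bounded_continuous g ->
  bounded_continuous (fun x => g (y + x)).
Proof. by move=> [cg [C gC]]; split; [exact: continuous_addl|exists C]. Qed.

Lemma bounded_continuous_of_bounds g m M : continuous g -> (forall x, m <= g x <= M) ->
  bounded_continuous g.
Proof.
move=> cg gmM; split=> //; exists (`|m| + `|M|) => x; have /andP[mg gM] := gmM x.
have := ler_norm M; have := ler_norm (- m); rewrite normrN.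
have := normr_ge0 M; have := normr_ge0 m.
by rewrite ler_norml => *; apply/andP; split; lra.
Qed.

Lemma bounded_continuous_comp (f : R -> R) g m M : continuous g -> (forall x, m <= g x <= M) ->
  (forall a, m <= a <= M -> {for a, continuous f}) -> bounded_continuous (fun x => f (g x)).
Proof.
move=> cg gmM cf; have [K fK] := continuous_bounded_segment cf.
split; first by apply: continuous_fun_comp => // x; exact/cf/gmM.
by exists K => x; exact/fK/gmM.
Qed.

Lemma bounded_continuous_powR p g : 0 < p -> bounded_continuous g -> (forall x, 0 <= g x) ->
  bounded_continuous (fun x => g x `^ p).
Proof.
move=> p0 [cg [C gC]] g0; split; first exact: continuous_fun_powR.
exists (C `^ p) => x; rewrite ger0_norm ?powR_ge0// ge0_ler_powR ?nnegrE ?(ltW p0)//.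
  exact: le_trans (gC 0).
by rewrite (le_trans (ler_norm _)).
Qed.

Lemma lipschitz_continuous_rV C g :
  (forall x y, `|g (x + y) - g x| <= C * `|y|) -> continuous g.
Proof.
move=> gC x; apply/(@cvgrPdist_lt _ _ _ (nbhs x)) => e e0.
apply/nbhs_ballP; exists (e / (`|C| + 1)) => /=; first by rewrite divr_gt0.
move=> y; rewrite -ball_normE/= => xy.
have := gC y (x - y); rewrite [y + _]addrC subrK => /le_lt_trans; apply.
apply: (@le_lt_trans _ _ ((`|C| + 1) * `|x - y|)); last by rewrite mulrC -ltr_pdivlMr.
by rewrite ler_wpM2r// (le_trans (ler_norm _))// lerDl.
Qed.

End bounded_continuous.

Section mean_functional.
Context {R : realType} {n : nat}.
Local Notation V := 'rV[R]_n.

Record mean_functional (I : (V -> R) -> R) : Prop := MeanFunctional {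
  meanD : forall g h, bounded_continuous g -> bounded_continuous h ->
    I (fun x => g x + h x) = I g + I h;
  meanZ : forall c g, bounded_continuous g -> I (fun x => c * g x) = c * I g;
  mean_cst : forall c, I (fun=> c) = c;
  mean_le : forall g h, bounded_continuous g -> bounded_continuous h ->
    (forall x, g x <= h x) -> I g <= I h }.

Variable I : (V -> R) -> R.
Hypothesis mI : mean_functional I.
Implicit Types g h : V -> R.

Lemma meanB g h : bounded_continuous g -> bounded_continuous h ->
  I (fun x => g x - h x) = I g - I h.
Proof.
move=> bg bh; under [in LHS]eq_fun do rewrite -mulN1r.
by rewrite (meanD mI bg (bounded_continuousZ (-1) bh)) (meanZ mI _ bh) mulN1r.
Qed.

Lemma mean_sum (J : Type) (r : seq J) (F : J -> V -> R) :
  (forall i, bounded_continuous (F i)) ->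
  I (fun x => \sum_(i <- r) F i x) = \sum_(i <- r) I (F i).
Proof.
move=> bF; elim: r => [|i r ih].
  by under eq_fun do rewrite big_nil; rewrite (mean_cst mI) big_nil.
under eq_fun do rewrite big_cons.
by rewrite (meanD mI (bF i) (bounded_continuous_sum r bF)) big_cons ih.
Qed.

Lemma mean_ge0 g : bounded_continuous g -> (forall x, 0 <= g x) -> 0 <= I g.
Proof.
move=> bg g0; rewrite -[leLHS](mean_cst mI).
exact: (mean_le mI (bounded_continuous_cst 0) bg).
Qed.

Lemma mean_bounds g m M : bounded_continuous g -> (forall x, m <= g x <= M) -> m <= I g <= M.
Proof.
move=> bg gmM; rewrite -[in X in X && _](mean_cst mI m) -[in X in _ && X](mean_cst mI M).
apply/andP; split.
  by apply: (mean_le mI (bounded_continuous_cst m) bg) => x; have /andP[] := gmM x.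
by apply: (mean_le mI bg (bounded_continuous_cst M)) => x; have /andP[] := gmM x.
Qed.

Lemma mean_norm_le g C : bounded_continuous g -> (forall x, `|g x| <= C) -> `|I g| <= C.
Proof.
by move=> bg gC; rewrite ler_norml; apply: mean_bounds => // x; rewrite -ler_norml.
Qed.

End mean_functional.

Lemma mean_functional_dmean (R : realType) n (w : 'rV[R]_n -> R) : density w ->
  mean_functional (dmean w).
Proof.
move=> dw; have bi g : bounded_continuous g -> dintegrable w g.
  by move=> [cg [C gC]]; exact: (dintegrable_bounded dw cg gC).
split=> [g h /bi ig /bi ih|c g /bi ig|c|g h /bi ig /bi ih gh].
- exact: dmeanD.
- exact: dmeanZ.
- exact: dmean_cst.
- exact: dmean_le.
Qed.

Section C11.
Context {R : realType} {n : nat}.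
Local Notation V := 'rV[R]_n.
Implicit Types (u : V -> R) (G : V -> V) (x h k : V) (m M C : R).

Definition C11 m M C u G : Prop := [/\ 0 <= C, forall x, m <= u x <= M &
  forall x h, `|u (x + h) - u x - dot (G x) h| <= C * `|h| ^+ 2].

Lemma norm_delta (i : 'I_n) : `|delta_mx 0 i : V| = 1.
Proof.
apply/le_anti/andP; split.
  by rewrite -ler_sqr ?nnegrE// (le_trans (sqr_norm_le_sqnorm _))// sqnorm_delta expr1n.
by have := norm_coord_le (delta_mx 0 i : V) i; rewrite mxE !eqxx normr1.
Qed.

Lemma C11_of_unit_ball m M C B u G : 0 <= C -> 0 <= B -> (forall x, m <= u x <= M) ->
  (forall x i, `|G x 0 i| <= B) ->
  (forall x h, `|h| <= 1 -> `|u (x + h) - u x - dot (G x) h| <= C * `|h| ^+ 2) ->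
  C11 m M (C + (M - m) + n%:R * B) u G.
Proof.
move=> C0 B0 umM GB small; have nB0 : 0 <= n%:R * B by rewrite mulr_ge0.
have mM : 0 <= M - m by have /andP[] := umM 0; lra.
split=> // [|x h]; first lra.
have [h1|h1] := leP `|h| 1.
  by apply: (le_trans (small x h h1)); rewrite ler_wpM2r//; lra.
have hh : `|h| <= `|h| ^+ 2 by rewrite expr2 ler_peMl// ltW.
have oscillation : `|u (x + h) - u x| <= (M - m) * `|h| ^+ 2.
  apply: (@le_trans _ _ (M - m)); last by rewrite ler_peMr// (le_trans _ hh)// ltW.
  have /andP[] := umM (x + h); have /andP[] := umM x.
  by rewrite ler_norml => *; apply/andP; split; lra.
have linear : `|dot (G x) h| <= n%:R * B * `|h| ^+ 2.
  by rewrite (le_trans (norm_dot_le h (GB x)))// ler_wpM2l.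
rewrite (le_trans (ler_normB _ _))// (le_trans (lerD oscillation linear))//.
by rewrite -mulrDl ler_wpM2r//; lra.
Qed.

Section C11_theory.
Variables (m M C : R) (u : V -> R) (G : V -> V).
Hypothesis uC : C11 m M C u G.

Let C0 : 0 <= C. Proof. by case: uC. Qed.
Let umM x : m <= u x <= M. Proof. by case: uC. Qed.
Let uG x h : `|u (x + h) - u x - dot (G x) h| <= C * `|h| ^+ 2. Proof. by case: uC. Qed.

Lemma C11_oscillation x y : `|u x - u y| <= M - m.
Proof.
have /andP[mx xM] := umM x; have /andP[my yM] := umM y.
by rewrite ler_norml; apply/andP; split; lra.
Qed.

Let mM : 0 <= M - m. Proof. exact: le_trans (C11_oscillation 0 0). Qed.

Lemma C11_grad_bound x i : `|G x 0 i| <= M - m + C.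
Proof.
have := uG x (delta_mx 0 i); rewrite dotC dot_delta norm_delta expr1n mulr1.
have := C11_oscillation (x + delta_mx 0 i) x.
by rewrite !ler_norml => /andP[? ?] /andP[? ?]; apply/andP; split; lra.
Qed.

(* Compare the expansions of [u] from [x] to [x + k + h] with those from [x] to [x + k] and from
   [x + k] to [x + k + h], for [h] in the direction of the [i]-th axis with [|h| = |k|]. *)
Lemma C11_grad_lipschitz x k i : `|G (x + k) 0 i - G x 0 i| <= 6 * C * `|k|.
Proof.
have [->|k0] := eqVneq k 0; first by rewrite addr0 subrr !normr0 mulr0.
have k1 : 0 < `|k| by rewrite normr_gt0.
pose h : V := `|k| *: delta_mx 0 i.
have hk : `|h| = `|k| by rewrite normrZ norm_delta mulr1 normr_id.
have := uG x (k + h); have := uG (x + k) h; have := uG x k.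
have dotGh y : dot (G y) h = `|k| * G y 0 i by rewrite dotZr dotC dot_delta.
rewrite addrA dotDr !dotGh hk => near_k near_h near_kh.
have kh_le : C * `|k + h| ^+ 2 <= C * (2 * `|k|) ^+ 2.
  rewrite ler_wpM2l// ler_sqr ?nnegrE ?mulr_ge0// (le_trans (ler_normD _ _))// hk; lra.
rewrite -(ler_pM2l k1) -{1}(normr_id k) -normrM mulrBr.
have -> : `|k| * (6 * C * `|k|) = C * (2 * `|k|) ^+ 2 + C * `|k| ^+ 2 + C * `|k| ^+ 2 by ring.
move: near_k near_h near_kh; rewrite !ler_norml => /andP[? ?] /andP[? ?] /andP[? ?].
by apply/andP; split; lra.
Qed.

Definition C11_lipschitz_constant : R := n%:R * (M - m + C) + C + (M - m).

Lemma C11_lipschitz_constant_ge0 : 0 <= C11_lipschitz_constant.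
Proof. exact: addr_ge0 (addr_ge0 (mulr_ge0 (ler0n _ _) (addr_ge0 mM C0)) C0) mM. Qed.

Lemma C11_lipschitz x h : `|u (x + h) - u x| <= C11_lipschitz_constant * `|h|.
Proof.
have B0 : 0 <= n%:R * (M - m + C) := mulr_ge0 (ler0n _ _) (addr_ge0 mM C0).
have [h1|h1] := leP `|h| 1; last first.
  rewrite (le_trans (C11_oscillation _ _))// -[leLHS]mulr1.
  by rewrite ler_pM ?(ltW h1)// lerDr addr_ge0.
have h2 : C * `|h| ^+ 2 <= C * `|h| by rewrite ler_wpM2l// expr2 ler_piMl.
have mMh : 0 <= (M - m) * `|h| by rewrite mulr_ge0.
have := uG x h; have := norm_dot_le h (C11_grad_bound x).
rewrite /C11_lipschitz_constant (mulrDl _ (M - m) `|h|) (mulrDl _ C `|h|).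
rewrite !ler_norml => /andP[? ?] /andP[? ?].
by apply/andP; split; lra.
Qed.

Lemma C11_bounded_continuous : bounded_continuous u.
Proof.
apply: (bounded_continuous_of_bounds _ umM); apply: lipschitz_continuous_rV.
exact: C11_lipschitz.
Qed.

Lemma C11_grad_bounded_continuous i : bounded_continuous (fun x => G x 0 i).
Proof.
split; last by exists (M - m + C) => x; exact: C11_grad_bound.
by apply: lipschitz_continuous_rV => x h; exact: C11_grad_lipschitz.
Qed.

Lemma C11_dot_grad_bounded_continuous h : bounded_continuous (fun x => dot (G x) h).
Proof.
apply: bounded_continuous_sum => i; apply: bounded_continuousM.
  exact: C11_grad_bounded_continuous.
exact: bounded_continuous_cst.
Qed.

Lemma C11_sqnorm_grad_bounded_continuous : bounded_continuous (fun x => sqnorm (G x)).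
Proof.
apply: bounded_continuous_sum => i; under eq_fun do rewrite expr2.
by apply: bounded_continuousM; exact: C11_grad_bounded_continuous.
Qed.

Lemma C11_comp_bounded_continuous (f : R -> R) :
  (forall a, m <= a <= M -> {for a, continuous f}) -> bounded_continuous (fun x => f (u x)).
Proof. exact: (bounded_continuous_comp (proj1 C11_bounded_continuous) umM). Qed.

Lemma C11_fisher_bounded_continuous (f : R -> R) :
  (forall a, m <= a <= M -> {for a, continuous f}) ->
  bounded_continuous (fun x => f (u x) * sqnorm (G x)).
Proof.
move=> cf; apply: bounded_continuousM; first exact: C11_comp_bounded_continuous.
exact: C11_sqnorm_grad_bounded_continuous.
Qed.

End C11_theory.

Lemma C11_comp m M C u G m' M' K f f1 f2 f3 : C11 m M C u G -> C3_on m M K f f1 f2 f3 ->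
  (forall a, m <= a <= M -> m' <= f a <= M') ->
  C11 m' M' (K * (C11_lipschitz_constant m M C) ^+ 2 + K * C)
    (fun x => f (u x)) (fun x => f1 (u x) *: G x).
Proof.
move=> uC [d0 d1 _ b1 b2 _] fM'; have [C0 umM uG] := uC.
have K0 : 0 <= K by exact: le_trans (b1 _ (umM 0)).
split=> [|x|x h]; first by rewrite addr_ge0// mulr_ge0// sqr_ge0.
  exact/fM'/umM.
set L := C11_lipschitz_constant m M C.
have second : `|f (u (x + h)) - f (u x) - f1 (u x) * (u (x + h) - u x)| <= K * (L * `|h|) ^+ 2.
  rewrite (le_trans (taylor1_le d0 d1 b2 _ _))// ler_wpM2l// ler_sqr ?nnegrE//.
    exact: C11_lipschitz.
  by rewrite mulr_ge0//; exact: (C11_lipschitz_constant_ge0 uC).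
have first_order : `|f1 (u x) * (u (x + h) - u x - dot (G x) h)| <= K * (C * `|h| ^+ 2).
  by rewrite normrM ler_pM// ?b1// uG.
rewrite dotZl (_ : (K * L ^+ 2 + K * C) * `|h| ^+ 2 = K * (L * `|h|) ^+ 2 + K * (C * `|h| ^+ 2));
  last by ring.
rewrite (_ : _ - _ - _ = (f (u (x + h)) - f (u x) - f1 (u x) * (u (x + h) - u x)) +
  f1 (u x) * (u (x + h) - u x - dot (G x) h)); last by ring.
by rewrite (le_trans (ler_normD _ _))// lerD.
Qed.

End C11.

(** * The heat semigroup *)

Section heat.
Context {R : realType} {n : nat}.
Local Notation V := 'rV[R]_n.
Local Notation gam := (@gauss_density R n).
Implicit Types (g u : V -> R) (G : V -> V) (x y z h : V) (m M B C t : R).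

(* [gauss_density 0] is degenerate, hence the separate case [t = 0]. *)
Definition heat t g x : R := if t == 0 then g x else dmean (gam t) (fun z => g (x + z)).

Definition heat_row t G x : V := \row_i heat t (fun y => G y 0 i) x.

Lemma heat0 g : heat 0 g = g.
Proof. by apply/funext => x; rewrite /heat eqxx. Qed.

Lemma heatE t g x : 0 < t -> heat t g x = dmean (gam t) (fun z => g (x + z)).
Proof. by move=> t0; rewrite /heat gt_eqF. Qed.

Lemma heat_addr t g x h : heat t g (x + h) = heat t (fun y => g (y + h)) x.
Proof. by rewrite /heat; case: ifP => // _; under eq_fun do rewrite addrAC. Qed.

Lemma mean_functional_heat t x : 0 <= t -> mean_functional (fun g => heat t g x).
Proof.
rewrite le_eqVlt => /predU1P[<-|t0].
  by split=> *; rewrite !heat0.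
have mI := mean_functional_dmean (density_gauss n t0).
have bcx g := @bounded_continuous_addl R n g x.
split=> [g h /bcx bg /bcx bh|c g /bcx bg|c|g h /bcx bg /bcx bh gh]; rewrite !heatE//.
- exact: (meanD mI).
- exact: (meanZ mI).
- exact: (mean_cst mI).
- exact: (mean_le mI).
Qed.

Lemma dot_heat_row t G x h : 0 <= t -> (forall i, bounded_continuous (fun y => G y 0 i)) ->
  dot (heat_row t G x) h = heat t (fun y => dot (G y) h) x.
Proof.
move=> t0 bG; have mH := mean_functional_heat x t0.
rewrite (mean_sum mH); last first.
  by move=> i; apply: bounded_continuousM => //; exact: bounded_continuous_cst.
apply: eq_bigr => i _; rewrite mxE mulrC -(meanZ mH)//.
by congr heat; apply/funext => y; rewrite mulrC.
Qed.

Lemma heat_C11 t m M C u G : 0 <= t -> C11 m M C u G ->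
  C11 m M C (heat t u) (heat_row t G).
Proof.
move=> t0 uC; have bu := C11_bounded_continuous uC.
have [C0 umM uG] := uC; split=> // [x|x h].
  exact: (mean_bounds (mean_functional_heat x t0)).
have mH := mean_functional_heat x t0.
have bGh := C11_dot_grad_bounded_continuous uC h.
have buh := bounded_continuous_addr h bu.
rewrite (dot_heat_row _ _ t0 (C11_grad_bounded_continuous uC)) heat_addr.
rewrite -(meanB mH buh bu) -(meanB mH (bounded_continuousB buh bu) bGh).
apply: (mean_norm_le mH) => // ; exact: bounded_continuousB (bounded_continuousB _ _) _.
Qed.

End heat.

Section heat_smoothing.
Context {R : realType} {n : nat}.
Local Notation V := 'rV[R]_n.
Variable t : R.
Hypothesis t0 : 0 < t.
Implicit Types (g : V -> R) (x z h : V).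

Local Notation gam := (@gauss_density R n t).
Local Notation k := (n%:R / (2 * t)).

Let dg : density gam := density_gauss n t0.

Let k0 : 0 <= k. Proof. by rewrite divr_ge0// mulr_ge0// ltW. Qed.

(* The Radon-Nikodym weight of the Gaussian translated by [h] (Cameron-Martin). *)
Definition shift_exponent (h z : V) : R := (2 * dot h z - sqnorm h) / (4 * t).

Lemma heat_shift_weight g x h : continuous g ->
  heat t g (x + h) = dmean gam (fun z => g (x + z) * expR (shift_exponent h z)).
Proof.
move=> cg; rewrite heatE// /dmean.
pose tilted z := g (x + z) * gam (z - h).
have m_tilted : measurable_fun setT tilted.
  apply: continuous_measurable_fun_rV; apply: continuous_funM; first exact: continuous_addl.
  by apply: continuous_addr; exact: continuous_gauss.
transitivity (\int[lebesgue_rV n]_z tilted (z + h)).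
  by apply: eq_Rintegral => z _; rewrite /tilted addrK [z + h]addrC addrA.
apply: (etrans (Rintegral_rV_addr h m_tilted)); apply: eq_Rintegral => z _.
by rewrite /tilted gauss_density_shift ?gt_eqF// /shift_exponent; ring.
Qed.

Let linear_le h z : `|dot h z / (2 * t)| <= `|h| * (k * `|z|).
Proof.
rewrite normrM [`|(2 * t)^-1|]ger0_norm ?invr_ge0 ?mulr_ge0 ?(ltW t0)//.
have -> : `|h| * (k * `|z|) = n%:R * `|h| * `|z| / (2 * t) by ring.
rewrite ler_wpM2r ?invr_ge0 ?mulr_ge0 ?(ltW t0)//.
by apply: norm_dot_le => i; exact: norm_coord_le.
Qed.

Let quadratic_le h : `|sqnorm h / (4 * t)| <= `|h| ^+ 2 * k.
Proof.
have t40 : 0 < 4 * t by rewrite mulr_gt0.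
rewrite ger0_norm ?divr_ge0 ?sqnorm_ge0 ?(ltW t40)// ler_pdivrMr//.
have -> : `|h| ^+ 2 * k * (4 * t) = 2 * (n%:R * `|h| ^+ 2) by field; rewrite gt_eqF.
apply: (le_trans (sqnorm_le (norm_coord_le h))).
by rewrite ler_peMl ?ler1n// mulr_ge0 ?exprn_ge0.
Qed.

Lemma norm_shift_exponent_le h z : `|h| <= 1 ->
  `|shift_exponent h z| <= `|h| * (k * (`|z| + 1)).
Proof.
move=> h1; have -> : shift_exponent h z = dot h z / (2 * t) - sqnorm h / (4 * t).
  by rewrite /shift_exponent; field; rewrite gt_eqF.
have h2 : `|h| ^+ 2 * k <= `|h| * k by rewrite ler_wpM2r// expr2 ler_piMl.
by rewrite (le_trans (ler_normB _ _))// !mulrDr mulr1 lerD// (le_trans (quadratic_le h)).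
Qed.

Lemma shift_weight_expansion h z : `|h| <= 1 ->
  `|expR (shift_exponent h z) - 1 - dot h z / (2 * t)| <=
  `|h| ^+ 2 * (expR (2 * k * (`|z| + 1)) + k).
Proof.
move=> h1; set s := shift_exponent h z; set y := k * (`|z| + 1).
have y0 : 0 <= y by rewrite mulr_ge0// addr_ge0.
have s_le : `|s| <= `|h| * y := norm_shift_exponent_le z h1.
have -> : expR s - 1 - dot h z / (2 * t) = (expR s - 1 - s) - sqnorm h / (4 * t).
  by rewrite {3}/s /shift_exponent; field; rewrite gt_eqF.
rewrite (le_trans (ler_normB _ _))// mulrDr lerD// (le_trans (expR_taylor1_le _))//.
have -> : `|h| ^+ 2 * expR (2 * k * (`|z| + 1)) = expR y * (`|h| ^+ 2 * expR y).
  by rewrite [RHS]mulrCA -expRD; congr (_ * expR _); rewrite /y; ring.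
have exp_s : expR `|s| <= expR y by rewrite ler_expR (le_trans s_le)// ler_piMl.
have y_sqr : y ^+ 2 <= expR y.
  have expN_le1 : expR (- y) <= 1 by rewrite expR_le1 oppr_le0.
  by have := sqr_le_cosh_excess y; rewrite /cosh_excess; lra.
have s_sqr : s ^+ 2 <= `|h| ^+ 2 * expR y.
  apply: (@le_trans _ _ (`|h| ^+ 2 * y ^+ 2)); last by rewrite ler_wpM2l ?exprn_ge0.
  by rewrite -exprMn -[leLHS]real_normK ?num_real// ler_sqr ?nnegrE// mulr_ge0.
by rewrite ler_pM ?expR_ge0 ?sqr_ge0.
Qed.

Lemma dintegrable_gauss_expR_norm c : dintegrable gam (fun z => expR (c * `|z|)).
Proof.
have iexp a i : dintegrable gam (fun z : V => expR (a * z 0 i)).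
  have := (dmean_gauss_expR_dot (a *: delta_mx 0 i) t0).1.
  by under eq_fun do rewrite dotZl dot_delta.
apply: (dintegrable_le dg _ _ (h := fun z => 1 + \sum_i (expR (c * z 0 i) + expR (- c * z 0 i)))).
- by apply: continuous_fun_expR; apply: continuous_funZ; exact: norm_continuous.
- move=> z; rewrite ger0_norm ?expR_ge0//.
  have := fun_norm_le_sum (f := fun s => expR (c * s)) z (fun s => expR_ge0 _).
  rewrite mulr0 expR0 => /le_trans; apply; rewrite lerD2l; apply: ler_sum => i _.
  by have [_|_] := ger0P (z 0 i); rewrite ?mulrN -?mulNr ?lerDl ?lerDr expR_ge0.
- apply: dintegrableD; first exact: dintegrable_cst.
  by apply: dintegrable_sum => // i; exact: dintegrableD.
Qed.

Section bounded_initial_value.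
Variables (g : V -> R) (B : R).
Hypotheses (cg : continuous g) (gB : forall x, `|g x| <= B).

Let B0 : 0 <= B. Proof. exact: le_trans (gB 0). Qed.

Let dintegrable_mul x (f : V -> R) : dintegrable gam f ->
  dintegrable gam (fun z => g (x + z) * f z).
Proof.
move=> jf; apply: (dintegrable_le dg _ _ (dintegrableZ B (dintegrable_norm dg jf))).
  by apply: continuous_funM; [exact: continuous_addl|case: jf].
by move=> z; rewrite normrM ler_wpM2r.
Qed.

Let dmean_mul_le x (f h : V -> R) : dintegrable gam f -> dintegrable gam h ->
  (forall z, `|f z| <= h z) -> `|dmean gam (fun z => g (x + z) * f z)| <= B * dmean gam h.
Proof.
move=> jf jh fh; rewrite -(dmeanZ _ jh); apply: dmean_norm_le => //.
- exact: dintegrable_mul.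
- exact: dintegrableZ.
- by move=> z; rewrite normrM ler_pM.
Qed.

Definition heat_grad x : V := \row_i dmean gam (fun z => g (x + z) * (z 0 i / (2 * t))).

Let dintegrable_linear h : dintegrable gam (fun z => dot h z / (2 * t)).
Proof. by under eq_fun do rewrite mulrC; apply: dintegrableZ; exact: dintegrable_gauss_dot. Qed.

Lemma dot_heat_grad x h :
  dot (heat_grad x) h = dmean gam (fun z => g (x + z) * (dot h z / (2 * t))).
Proof.
have icoord i : dintegrable gam (fun z => g (x + z) * (z 0 i / (2 * t))).
  apply: dintegrable_mul; under eq_fun do rewrite -(dot_delta i); exact: dintegrable_linear.
have -> : (fun z => g (x + z) * (dot h z / (2 * t))) =
    (fun z => \sum_i h 0 i * (g (x + z) * (z 0 i / (2 * t)))).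
  by apply/funext => z; rewrite mulr_suml mulr_sumr; apply: eq_bigr => i _; ring.
rewrite (dmean_sum dg) => [|i]; last exact: dintegrableZ.
by apply: eq_bigr => i _; rewrite mxE (dmeanZ _ (icoord i)) mulrC.
Qed.

Lemma heat_grad_expansion x h : `|h| <= 1 ->
  `|heat t g (x + h) - heat t g x - dot (heat_grad x) h| <=
  B * dmean gam (fun z => expR (2 * k * (`|z| + 1)) + k) * `|h| ^+ 2.
Proof.
move=> h1.
have iW : dintegrable gam (fun z => expR (2 * k * (`|z| + 1)) + k).
  apply: dintegrableD; last exact: dintegrable_cst.
  under eq_fun do rewrite mulrDr mulr1 addrC expRD.
  by apply: dintegrableZ; exact: dintegrable_gauss_expR_norm.
have iexp : dintegrable gam (fun z => expR (shift_exponent h z)).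
  have [ie _] := dmean_gauss_expR_dot ((2 * t)^-1 *: h) t0.
  have -> : (fun z => expR (shift_exponent h z)) =
      (fun z => expR (- sqnorm h / (4 * t)) * expR (dot ((2 * t)^-1 *: h) z)).
    apply/funext => z; rewrite -expRD dotZl /shift_exponent; congr expR.
    by field; rewrite gt_eqF.
  exact: dintegrableZ.
have ig : dintegrable gam (fun z => g (x + z)).
  by apply: (dintegrable_bounded dg (C := B)) => //; exact: continuous_addl.
have igexp := dintegrable_mul x iexp; have igN := dintegrableZ (-1) ig.
have iglin := dintegrable_mul x (dintegrable_linear h); have iglinN := dintegrableZ (-1) iglin.
have -> : heat t g (x + h) - heat t g x - dot (heat_grad x) h =
    dmean gam (fun z => g (x + z) * (expR (shift_exponent h z) - 1 - dot h z / (2 * t))).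
  rewrite (_ : (fun z => _ * (_ - _)) = (fun z => g (x + z) * expR (shift_exponent h z) +
    -1 * g (x + z) + -1 * (g (x + z) * (dot h z / (2 * t))))); last by apply/funext => z; ring.
  rewrite (dmeanD (dintegrableD igexp igN) iglinN) (dmeanD igexp igN).
  rewrite (dmeanZ _ ig) (dmeanZ _ iglin) !mulN1r.
  by rewrite heat_shift_weight// heatE// dot_heat_grad.
rewrite mulrAC -[_ * _ * dmean _ _]mulrA -(dmeanZ _ iW).
apply: dmean_mul_le => [||z]; [|exact: dintegrableZ|exact: shift_weight_expansion].
have i1 := dintegrable_cst dg (-1); have iN := dintegrableZ (-1) (dintegrable_linear h).
have := dintegrableD (dintegrableD iexp i1) iN.
by under eq_fun do rewrite mulN1r.
Qed.

Lemma heat_smoothing_bounded m M : (forall x, m <= g x <= M) ->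
  exists C G, C11 m M C (heat t g) G.
Proof.
move=> gmM; have mH x := mean_functional_heat (n := n) x (ltW t0).
pose W z := expR (2 * k * (`|z| + 1)) + k.
pose D := dmean gam (fun z : V => (2 * t)^-1 * expR (1 * `|z|)).
have D0 : 0 <= D.
  by apply: (dmean_ge0 dg) => z; rewrite mulr_ge0 ?expR_ge0// invr_ge0 mulr_ge0// ltW.
exists (B * dmean gam W + (M - m) + n%:R * (B * D)), heat_grad.
apply: C11_of_unit_ball => [||x|x i|x h].
- by rewrite mulr_ge0//; apply: (dmean_ge0 dg) => z; rewrite addr_ge0// expR_ge0.
- by rewrite mulr_ge0.
- by apply: (mean_bounds (mH x)) => //; split=> //; exists B.
- rewrite mxE; apply: dmean_mul_le => [||z].
  + under eq_fun do rewrite -(dot_delta i); exact: dintegrable_linear.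
  + exact/dintegrableZ/dintegrable_gauss_expR_norm.
  + rewrite normrM [_ * `|_^-1|]mulrC [`|(2 * t)^-1|]ger0_norm ?invr_ge0 ?mulr_ge0 ?(ltW t0)//.
    rewrite ler_wpM2l ?invr_ge0 ?mulr_ge0 ?(ltW t0)// mul1r (le_trans (norm_coord_le z i))//.
    by have := expR_ge1Dx `|z|; lra.
- exact: heat_grad_expansion.
Qed.

End bounded_initial_value.
End heat_smoothing.

Section heat_bounded_continuous.
Context {R : realType} {n : nat}.
Implicit Types (g : 'rV[R]_n -> R) (t m M : R).

Lemma heat_smoothing t g m M : 0 < t -> continuous g -> (forall x, m <= g x <= M) ->
  exists C G, C11 m M C (heat t g) G.
Proof.
move=> t0 cg gmM; have [_ [B gB]] := bounded_continuous_of_bounds cg gmM.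
exact: (heat_smoothing_bounded t0 cg gB gmM).
Qed.

Lemma heat_bounded_continuous t g : 0 <= t -> bounded_continuous g ->
  bounded_continuous (heat t g).
Proof.
rewrite le_eqVlt => /predU1P[<-|t0]; first by rewrite heat0.
move=> [cg [B gB]]; have gI x : - B <= g x <= B by rewrite -ler_norml.
by have [C [G]] := heat_smoothing t0 cg gI; exact: C11_bounded_continuous.
Qed.

End heat_bounded_continuous.

Section convolution.
Context {R : realType} {n : nat}.
Local Notation V := 'rV[R]_n.
Local Notation leb := (lebesgue_rV n).
Local Notation gam := (@gauss_density R n).
Implicit Types (g u w phi : V -> R) (x y z h : V) (a b t : R).

Definition gauss_conv b w y : R := dmean w (fun z => gam b (y - z)).

Lemma gauss_conv_gauss a b : 0 < a -> 0 < b -> gauss_conv b (gam a) = gam (a + b).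
Proof.
move=> a0 b0; pose c := a * b / (a + b); pose la := a / (a + b).
have ab0 : 0 < a + b by rewrite addr_gt0.
have c0 : 0 < c by rewrite divr_gt0// mulr_gt0.
pose K t : R := Num.sqrt (4 * pi * t) ^- n.
have pi4_ge0 t : 0 < t -> 0 <= 4 * pi * t by move=> t0; rewrite !mulr_ge0// ?pi_ge0// ltW.
have normalization : K b * K a = K (a + b) * K c.
  rewrite /K -[LHS]invfM -[RHS]invfM -[in LHS]exprMn -[in RHS]exprMn.
  rewrite -(sqrtrM _ (pi4_ge0 b b0)) -(sqrtrM _ (pi4_ge0 _ ab0)); congr (Num.sqrt _ ^- n).
  by rewrite /c; field; rewrite gt_eqF.
have complete_square y z : gam b (y - z) * gam a z = gam (a + b) y * gam c (z - la *: y).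
  rewrite !gauss_densityE -!/(K _) mulrACA [RHS]mulrACA normalization -[in LHS]expRD -[in RHS]expRD.
  congr (_ * expR _); rewrite sqnormB (sqnormB (la *: y)) sqnormZ dotZl (dotC z y) /c /la.
  by field; rewrite !gt_eqF.
apply/funext => y; rewrite /gauss_conv /dmean /Rintegral.
have cg := @continuous_gauss R n c; have g0 z : 0 <= gam c z by exact/ltW/gauss_gt0.
under eq_integral do rewrite complete_square.
rewrite ge0_integral_continuousZl//; last 2 first.
- exact/ltW/gauss_gt0.
- exact: continuous_addr.
by rewrite ge0_integral_continuous_addr// (integral_density (density_gauss n c0)) mule1.
Qed.

Lemma heat_gauss a b : 0 < a -> 0 < b -> heat a (gam b) = gam (a + b).
Proof.
move=> a0 b0; apply/funext => x; rewrite heatE// -[RHS]gaussN -(gauss_conv_gauss a0 b0) /gauss_conv.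
by congr (dmean _ _); apply/funext => z; rewrite -opprD gaussN.
Qed.

Lemma gauss_bounds b z : 0 < b -> 0 <= gam b z <= gam b 0.
Proof.
move=> b0; rewrite ltW ?gauss_gt0//= !gauss_densityE.
have /ltW K0 : 0 < Num.sqrt (4 * pi * b) ^- n.
  by rewrite invr_gt0 exprn_gt0// sqrtr_gt0 !mulr_gt0// pi_gt0.
rewrite ler_wpM2l// ler_expR ler_wpM2r ?invr_ge0 ?mulr_ge0 ?(ltW b0)//.
by rewrite lerN2 /sqnorm big1 ?sqnorm_ge0// => i _; rewrite mxE expr0n.
Qed.

Lemma gauss_lipschitz b : 0 < b -> exists L, forall z h, `|gam b (z + h) - gam b z| <= L * `|h|.
Proof.
move=> b0; have b20 : 0 < b / 2 by rewrite divr_gt0.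
have [C [G GC]] := heat_smoothing b20 (@continuous_gauss R n (b / 2)) (fun z => gauss_bounds z b20).
exists (@C11_lipschitz_constant R n 0 (gam (b / 2) 0) C) => z h.
by have := C11_lipschitz GC z h; rewrite heat_gauss// -splitr.
Qed.

Section fixed_density.
Variables (b : R) (w : V -> R).
Hypotheses (b0 : 0 < b) (dw : density w).

Let cw : continuous w := density_continuous dw.
Let w0 x : 0 <= w x := density_ge0 dw x.
Let gauss_ge0 z : 0 <= gam b z. Proof. exact/ltW/gauss_gt0. Qed.

Let bounded_continuous_kernel y : bounded_continuous (fun z => gam b (y - z)).
Proof.
apply: (bounded_continuous_of_bounds _ (fun z => gauss_bounds (y - z) b0)).
have -> : (fun z => gam b (y - z)) = (fun z => gam b (z - y)).
  by apply/funext => z; rewrite -gaussN opprB.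
exact/continuous_addr/continuous_gauss.
Qed.

Let dintegrable_kernel y : dintegrable w (fun z => gam b (y - z)).
Proof.
by have [ck [C kC]] := bounded_continuous_kernel y; exact: (dintegrable_bounded dw ck kC).
Qed.

Lemma gauss_conv_ge0 y : 0 <= gauss_conv b w y.
Proof. exact: (dmean_ge0 dw). Qed.

Lemma continuous_gauss_conv : continuous (gauss_conv b w).
Proof.
have [L gL] := gauss_lipschitz b0; have mI := mean_functional_dmean dw.
apply: (@lipschitz_continuous_rV _ _ L) => y h.
rewrite -(meanB mI (bounded_continuous_kernel _) (bounded_continuous_kernel _)).
apply: (mean_norm_le mI); first exact: bounded_continuousB.
by move=> z; rewrite addrAC.
Qed.

Lemma gauss_conv_gt0 y : 0 < gauss_conv b w y.
Proof.
rewrite lt_def gauss_conv_ge0 andbT; apply/eqP => conv0.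
have := dmean_EFin (dintegrable_kernel y); rewrite -/(gauss_conv b w y) conv0; apply/eqP.
rewrite gt_eqF// integral_continuous_gt0//.
- by apply: continuous_funM => //; case: (bounded_continuous_kernel y).
- by move=> z; rewrite mulr_ge0.
have [z wz] := density_gt0_exists dw.
by exists z; rewrite mulr_gt0// gauss_gt0.
Qed.

(* Tonelli, after translating the inner integral by the outer variable. *)
Lemma integral_mul_gauss_conv phi : continuous phi -> (forall y, 0 <= phi y) ->
  (\int[leb]_x \int[leb]_z (phi (x + z)%R * w x * gam b z)%:E =
   \int[leb]_y (phi y * gauss_conv b w y)%:E)%E.
Proof.
move=> cphi phi0; pose F (p : V * V) : \bar R := (phi p.2 * (gam b (p.2 - p.1) * w p.1))%:E.
have mF : measurable_fun setT F.
  apply/measurable_EFinP; apply: measurable_funM; first exact: measurable_fun_continuous_comp_rV.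
  apply: measurable_funM; last exact: measurable_fun_continuous_comp_rV.
  apply: measurable_fun_continuous_comp_rV; first exact: continuous_gauss.
  exact: measurable_funB_rV.
have F0 p : (0 <= F p)%E by rewrite lee_fin !mulr_ge0.
transitivity (\int[leb]_x \int[leb]_z F (x, z))%E.
  apply: eq_integral => x _; pose Fx y := phi y * (gam b (y - x) * w x).
  have cFx : continuous Fx.
    apply: continuous_funM => //; apply: continuous_funM; last exact: cst_continuous.
    exact/continuous_addr/continuous_gauss.
  have Fx0 y : 0 <= Fx y by rewrite !mulr_ge0.
  rewrite -[RHS](ge0_integral_continuous_addr x cFx Fx0).
  by apply: eq_integral => z _; rewrite /Fx addrK [z + x]addrC; congr (_%:E); ring.
rewrite (fubini_tonelli F mF F0); apply: eq_integral => y _; rewrite /F/=.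
rewrite ge0_integral_continuousZl//; last 2 first.
- by apply: continuous_funM => //; case: (bounded_continuous_kernel y).
- by move=> x; rewrite mulr_ge0.
by rewrite (dmean_EFin (dintegrable_kernel y)).
Qed.

Let integral_gauss_conv_heat g : bounded_continuous g -> (forall x, 0 <= g x) ->
  (\int[leb]_y (g y * gauss_conv b w y)%:E = (dmean w (heat b g))%:E)%E.
Proof.
move=> bg g0; have [cg _] := bg.
have [ch [B hB]] := heat_bounded_continuous (ltW b0) bg.
rewrite -integral_mul_gauss_conv// -(dmean_EFin (dintegrable_bounded dw ch hB)).
apply: eq_integral => x _; have cgx : continuous (fun z => g (x + z)) by exact: continuous_addl.
under eq_integral do rewrite mulrAC mulrC.
rewrite ge0_integral_continuousZl//; last 2 first.
- by apply: continuous_funM => //; exact: continuous_gauss.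
- by move=> z; rewrite mulr_ge0.
have [_ [C gC]] := bg; have dg := density_gauss n b0.
by rewrite heatE// (dmean_EFin (dintegrable_bounded dg cgx (fun z => gC _))) -EFinM mulrC.
Qed.

Lemma density_gauss_conv : density (gauss_conv b w).
Proof.
split; first exact: continuous_gauss_conv.
split=> [|]; first exact: gauss_conv_ge0.
rewrite iint_continuous; [|exact: continuous_gauss_conv|exact: gauss_conv_ge0].
have := integral_gauss_conv_heat (bounded_continuous_cst 1) (fun=> ler01).
under eq_integral do rewrite mul1r; move=> ->.
have mH x := mean_functional_heat (n := n) x (ltW b0).
have -> : heat b (fun _ : V => 1) = (fun=> 1) by apply/funext => x; exact: (mean_cst (mH x)).
by rewrite dmean_cst.
Qed.

Lemma dmean_gauss_conv g : bounded_continuous g -> dmean (gauss_conv b w) g = dmean w (heat b g).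
Proof.
move=> bg; have [cg [B gB]] := bg; have mc := mean_functional_dmean density_gauss_conv.
have mw := mean_functional_dmean dw; have mH x := mean_functional_heat (n := n) x (ltW b0).
have bB := @bounded_continuous_cst R n B; have bgB := bounded_continuousD bg bB.
have gB_ge0 x : 0 <= g x + B by have := gB x; rewrite ler_norml => /andP[]; lra.
have [cgB [D gD]] := bgB.
have := integral_gauss_conv_heat bgB gB_ge0.
rewrite (dmean_EFin (dintegrable_bounded density_gauss_conv cgB gD)).
rewrite (meanD mc bg bB) (mean_cst mc).
have -> : heat b (fun x => g x + B) = (fun x => heat b g x + B).
  by apply/funext => x; rewrite (meanD (mH x) bg bB) (mean_cst (mH x)).
rewrite (meanD mw (heat_bounded_continuous (ltW b0) bg) bB) (mean_cst mw).
by move=> -[/addIr].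
Qed.

End fixed_density.

Lemma heat_semigroup a b g : 0 <= a -> 0 <= b -> bounded_continuous g ->
  heat a (heat b g) = heat (a + b) g.
Proof.
rewrite le_eqVlt => /predU1P[<-|a0]; first by rewrite heat0 add0r.
rewrite le_eqVlt => /predU1P[<-|b0] bg; first by rewrite heat0 addr0.
apply/funext => x; have bgx := bounded_continuous_addl x bg.
rewrite (heatE (heat b g) x a0) (heatE g x (addr_gt0 a0 b0)) -(gauss_conv_gauss a0 b0).
rewrite (dmean_gauss_conv b0 (density_gauss n a0) bgx); congr (dmean _ _); apply/funext => z.
rewrite [x + z]addrC (heat_addr b g z x); congr (heat b _ z).
by apply/funext => y; rewrite addrC.
Qed.

End convolution.

Section heat_comp.
Context {R : realType} {n : nat}.
Local Notation V := 'rV[R]_n.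
Variables (m M C K : R).

Local Notation B := (M - m + C).
Local Notation L := (@C11_lipschitz_constant R n m M C).

Definition taylor_constant : R := K * (C * L + L ^+ 3).

Definition fisher_lipschitz_constant : R := K * (n%:R * (L * B ^+ 2 + 12 * (C * B))).

Definition heat_comp_constant : R :=
  taylor_constant * (66 * n%:R) + fisher_lipschitz_constant * (1 + 2 * n%:R) +
  K * (2 * n%:R * C) ^+ 2.

Variables (u : V -> R) (G : V -> V) (f f1 f2 f3 : R -> R).
Hypotheses (uC : C11 m M C u G) (fC : C3_on m M K f f1 f2 f3).
Implicit Types (x z : V) (e : R).

Let C0 : 0 <= C. Proof. by case: uC. Qed.
Let umM x : m <= u x <= M. Proof. by case: uC. Qed.
Let uG x h : `|u (x + h) - u x - dot (G x) h| <= C * `|h| ^+ 2. Proof. by case: uC. Qed.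
Let L0 : 0 <= L. Proof. exact: C11_lipschitz_constant_ge0 uC. Qed.
Let B0 : 0 <= B. Proof. exact: addr_ge0 (le_trans (normr_ge0 _) (C11_oscillation uC 0 0)) C0. Qed.
Let K0 : 0 <= K. Proof. exact: le_trans (C3_on_bound1 fC (umM 0)). Qed.

Lemma taylor_constant_ge0 : 0 <= taylor_constant.
Proof. exact: mulr_ge0 K0 (addr_ge0 (mulr_ge0 C0 L0) (exprn_ge0 3 L0)). Qed.

Lemma fisher_lipschitz_constant_ge0 : 0 <= fisher_lipschitz_constant.
Proof.
apply: (mulr_ge0 K0 (mulr_ge0 (ler0n _ _) (addr_ge0 (mulr_ge0 L0 (exprn_ge0 2 B0)) _))).
exact: mulr_ge0 (ler0n _ 12) (mulr_ge0 C0 B0).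
Qed.

Lemma heat_comp_constant_ge0 : 0 <= heat_comp_constant.
Proof.
have n0 : 0 <= n%:R :> R by [].
apply: (addr_ge0 (addr_ge0 (mulr_ge0 taylor_constant_ge0 _)
  (mulr_ge0 fisher_lipschitz_constant_ge0 _)) (mulr_ge0 K0 (sqr_ge0 _))); lra.
Qed.

Let norm_dot_grad_le x z : `|dot (G x) z| <= L * `|z|.
Proof.
rewrite (le_trans (norm_dot_le z (C11_grad_bound uC x)))// ler_wpM2r//.
rewrite /C11_lipschitz_constant -[leRHS]addrA lerDl.
exact: addr_ge0 C0 (le_trans (normr_ge0 _) (C11_oscillation uC 0 0)).
Qed.

Lemma comp_taylor_le x z :
  f (u (x + z)) <= f (u x) + f1 (u x) * (u (x + z) - u x) + f2 (u x) / 2 * dot (G x) z ^+ 2 +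
    taylor_constant * `|z| ^+ 3.
Proof.
set a := u x; set b := u (x + z); set g := dot (G x) z.
have ba : `|b - a| <= L * `|z| := C11_lipschitz uC x z.
have cubic : K * `|b - a| ^+ 3 <= K * (L * `|z|) ^+ 3.
  by rewrite ler_wpM2l// lerXn2r ?nnegrE// mulr_ge0.
have quadratic : f2 a / 2 * ((b - a) ^+ 2 - g ^+ 2) <= K * (C * L * `|z| ^+ 3).
  rewrite (_ : (b - a) ^+ 2 - g ^+ 2 = (b - a - g) * (b - a + g)); last by ring.
  rewrite (le_trans (ler_norm _))// normrM normrM [`|2^-1|]ger0_norm// normrM.
  have -> : K * (C * L * `|z| ^+ 3) = K / 2 * (C * `|z| ^+ 2 * (L * `|z| + L * `|z|)) by field.
  have sum_le : `|b - a + g| <= L * `|z| + L * `|z|.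
    by rewrite (le_trans (ler_normD _ _))// lerD// norm_dot_grad_le.
  have f2_half : `|f2 a| / 2 <= K / 2 by rewrite ler_wpM2r// (C3_on_bound2 fC (umM x)).
  have remainder_le : `|b - a - g| * `|b - a + g| <= C * `|z| ^+ 2 * (L * `|z| + L * `|z|).
    by apply: ler_pM => //; exact: uG.
  by apply: ler_pM => //; exact: mulr_ge0.
have := taylor2_le fC (umM x) (umM (x + z)); rewrite -/a -/b ler_norml => /andP[_].
by rewrite /taylor_constant; move: cubic quadratic; rewrite exprMn; lra.
Qed.

Lemma comp_fisher_le x z : f2 (u x) * sqnorm (G x) <=
  f2 (u (x + z)) * sqnorm (G (x + z)) + fisher_lipschitz_constant * `|z|.
Proof.
have f2_le : `|f2 (u x) - f2 (u (x + z))| <= K * (L * `|z|).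
  have := lipschitz_segment (C3_on_derive2 fC) (C3_on_bound3 fC) (umM x) (umM (x + z)).
  by rewrite distrC => /le_trans; apply; rewrite ler_wpM2l// (C11_lipschitz uC).
have sqnorm_lip : `|sqnorm (G x) - sqnorm (G (x + z))| <= n%:R * ((6 * C * `|z|) * (2 * B)).
  have -> : n%:R * ((6 * C * `|z|) * (2 * B)) = \sum_(i < n) (6 * C * `|z|) * (2 * B).
    by rewrite sumr_const card_ord -[RHS]mulr_natl.
  rewrite /sqnorm -sumrB (le_trans (ler_norm_sum _ _ _))//; apply: ler_sum => i _.
  rewrite subr_sqr normrM distrC ler_pM// ?(C11_grad_lipschitz uC)//.
  have := C11_grad_bound uC (x + z) i; have := C11_grad_bound uC x i.
  by have := ler_normD (G x 0 i) (G (x + z) 0 i); lra.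
have sqnormG : `|sqnorm (G x)| <= n%:R * B ^+ 2.
  by rewrite ger0_norm ?sqnorm_ge0//; apply: sqnorm_le; exact: C11_grad_bound.
rewrite -lerBlDl (le_trans (ler_norm _))//.
have -> : f2 (u x) * sqnorm (G x) - f2 (u (x + z)) * sqnorm (G (x + z)) =
    (f2 (u x) - f2 (u (x + z))) * sqnorm (G x) +
    f2 (u (x + z)) * (sqnorm (G x) - sqnorm (G (x + z))) by ring.
have -> : fisher_lipschitz_constant * `|z| = K * (L * `|z|) * (n%:R * B ^+ 2) +
    K * (n%:R * ((6 * C * `|z|) * (2 * B))) by rewrite /fisher_lipschitz_constant; ring.
by rewrite (le_trans (ler_normD _ _))// !normrM lerD// ler_pM// (C3_on_bound2 fC).
Qed.

Section small_time.
Variable e : R.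
Hypotheses (e0 : 0 < e) (e1 : e <= 1).

Let t0 : 0 < e ^+ 2. Proof. exact: exprn_gt0. Qed.
Let dg : density (@gauss_density R n (e ^+ 2)) := density_gauss n t0.

Let dintegrable_shift x g : bounded_continuous g ->
  dintegrable (@gauss_density R n (e ^+ 2)) (fun z => g (x + z)).
Proof.
by move=> [cg [D gD]]; apply: (dintegrable_bounded dg (C := D)) => //; exact: continuous_addl.
Qed.

Let bu := C11_bounded_continuous uC.

Let heat_displacement x : `|heat (e ^+ 2) u x - u x| <= 2 * n%:R * C * e ^+ 2.
Proof.
have [i2 m2] := dmean_gauss_norm2_le (n := n) e0.
have id := dintegrable_gauss_dot t0 (G x).
have iu := dintegrable_shift x bu; have ic := dintegrable_cst dg (- u x).
have idN := dintegrableZ (-1) id; have iuc := dintegrableD iu ic.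
rewrite heatE//.
have -> : dmean (gauss_density (e ^+ 2)) (fun z => u (x + z)) - u x =
    dmean (gauss_density (e ^+ 2)) (fun z => u (x + z) + - u x + -1 * dot (G x) z).
  by rewrite (dmeanD iuc idN) (dmeanD iu ic) (dmeanZ _ id) dmean_gauss_dot// mulr0 addr0 dmean_cst.
apply: (@le_trans _ _ (C * dmean (gauss_density (e ^+ 2)) (fun z : V => `|z| ^+ 2))).
  rewrite -(dmeanZ _ i2); apply: (dmean_norm_le dg (dintegrableD iuc idN) (dintegrableZ C i2)) => z.
  by rewrite mulN1r; exact: uG.
by rewrite (_ : 2 * n%:R * C * e ^+ 2 = C * (2 * n%:R * e ^+ 2)) ?ler_wpM2l//; ring.
Qed.

Let heat_comp_expansion x : heat (e ^+ 2) (fun y => f (u y)) x <=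
  f (u x) + f1 (u x) * (heat (e ^+ 2) u x - u x) + e ^+ 2 * (f2 (u x) * sqnorm (G x)) +
  taylor_constant * (66 * n%:R * e ^+ 3).
Proof.
have [i3 m3] := dmean_gauss_norm3_le (n := n) e0.
have iu := dintegrable_shift x bu; have iB := dintegrableD iu (dintegrable_cst dg (- u x)).
have iL := dintegrableD (dintegrable_cst dg (f (u x))) (dintegrableZ (f1 (u x)) iB).
have i2 := dintegrable_gauss_dot2 t0 (G x); have iQ := dintegrableZ (f2 (u x) / 2) i2.
have iLQ := dintegrableD iL iQ; have iT := dintegrableZ taylor_constant i3.
rewrite !(heatE _ _ t0).
have bf := C11_comp_bounded_continuous uC (fun a aI => is_derive_continuous (C3_on_derive0 fC aI)).
apply: (le_trans (dmean_le dg (dintegrable_shift x bf) (dintegrableD iLQ iT)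
  (fun z => comp_taylor_le x z))).
rewrite (dmeanD iLQ iT) (dmeanD iL iQ) (dmeanZ _ i2) (dmeanZ _ i3) dmean_gauss_dot2//.
rewrite (dmeanD (dintegrable_cst dg _) (dintegrableZ _ iB)) (dmeanZ _ iB).
rewrite (dmeanD iu (dintegrable_cst dg _)) !dmean_cst//.
rewrite (_ : f2 (u x) / 2 * (2 * _) = e ^+ 2 * (f2 (u x) * sqnorm (G x))); last by field.
by rewrite lerD2l ler_wpM2l// taylor_constant_ge0.
Qed.

Let heat_fisher_ge x : f2 (u x) * sqnorm (G x) <=
  heat (e ^+ 2) (fun y => f2 (u y) * sqnorm (G y)) x +
  fisher_lipschitz_constant * ((1 + 2 * n%:R) * e).
Proof.
have [i1 m1] := dmean_gauss_norm_le (n := n) e0.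
have i2 := dintegrable_shift x
  (C11_fisher_bounded_continuous uC (fun a aI => is_derive_continuous (C3_on_derive2 fC aI))).
have i1Z := dintegrableZ fisher_lipschitz_constant i1.
rewrite heatE// -[leLHS](dmean_cst dg).
apply: (le_trans (dmean_le dg (dintegrable_cst dg _) (dintegrableD i2 i1Z)
  (fun z => comp_fisher_le x z))).
by rewrite (dmeanD i2 i1Z) lerD2l (dmeanZ _ i1) ler_wpM2l// fisher_lipschitz_constant_ge0.
Qed.

Lemma heat_comp_le x : heat (e ^+ 2) (fun y => f (u y)) x <=
  f (heat (e ^+ 2) u x) + e ^+ 2 * heat (e ^+ 2) (fun y => f2 (u y) * sqnorm (G y)) x +
  heat_comp_constant * e ^+ 3.
Proof.
have PuI : m <= heat (e ^+ 2) u x <= M := mean_bounds (mean_functional_heat x (ltW t0)) bu umM.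
have recentre : f (u x) + f1 (u x) * (heat (e ^+ 2) u x - u x) <=
    f (heat (e ^+ 2) u x) + K * (2 * n%:R * C) ^+ 2 * e ^+ 3.
  have := taylor1_le (C3_on_derive0 fC) (C3_on_derive1 fC) (C3_on_bound2 fC) (umM x) PuI.
  have : K * `|heat (e ^+ 2) u x - u x| ^+ 2 <= K * (2 * n%:R * C) ^+ 2 * e ^+ 3.
    rewrite -mulrA ler_wpM2l//; apply: (@le_trans _ _ ((2 * n%:R * C * e ^+ 2) ^+ 2)).
      by rewrite lerXn2r ?nnegrE ?heat_displacement// !mulr_ge0 ?exprn_ge0// ltW.
    rewrite exprMn ler_wpM2l ?sqr_ge0// -exprM.
    by rewrite (exprS e 3) ler_piMl// exprn_ge0// ltW.
  by rewrite ler_norml => ? /andP[? _]; lra.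
have := heat_comp_expansion x; have := ler_wpM2l (ltW t0) (heat_fisher_ge x).
rewrite /heat_comp_constant; move: recentre.
set P := heat _ _ _; set Q := heat _ _ _; set S := f2 _ * _; move: (_ * (2 * n%:R * C) ^+ 2) => k.
move=> recentre fisher_ge expansion.
have -> : (taylor_constant * (66 * n%:R) + fisher_lipschitz_constant * (1 + 2 * n%:R) + k) *
    e ^+ 3 = taylor_constant * (66 * n%:R * e ^+ 3) +
    e ^+ 2 * (fisher_lipschitz_constant * ((1 + 2 * n%:R) * e)) + k * e ^+ 3 by ring.
lra.
Qed.

End small_time.
End heat_comp.

Section telescoping.
Context {R : realType}.
Implicit Types (D : R -> R) (S a K s e : R).

Lemma telescope_cubic_error D S a K : 0 <= S -> 0 <= K ->
  (forall s e, 0 <= s -> 0 < e -> e <= 1 -> s + e ^+ 2 <= S ->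
     D (s + e ^+ 2) <= D s + a * e ^+ 2 + K * e ^+ 3) ->
  D S <= D 0 + a * S.
Proof.
move=> S0 K0 step; move: S0; rewrite le_eqVlt => /predU1P[<-|S0]; first by rewrite mulr0 addr0.
apply: (@le_of_forall_small _ _ _ (K * S) 1 ltr01) => e1 e1_gt0 e1_le1.
pose N := Num.bound (S / e1 ^+ 2).
have NS : S / e1 ^+ 2 < N%:R by apply: archi_boundP; rewrite divr_ge0 ?exprn_ge0 ?ltW.
have N0 : 0 < N%:R :> R by rewrite (lt_trans _ NS)// divr_gt0// exprn_gt0.
pose e := Num.sqrt (S / N%:R).
have e0 : 0 < e by rewrite sqrtr_gt0 divr_gt0.
have e2 : N%:R * e ^+ 2 = S by rewrite sqr_sqrtr ?divr_ge0 ?ltW// mulrC divfK// gt_eqF.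
have ee1 : e <= e1.
  rewrite -ler_sqr ?nnegrE ?(ltW e0) ?(ltW e1_gt0)// -(ler_pM2l N0) e2.
  by rewrite -ler_pdivrMr ?exprn_gt0// ltW.
have after j : (j <= N)%N -> D (j%:R * e ^+ 2) <= D 0 + a * (j%:R * e ^+ 2) + K * (j%:R * e ^+ 3).
  elim: j => [_|j ih jN]; first by rewrite !mul0r !mulr0 !addr0.
  have j0 : 0 <= j%:R * e ^+ 2 by rewrite mulr_ge0// exprn_ge0// ltW.
  have jS : j%:R * e ^+ 2 + e ^+ 2 <= S.
    have -> : j%:R * e ^+ 2 + e ^+ 2 = j.+1%:R * e ^+ 2 by rewrite -natr1 mulrDl mul1r.
    by rewrite -e2 ler_wpM2r ?exprn_ge0 ?(ltW e0)// ler_nat.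
  have := step _ e j0 e0 (le_trans ee1 e1_le1) jS; have := ih (ltnW jN).
  by rewrite -natr1 !mulrDl !mul1r; lra.
have := after N (leqnn N); rewrite e2 => /le_trans; apply; rewrite lerD2l.
by rewrite -[K * S * e1]mulrA ler_wpM2l// exprSr mulrA e2 ler_wpM2l// ltW.
Qed.

End telescoping.

(** * Powers and logarithms *)

Section real_powers.
Context {R : realType}.
Implicit Types (m M b c p r x : R).

Lemma powRD_gt0 p r x : 0 < x -> x `^ (p + r) = x `^ p * x `^ r.
Proof. by move=> x0; rewrite powRD// (gt_eqF x0) implybT. Qed.

Lemma continuous_powR p x : 0 < x -> {for x, continuous (@powR R ^~ p)}.
Proof. by move=> x0; exact: is_derive_continuous (is_derive1_powR p x0). Qed.

Definition powR_segment_bound m M c : R := expR (c * (`|ln m| + `|ln M|)).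

Lemma powR_segment_bound_gt0 m M c : 0 < powR_segment_bound m M c.
Proof. exact: expR_gt0. Qed.

Lemma powR_segment_le m M c p x : 0 < m -> m <= x <= M -> `|p| <= c ->
  x `^ p <= powR_segment_bound m M c.
Proof.
move=> m0 /andP[mx xM] pc; have x0 : 0 < x by exact: lt_le_trans mx.
rewrite /powR gt_eqF// ler_expR (le_trans (ler_norm _))// normrM ler_pM//.
have lnm : ln m <= ln x by rewrite ler_ln ?posrE.
have lnM : ln x <= ln M by rewrite ler_ln ?posrE// (lt_le_trans x0).
have := ler_norm (- ln m); have := ler_norm (ln M); rewrite normrN.
have := normr_ge0 (ln m); have := normr_ge0 (ln M).
by rewrite ler_norml => *; apply/andP; split; lra.
Qed.

Lemma powR_segment_ge m M c p x : 0 < m -> m <= x <= M -> `|p| <= c ->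
  (powR_segment_bound m M c)^-1 <= x `^ p.
Proof.
move=> m0 xI pc; rewrite -[x `^ p]invrK -powRN lef_pV2 ?posrE ?powR_segment_bound_gt0//.
  by apply: powR_segment_le; rewrite ?normrN.
by rewrite powR_gt0// (lt_le_trans m0)//; case/andP: xI.
Qed.

Lemma powR_C3_on m M b : 0 < m -> exists K, forall r, 1 <= r <= b ->
  C3_on m M K (fun x => x `^ r) (fun x => r * x `^ (r - 1)) (fun x => r * (r - 1) * x `^ (r - 2))
    (fun x => r * (r - 1) * (r - 2) * x `^ (r - 3)).
Proof.
move=> m0; pose k := b + 2; pose Q := powR_segment_bound m M k.
exists ((k + k ^+ 2 + k ^+ 3) * Q) => r /andP[r1 rb].
have pos x : m <= x <= M -> 0 < x by move=> /andP[mx _]; exact: lt_le_trans mx.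
have term_le (a p x : R) : m <= x <= M -> `|a| <= k + k ^+ 2 + k ^+ 3 -> `|p| <= k ->
    `|a * x `^ p| <= (k + k ^+ 2 + k ^+ 3) * Q.
  move=> xI ak pk; rewrite normrM [`|x `^ p|]ger0_norm ?powR_ge0//.
  by rewrite ler_pM ?powR_ge0//; exact: powR_segment_le.
have dist i : 0 <= i -> i <= 3 -> `|r - i| <= k.
  by move=> i0 i3; rewrite ler_norml /k; apply/andP; split; lra.
have k0 : 0 <= k by rewrite /k; lra.
have k2 : 0 <= k ^+ 2 := sqr_ge0 k; have k3 : 0 <= k ^+ 3 := exprn_ge0 3 k0.
have rk : `|r| <= k by rewrite -[r]subr0 dist//; lra.
have r1k : `|r * (r - 1)| <= k ^+ 2 by rewrite normrM expr2 ler_pM// dist//; lra.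
have r2k : `|r * (r - 1) * (r - 2)| <= k ^+ 3 by rewrite normrM exprSr ler_pM// dist//; lra.
split=> x xI.
- exact: is_derive1_powR (pos x xI).
- have dx := is_derive1_powR (r - 1) (pos x xI).
  have -> : r - 2 = r - 1 - 1 by ring.
  by apply: is_derive_eq; rewrite /GRing.scale/=; ring.
- have dx := is_derive1_powR (r - 2) (pos x xI).
  have -> : r - 3 = r - 2 - 1 by ring.
  by apply: is_derive_eq; rewrite /GRing.scale/=; ring.
- by apply: term_le => //; [lra|apply: dist; lra].
- by apply: term_le => //; [lra|apply: dist; lra].
- by apply: term_le => //; [lra|apply: dist; lra].
Qed.

Lemma ln_le_of_leD a x d : 0 < a -> 0 < x -> a <= x + d -> ln a <= ln x + d / x.
Proof.
move=> a0 x0 ad; rewrite -lerBlDl -ln_div ?posrE// -[a / x](subrK 1) [_ + 1]addrC.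
apply: (le_trans (le_ln1Dx _)); first by rewrite ltrBrDl subrr divr_gt0.
by rewrite -{1}(mulfV (lt0r_neq0 x0)) -mulrBl ler_wpM2r ?invr_ge0 ?(ltW x0)// lerBlDl.
Qed.

Definition xlnx x : R := x * ln x.

Let is_derive_inv x : 0 < x -> is_derive x 1 (fun t : R => t^-1) (- x ^- 2).
Proof.
move=> x0; have := is_deriveV (f := id) (lt0r_neq0 x0) (is_derive_id x 1).
by move=> dx; apply: is_derive_eq; rewrite /GRing.scale/= mulr1.
Qed.

Lemma continuous_xlnx x : 0 < x -> {for x, continuous xlnx}.
Proof. by move=> x0; apply: continuousM; [exact: cvg_id|exact: continuous_ln]. Qed.

Lemma xlnx_C3_on m M : 0 < m ->
  exists K, C3_on m M K xlnx (fun x => ln x + 1) (fun x => x^-1) (fun x => - x ^- 2).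
Proof.
move=> m0; apply: C3_on_exists => x /andP[mx _]; have x0 : 0 < x by exact: lt_le_trans mx.
- have dl := is_derive1_ln x0.
  by apply: is_derive_eq; rewrite /GRing.scale/= mulfV ?gt_eqF//; ring.
- by have dl := is_derive1_ln x0; apply: is_derive_eq; rewrite addr0.
- exact: is_derive_inv.
- by apply: continuousN; apply: continuousV; [rewrite expf_neq0 ?gt_eqF|exact: exprn_continuous].
Qed.

Lemma ln_C3_on m M c : 0 < m ->
  exists K, C3_on m M K (fun x => ln x - c) (fun x => x^-1) (fun x => - x ^- 2)
    (fun x => 2 * x ^- 3).
Proof.
move=> m0; apply: C3_on_exists => x /andP[mx _]; have x0 : 0 < x by exact: lt_le_trans mx.
- by have dl := is_derive1_ln x0; apply: is_derive_eq; rewrite subr0.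
- exact: is_derive_inv.
- have xn : x ^+ 2 != 0 by rewrite expf_neq0// gt_eqF.
  by apply: is_derive_eq; rewrite /GRing.scale/=; field; rewrite gt_eqF.
- apply: continuousM; first exact: cst_continuous.
  by apply: continuousV; [rewrite expf_neq0 ?gt_eqF|exact: exprn_continuous].
Qed.

End real_powers.

(** * From log-Sobolev to hypercontractivity *)

Section log_sobolev.
Context {R : realType} {n : nat}.
Local Notation V := 'rV[R]_n.
Implicit Types (I : (V -> R) -> R) (F : V -> R) (G : V -> V) (m M C s t k : R) (x : V).

Definition log_sobolev k I : Prop := forall m M C F G, 0 < m -> C11 m M C F G ->
  I (fun x => xlnx (F x)) <= xlnx (I F) + k * I (fun x => (F x)^-1 * sqnorm (G x)).

Section positive_C11.
Variables (m M C : R) (F : V -> R) (G : V -> V).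
Hypotheses (m0 : 0 < m) (FC : C11 m M C F G).

Let FmM x : m <= F x <= M. Proof. by case: FC. Qed.

Lemma C11_gt0 x : 0 < F x.
Proof. by have /andP[mF _] := FmM x; exact: lt_le_trans mF. Qed.

Lemma mean_gt0 I : mean_functional I -> 0 < I F.
Proof.
move=> mI; have /andP[mF _] := mean_bounds mI (C11_bounded_continuous FC) FmM.
exact: lt_le_trans mF.
Qed.

Lemma C11_xlnx_bounded_continuous : bounded_continuous (fun x => xlnx (F x)).
Proof.
apply: (C11_comp_bounded_continuous FC) => a /andP[ma _]; apply: continuous_xlnx.
exact: lt_le_trans ma.
Qed.

Lemma C11_inv_fisher_bounded_continuous : bounded_continuous (fun x => (F x)^-1 * sqnorm (G x)).
Proof.
apply: (C11_fisher_bounded_continuous FC (f := fun a => a^-1)) => a /andP[ma _].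
by apply: continuousV; [rewrite gt_eqF// (lt_le_trans m0)|exact: cvg_id].
Qed.

(* Convexity of [(v, t) |-> |v|^2 / t], by integrating the tangent inequality at the mean. *)
Lemma mean_inv_fisher_le I : mean_functional I ->
  (I F)^-1 * sqnorm (\row_i I (fun x => G x 0 i)) <= I (fun x => (F x)^-1 * sqnorm (G x)).
Proof.
move=> mI; have bF := C11_bounded_continuous FC; have IF0 := mean_gt0 mI.
have bG i := C11_grad_bounded_continuous FC i.
pose c i := I (fun x => G x 0 i) / I F.
have bG2 i := bounded_continuousZ (2 * c i) (bG i).
have bF2 i := bounded_continuousZ (- c i ^+ 2) bF.
have bT i := bounded_continuousD (bG2 i) (bF2 i).
have -> : (I F)^-1 * sqnorm (\row_i I (fun x => G x 0 i)) =
    I (fun x => \sum_i (2 * c i * G x 0 i + - c i ^+ 2 * F x)).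
  rewrite (mean_sum mI)// mulr_sumr; apply: eq_bigr => i _.
  rewrite mxE (meanD mI (bG2 i) (bF2 i)) (meanZ mI _ (bG i)) (meanZ mI _ bF) /c.
  by field; rewrite gt_eqF.
apply: (mean_le mI (bounded_continuous_sum _ bT) C11_inv_fisher_bounded_continuous) => x.
rewrite mulr_sumr; apply: ler_sum => i _; have F0 := C11_gt0 x.
rewrite -(ler_pM2l F0) [leRHS]mulVKf ?gt_eqF//.
by have := sqr_ge0 (G x 0 i - c i * F x); lra.
Qed.

End positive_C11.

Lemma mean_functional_heat_comp I t : mean_functional I -> 0 <= t ->
  mean_functional (fun g => I (heat t g)).
Proof.
move=> mI t0; have mH (x : V) := mean_functional_heat x t0.
have bH (g : V -> R) := @heat_bounded_continuous R n t g t0.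
split=> [g h bg bh|c g bg|c|g h bg bh gh].
- rewrite -(meanD mI (bH _ bg) (bH _ bh)); congr I.
  by apply/funext => x; exact: (meanD (mH x)).
- by rewrite -(meanZ mI c (bH _ bg)); congr I; apply/funext => x; exact: (meanZ (mH x)).
- by rewrite -[RHS](mean_cst mI); congr I; apply/funext => x; exact: (mean_cst (mH x)).
- by apply: (mean_le mI (bH _ bg) (bH _ bh)) => x; exact: (mean_le (mH x)).
Qed.

Lemma heat_inv_fisher_le m M C F G t x : 0 <= t -> 0 < m -> C11 m M C F G ->
  (heat t F x)^-1 * sqnorm (heat_row t G x) <= heat t (fun y => (F y)^-1 * sqnorm (G y)) x.
Proof. by move=> t0 m0 FC; exact: (mean_inv_fisher_le m0 FC (mean_functional_heat x t0)). Qed.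

(* [P_t (P_(S-t) F ln P_(S-t) F)] interpolates between the two sides and grows at most at rate
   [P_S (|grad F|^2 / F)]. *)
Lemma heat_log_sobolev m M C F G S x : 0 < m -> C11 m M C F G -> 0 <= S ->
  heat S (fun y => xlnx (F y)) x <=
  xlnx (heat S F x) + S * heat S (fun y => (F y)^-1 * sqnorm (G y)) x.
Proof.
move=> m0 FC S0; have bF := C11_bounded_continuous FC.
have [K xlnxC] := xlnx_C3_on M m0; pose c := @heat_comp_constant R n m M C K.
pose J y := (F y)^-1 * sqnorm (G y).
have bJ : bounded_continuous J := C11_inv_fisher_bounded_continuous m0 FC.
pose D t := heat t (fun y => xlnx (heat (S - t) F y)) x.
have step s e : 0 <= s -> 0 < e -> e <= 1 -> s + e ^+ 2 <= S ->
    D (s + e ^+ 2) <= D s + heat S J x * e ^+ 2 + c * e ^+ 3.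
  move=> s0 e0 e1 sS; have t0 : 0 <= e ^+ 2 by rewrite exprn_ge0// ltW.
  pose q := S - (s + e ^+ 2); have q0 : 0 <= q by rewrite subr_ge0.
  have eq0 : 0 <= e ^+ 2 + q := addr_ge0 t0 q0.
  have qFC := heat_C11 q0 FC.
  have bq := C11_xlnx_bounded_continuous m0 qFC.
  have bS := C11_xlnx_bounded_continuous m0 (heat_C11 eq0 FC).
  have bqJ := heat_bounded_continuous eq0 bJ; have bZ := bounded_continuousZ (e ^+ 2) bqJ.
  have bc := @bounded_continuous_cst R n (c * e ^+ 3).
  have pointwise y : heat (e ^+ 2) (fun z => xlnx (heat q F z)) y <=
      xlnx (heat (e ^+ 2 + q) F y) + e ^+ 2 * heat (e ^+ 2 + q) J y + c * e ^+ 3.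
    apply: (le_trans (heat_comp_le qFC xlnxC e0 e1 y)).
    rewrite (heat_semigroup t0 q0 bF) lerD2r lerD2l ler_wpM2l// -(heat_semigroup t0 q0 bJ).
    apply: (mean_le (mean_functional_heat y t0) _ (heat_bounded_continuous q0 bJ)) => [|z].
      exact: C11_inv_fisher_bounded_continuous m0 qFC.
    exact: heat_inv_fisher_le q0 m0 FC.
  have mH := mean_functional_heat x s0; have bSZ := bounded_continuousD bS bZ.
  have := mean_le mH (heat_bounded_continuous t0 bq) (bounded_continuousD bSZ bc) pointwise.
  rewrite (meanD mH bSZ bc) (meanD mH bS bZ) (meanZ mH _ bqJ) (mean_cst mH).
  rewrite (heat_semigroup s0 t0 bq) (heat_semigroup s0 eq0 bJ).
  have -> : s + (e ^+ 2 + q) = S by rewrite /q; ring.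
  by have -> : e ^+ 2 + q = S - s; [rewrite /q; ring|rewrite [e ^+ 2 * _]mulrC].
have := telescope_cubic_error S0 (heat_comp_constant_ge0 FC xlnxC) step.
by rewrite /D subrr subr0 !heat0 [_ * S]mulrC.
Qed.

Lemma log_sobolev_heat I k s : mean_functional I -> 0 <= k -> 0 <= s -> log_sobolev k I ->
  log_sobolev (k + s) (fun g => I (heat s g)).
Proof.
move=> mI k0 s0 sobI m M C F G m0 FC; have sFC := heat_C11 s0 FC.
have bH (g : V -> R) := @heat_bounded_continuous R n s g s0.
have bfisher := bH _ (C11_inv_fisher_bounded_continuous m0 FC).
have bxlnx := C11_xlnx_bounded_continuous m0 sFC.
have bZ := bounded_continuousZ s bfisher.
have local := mean_le mI (bH _ (C11_xlnx_bounded_continuous m0 FC)) (bounded_continuousD bxlnx bZ)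
  (fun x => heat_log_sobolev x m0 FC s0).
rewrite (meanD mI bxlnx bZ) (meanZ mI s bfisher) in local.
have global := sobI m M C _ _ m0 sFC.
have := mean_le mI (C11_inv_fisher_bounded_continuous m0 sFC) bfisher
  (fun x => heat_inv_fisher_le x s0 m0 FC).
by move=> /(ler_wpM2l k0); rewrite mulrDl; lra.
Qed.

End log_sobolev.

Section powers_of_C11.
Context {R : realType} {n : nat}.
Local Notation V := 'rV[R]_n.
Variables (I : (V -> R) -> R) (m M C : R) (v : V -> R) (G : V -> V).
Hypotheses (mI : mean_functional I) (m0 : 0 < m) (vC : C11 m M C v G).
Implicit Types (p r b : R) (x : V).

Local Notation mean_powR p := (I (fun x => v x `^ p)).
Local Notation mean_fisher p := (I (fun x => v x `^ (p - 2) * sqnorm (G x))).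

Let vmM x : m <= v x <= M. Proof. by case: vC. Qed.
Let v0 x : 0 < v x := C11_gt0 m0 vC x.
Let segment_gt0 a : m <= a <= M -> 0 < a.
Proof. by move=> /andP[ma _]; exact: lt_le_trans ma. Qed.

Lemma C11_powR_bounded_continuous p : bounded_continuous (fun x => v x `^ p).
Proof.
apply: (C11_comp_bounded_continuous vC (f := fun a => a `^ p)) => a /segment_gt0.
exact: continuous_powR.
Qed.

Lemma C11_powR_fisher_bounded_continuous p :
  bounded_continuous (fun x => v x `^ p * sqnorm (G x)).
Proof.
apply: (C11_fisher_bounded_continuous vC (f := fun a => a `^ p)) => a /segment_gt0.
exact: continuous_powR.
Qed.

Lemma C11_powR_ln_bounded_continuous p : bounded_continuous (fun x => v x `^ p * ln (v x)).
Proof.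
apply: (C11_comp_bounded_continuous vC (f := fun a => a `^ p * ln a)) => a /segment_gt0 a0.
by apply: continuousM; [exact: continuous_powR|exact: continuous_ln].
Qed.

Lemma mean_powR_ge b r : `|r| <= b -> (powR_segment_bound m M b)^-1 <= mean_powR r.
Proof.
move=> rb; rewrite -[leLHS](mean_cst mI).
apply: (mean_le mI (bounded_continuous_cst _) (C11_powR_bounded_continuous r)) => x.
exact: powR_segment_ge.
Qed.

Lemma mean_powR_gt0 r : 0 < mean_powR r.
Proof.
by apply: lt_le_trans (mean_powR_ge (lexx _)); rewrite invr_gt0 powR_segment_bound_gt0.
Qed.

Definition fisher_ratio_bound : R := n%:R * (M - m + C) ^+ 2 / m ^+ 2.

Lemma mean_fisher_ge0 r : 0 <= mean_fisher r.
Proof.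
apply: (mean_ge0 mI (C11_powR_fisher_bounded_continuous (r - 2))) => x.
by rewrite mulr_ge0 ?powR_ge0 ?sqnorm_ge0.
Qed.

Lemma mean_fisher_le r : mean_fisher r <= fisher_ratio_bound * mean_powR r.
Proof.
have br := C11_powR_bounded_continuous r.
rewrite -(meanZ mI _ br); apply: (mean_le mI (C11_powR_fisher_bounded_continuous _)
  (bounded_continuousZ _ br)) => x.
have -> : v x `^ r = v x `^ (r - 2) * v x ^+ 2.
  by rewrite -[_ ^+ 2]powR_mulrn ?(ltW (v0 x))// -powRD_gt0// subrK.
rewrite mulrCA ler_wpM2l ?powR_ge0// (le_trans (sqnorm_le (C11_grad_bound vC x)))//.
rewrite /fisher_ratio_bound -[leRHS]mulrA ler_peMr//; first by rewrite mulr_ge0// sqr_ge0.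
rewrite mulrC ler_pdivlMr ?exprn_gt0// mul1r ler_sqr ?nnegrE ?(ltW m0) ?(ltW (v0 x))//.
by have /andP[] := vmM x.
Qed.

Lemma mean_powR_log_sobolev k r : log_sobolev k I -> 1 <= r ->
  r * I (fun x => v x `^ r * ln (v x)) <= xlnx (mean_powR r) + k * (r ^+ 2 * mean_fisher r).
Proof.
move=> sobI r1; have [K powC] := powR_C3_on M r m0.
have rI : 1 <= r <= r by rewrite r1 lexx.
pose Q := powR_segment_bound m M `|r|.
have vI a : m <= a <= M -> Q^-1 <= a `^ r <= Q.
  by move=> aI; rewrite powR_segment_ge ?powR_segment_le.
have lo0 : 0 < Q^-1 by rewrite invr_gt0 powR_segment_bound_gt0.
have := sobI _ _ _ _ _ lo0 (C11_comp vC (powC r rI) vI); cbv beta.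
have -> : (fun x => xlnx (v x `^ r)) = (fun x => r * (v x `^ r * ln (v x))).
  by apply/funext => x; rewrite /xlnx ln_powR mulrCA.
have -> : (fun x => (v x `^ r)^-1 * sqnorm ((r * v x `^ (r - 1)) *: G x)) =
    (fun x => r ^+ 2 * (v x `^ (r - 2) * sqnorm (G x))).
  apply/funext => x; have square : (v x `^ (r - 1)) ^+ 2 = v x `^ r * v x `^ (r - 2).
    by rewrite expr2 -!powRD_gt0//; congr (_ `^ _); ring.
  by rewrite sqnormZ exprMn square; field; rewrite gt_eqF// powR_gt0.
rewrite (meanZ mI _ (C11_powR_ln_bounded_continuous r)).
by rewrite (meanZ mI _ (C11_powR_fisher_bounded_continuous _)).
Qed.

(* [p |-> ln I (v^p)] is convex, with derivative [I (v^p ln v) / I (v^p)]. *)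
Lemma ln_mean_powR_tangent r p :
  ln (mean_powR r) + (p - r) * (I (fun x => v x `^ r * ln (v x)) / mean_powR r) <=
  ln (mean_powR p).
Proof.
have br := C11_powR_bounded_continuous r; have bl := C11_powR_ln_bounded_continuous r.
have N0 := mean_powR_gt0 r; set N := mean_powR r; set c := _ / N; pose k := expR ((p - r) * c).
have k0 : 0 < k := expR_gt0 _.
have -> : ln N + (p - r) * c = ln (k * N) by rewrite lnM ?posrE// expRK addrC.
rewrite ler_ln ?posrE ?mulr_gt0 ?mean_powR_gt0//.
have b1 := bounded_continuousZ (k * (1 - (p - r) * c)) br.
have b2 := bounded_continuousZ (k * (p - r)) bl.
have -> : k * N =
    I (fun x => k * (1 - (p - r) * c) * v x `^ r + k * (p - r) * (v x `^ r * ln (v x))).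
  by rewrite (meanD mI b1 b2) (meanZ mI _ br) (meanZ mI _ bl) -/N /c; field; rewrite gt_eqF.
apply: (mean_le mI (bounded_continuousD b1 b2) (C11_powR_bounded_continuous p)) => x.
have -> : v x `^ p = k * v x `^ r * expR ((p - r) * (ln (v x) - c)).
  rewrite -[p in LHS](subrK r) powRD_gt0// {1}/powR gt_eqF//.
  by rewrite [k * _]mulrC -mulrA -expRD mulrC; congr (_ * expR _); ring.
have := ler_wpM2l (mulr_ge0 (ltW k0) (powR_ge0 (v x) r)) (expR_ge1Dx ((p - r) * (ln (v x) - c))).
by move=> /(le_trans _); apply; rewrite le_eqVlt; apply/orP; left; apply/eqP; ring.
Qed.

Lemma ln_mean_powR_norm_ge k r p d : log_sobolev k I -> 1 < p -> p <= r ->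
  (r - p) * k = d * (r - 1) ->
  r^-1 * ln (mean_powR r) - d * (r - 1) * (r / p) * (mean_fisher r / mean_powR r) <=
  p^-1 * ln (mean_powR p).
Proof.
move=> sobI p1 pr dE; have r1 : 1 <= r := le_trans (ltW p1) pr.
have r0 : 0 < r := lt_le_trans ltr01 r1; have p0 : 0 < p := lt_trans ltr01 p1.
have N0 := mean_powR_gt0 r; have := mean_powR_log_sobolev sobI r1; have := ln_mean_powR_tangent r p.
move: N0; set N := mean_powR r; set J := mean_fisher r; set L := I (fun=> _ * _).
rewrite /xlnx => N0 tangent sob.
have {}sob : L / N <= r^-1 * ln N + k * r * (J / N).
  rewrite ler_pdivrMr// -(ler_pM2l r0) (le_trans sob)// le_eqVlt; apply/orP; left; apply/eqP.
  by field; rewrite !gt_eqF.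
rewrite -(ler_pM2l p0) [leRHS]mulVKf ?gt_eqF// (le_trans _ tangent)//.
have := ler_wpM2l (_ : 0 <= r - p) sob; rewrite subr_ge0 => /(_ pr).
have -> : (r - p) * (r^-1 * ln N + k * r * (J / N)) =
    ln N - p * (r^-1 * ln N) + d * (r - 1) * r * (J / N).
  rewrite mulrDr [(r - p) * (k * r * _)]mulrA [(r - p) * (k * r)]mulrA dE.
  by field; rewrite !gt_eqF.
have -> : p * (r^-1 * ln N - d * (r - 1) * (r / p) * (J / N)) =
    p * (r^-1 * ln N) - d * (r - 1) * r * (J / N) by field; rewrite !gt_eqF.
lra.
Qed.

Lemma ln_powR_norm_le r b d A K : 1 <= r -> r <= b -> 0 < A -> 0 <= K ->
  A <= mean_powR r - d * (r * (r - 1)) * mean_fisher r + K ->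
  r^-1 * ln A <= r^-1 * ln (mean_powR r) - d * (r - 1) * (mean_fisher r / mean_powR r) +
    K * powR_segment_bound m M b.
Proof.
move=> r1 rb A0 K0; have r0 : 0 < r := lt_le_trans ltr01 r1; have N0 := mean_powR_gt0 r.
have := @mean_powR_ge b r; rewrite ger0_norm ?(ltW r0)// => /(_ rb).
set N := mean_powR r; set J := mean_fisher r; set Q := powR_segment_bound m M b => N_ge.
rewrite -addrA => /(ln_le_of_leD A0 N0) /(ler_wpM2l (ltW _ : 0 <= r^-1)).
rewrite invr_gt0 => /(_ r0) /le_trans; apply.
have -> : r^-1 * (ln N + (- (d * (r * (r - 1)) * J) + K) / N) =
    r^-1 * ln N - d * (r - 1) * (J / N) + r^-1 * (K / N) by field; rewrite !gt_eqF.
have N_inv : N^-1 <= Q by rewrite -[Q]invrK lef_pV2 ?posrE ?invr_gt0 ?powR_segment_bound_gt0.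
rewrite lerD2l (@le_trans _ _ (K / N))//; last exact: ler_wpM2l.
by rewrite ler_piMl ?invf_le1// divr_ge0// ltW.
Qed.

Lemma powR_norm_step k r p b e D A K : log_sobolev k I -> 1 < p -> p <= r -> r <= b ->
  r - p <= D * e ^+ 2 -> (r - p) * k = e ^+ 2 * (r - 1) -> 0 < e -> e <= 1 ->
  0 < A -> 0 <= K ->
  A <= mean_powR r - e ^+ 2 * (r * (r - 1)) * mean_fisher r + K * e ^+ 3 ->
  r^-1 * ln A <= p^-1 * ln (mean_powR p) +
    (K * powR_segment_bound m M b + D * (b - 1) * fisher_ratio_bound) * e ^+ 3.
Proof.
move=> sobI p1 pr rb rpD rpE e0 e1 A0 K0 A_le.
have p0 : 0 < p := lt_trans ltr01 p1; have r1 : 1 <= r := le_trans (ltW p1) pr.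
have e3 : 0 <= e ^+ 3 := exprn_ge0 3 (ltW e0).
have lower := ln_mean_powR_norm_ge sobI p1 pr rpE.
have upper := ln_powR_norm_le r1 rb A0 (mulr_ge0 K0 e3) A_le.
move: lower upper; set N := mean_powR r; set J := mean_fisher r; set Q := powR_segment_bound m M b.
set y := J / N => lower upper.
have y0 : 0 <= y := divr_ge0 (mean_fisher_ge0 r) (ltW (mean_powR_gt0 r)).
have y_le : y <= fisher_ratio_bound by rewrite ler_pdivrMr ?mean_powR_gt0// mean_fisher_le.
have exponent_error : e ^+ 2 * (r - 1) * (r / p - 1) * y <=
    D * (b - 1) * fisher_ratio_bound * e ^+ 3.
  have ratio_le : r / p - 1 <= D * e ^+ 2.
    rewrite (le_trans _ rpD)// -(mulfV (lt0r_neq0 p0)) -mulrBl.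
    by rewrite ler_pdivrMr// ler_peMr ?subr_ge0// ltW.
  have ratio_ge0 : 0 <= r / p - 1 by rewrite subr_ge0 ler_pdivlMr// mul1r.
  have er0 : 0 <= e ^+ 2 * (r - 1) by rewrite mulr_ge0 ?sqr_ge0// subr_ge0.
  have er_le : e ^+ 2 * (r - 1) <= e * (b - 1).
    by rewrite ler_pM ?sqr_ge0 ?subr_ge0 ?lerD2r// expr2 ler_piMl// ltW.
  have -> : D * (b - 1) * fisher_ratio_bound * e ^+ 3 =
    e * (b - 1) * (D * e ^+ 2) * fisher_ratio_bound by ring.
  exact: ler_pM (mulr_ge0 er0 ratio_ge0) y0 (ler_pM er0 ratio_ge0 er_le ratio_le) y_le.
have -> : (K * Q + D * (b - 1) * fisher_ratio_bound) * e ^+ 3 =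
  K * e ^+ 3 * Q + D * (b - 1) * fisher_ratio_bound * e ^+ 3 by ring.
by move: lower upper exponent_error; lra.
Qed.

End powers_of_C11.

Section hypercontractive_exponent.
Context {R : realType}.
Variables be rho : R.
Hypotheses (be0 : 0 < be) (rho0 : 0 < rho).
Implicit Types s t : R.

Definition hyper_exponent s : R := 1 + rho / (1 + 2 * be * s).

Let denominator_ge1 s : 0 <= s -> 1 <= 1 + 2 * be * s.
Proof. by move=> s0; rewrite lerDl !mulr_ge0// ltW. Qed.

Let denominator_gt0 s : 0 <= s -> 0 < 1 + 2 * be * s.
Proof. by move=> /denominator_ge1; exact: lt_le_trans. Qed.

Lemma hyper_exponent_gt1 s : 0 <= s -> 1 < hyper_exponent s.
Proof. by move=> s0; rewrite ltrDl divr_gt0// denominator_gt0. Qed.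

Lemma hyper_exponent_le s : 0 <= s -> hyper_exponent s <= 1 + rho.
Proof.
move=> s0; rewrite lerD2l ler_pdivrMr ?denominator_gt0// ler_peMr ?denominator_ge1//.
exact: ltW.
Qed.

Lemma hyper_exponentB s t : 0 <= s -> 0 <= t ->
  (hyper_exponent s - hyper_exponent t) * ((2 * be)^-1 + t) = (t - s) * (hyper_exponent s - 1).
Proof.
move=> /denominator_gt0/gt_eqF sn /denominator_gt0/gt_eqF tn; rewrite /hyper_exponent.
by field; rewrite sn tn gt_eqF.
Qed.

Let be2V : 0 < (2 * be)^-1. Proof. by rewrite invr_gt0 mulr_gt0. Qed.

Lemma hyper_exponent_anti s t : 0 <= s -> s <= t -> hyper_exponent t <= hyper_exponent s.
Proof.
move=> s0 st; have t0 := le_trans s0 st.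
rewrite -subr_ge0 -(pmulr_lge0 _ (ltr_wpDr t0 be2V)) hyper_exponentB//.
by rewrite mulr_ge0 ?subr_ge0// ltW// hyper_exponent_gt1.
Qed.

Lemma hyper_exponent_lipschitz s t : 0 <= s -> s <= t ->
  hyper_exponent s - hyper_exponent t <= 2 * be * rho * (t - s).
Proof.
move=> s0 st; have t0 := le_trans s0 st.
rewrite -(ler_pM2r be2V); have -> : 2 * be * rho * (t - s) / (2 * be) = (t - s) * rho.
  by field; rewrite gt_eqF.
apply: (@le_trans _ _ ((hyper_exponent s - hyper_exponent t) * ((2 * be)^-1 + t))).
  by rewrite ler_wpM2l ?subr_ge0 ?hyper_exponent_anti// lerDl.
by rewrite hyper_exponentB// ler_wpM2l ?subr_ge0// lerBlDl hyper_exponent_le.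
Qed.

End hypercontractive_exponent.

Section hypercontractivity.
Context {R : realType} {n : nat}.
Local Notation V := 'rV[R]_n.
Variable I : (V -> R) -> R.
Hypothesis mI : mean_functional I.
Implicit Types (u v g : V -> R) (G : V -> V) (m M C K a r e s t : R).

Definition improved_exponent be S a : R := 1 + (a - 1) * (1 + 2 * be * S).

Lemma improved_exponent_gt1 be S a : 0 < be -> 0 <= S -> 1 < a -> 1 < improved_exponent be S a.
Proof.
move=> be0 S0 a1; have beS : 0 <= 2 * be * S by rewrite !mulr_ge0// ltW.
by rewrite ltrDl mulr_gt0 ?subr_gt0// ltr_wpDr.
Qed.

Lemma mean_heat_powR_le m M C K v G r e s : 0 < m -> C11 m M C v G ->
  C3_on m M K (fun x => x `^ r) (fun x => r * x `^ (r - 1)) (fun x => r * (r - 1) * x `^ (r - 2))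
    (fun x => r * (r - 1) * (r - 2) * x `^ (r - 3)) ->
  0 <= s -> 0 < e -> e <= 1 ->
  I (heat s (fun x => heat (e ^+ 2) v x `^ r)) <=
  I (heat (s + e ^+ 2) (fun x => v x `^ r)) -
    e ^+ 2 * (r * (r - 1)) * I (heat (s + e ^+ 2) (fun x => v x `^ (r - 2) * sqnorm (G x))) +
    @heat_comp_constant R n m M C K * e ^+ 3.
Proof.
move=> m0 vC powC s0 e0 e1; set c := heat_comp_constant _ _ _ _.
have t0 : 0 <= e ^+ 2 by rewrite exprn_ge0// ltW.
have br := C11_powR_bounded_continuous m0 vC r.
have bf := C11_powR_fisher_bounded_continuous m0 vC (r - 2).
have pointwise x : heat (e ^+ 2) v x `^ r <= heat (e ^+ 2) (fun x => v x `^ r) x +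
    - (e ^+ 2 * (r * (r - 1))) * heat (e ^+ 2) (fun x => v x `^ (r - 2) * sqnorm (G x)) x +
    c * e ^+ 3.
  have mH := mean_functional_heat x t0; have := heat_comp_le vC (C3_onN powC) e0 e1 x.
  have -> : (fun x => - v x `^ r) = (fun x => -1 * v x `^ r).
    by apply/funext => y; rewrite mulN1r.
  have -> : (fun x => - (r * (r - 1) * v x `^ (r - 2)) * sqnorm (G x)) =
      (fun x => - (r * (r - 1)) * (v x `^ (r - 2) * sqnorm (G x))) by apply/funext => y; ring.
  by rewrite (meanZ mH _ br) (meanZ mH _ bf) -/c; lra.
have mJ := mean_functional_heat_comp mI s0.
have bH := heat_bounded_continuous t0 br; have bHf := heat_bounded_continuous t0 bf.
have bZ := bounded_continuousZ (- (e ^+ 2 * (r * (r - 1)))) bHf.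
have bc := @bounded_continuous_cst R n (c * e ^+ 3).
have bHr := C11_powR_bounded_continuous m0 (heat_C11 t0 vC) r.
have sumE := meanD mJ (bounded_continuousD bH bZ) bc; have termE := meanD mJ bH bZ.
have fisherE := meanZ mJ (- (e ^+ 2 * (r * (r - 1)))) bHf; have errorE := mean_cst mJ (c * e ^+ 3).
cbv beta in sumE, termE, fisherE, errorE.
rewrite -(heat_semigroup s0 t0 br) -(heat_semigroup s0 t0 bf).
apply: (le_trans (mean_le mJ bHr (bounded_continuousD (bounded_continuousD bH bZ) bc) pointwise)).
by rewrite sumE termE fisherE errorE mulNr.
Qed.

Section hyper_norm.
Variables (be rho S m M C K : R) (u : V -> R) (G : V -> V).
Hypotheses (be0 : 0 < be) (rho0 : 0 < rho) (sob : log_sobolev (2 * be)^-1 I).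
Hypotheses (m0 : 0 < m) (uC : C11 m M C u G).
Hypothesis powC : forall r, 1 <= r <= 1 + rho ->
  C3_on m M K (fun x => x `^ r) (fun x => r * x `^ (r - 1)) (fun x => r * (r - 1) * x `^ (r - 2))
    (fun x => r * (r - 1) * (r - 2) * x `^ (r - 3)).
Local Notation r := (hyper_exponent be rho).

(* The logarithm of the norm of [P_(S-s) u] in [L^(r s)] of the mean [g |-> I (P_s g)]: it starts at
   the left-hand side of hypercontractivity, ends at the right-hand side, and does not decrease. *)
Definition ln_hyper_norm s : R :=
  (r s)^-1 * ln (I (heat s (fun x => heat (S - s) u x `^ r s))).

Definition hyper_norm_constant : R :=
  @heat_comp_constant R n m M C K * powR_segment_bound m M (1 + rho) +
  2 * be * rho * (1 + rho - 1) * @fisher_ratio_bound R n m M C.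

Let exponentI s : 0 <= s -> 1 <= r s <= 1 + rho.
Proof. by move=> s0; rewrite (ltW (hyper_exponent_gt1 be0 rho0 s0)) hyper_exponent_le. Qed.

Let heat_comp0 : 0 <= @heat_comp_constant R n m M C K.
Proof. exact: heat_comp_constant_ge0 uC (powC (exponentI (lexx 0))). Qed.

Lemma hyper_norm_constant_ge0 : 0 <= hyper_norm_constant.
Proof.
have ratio0 : 0 <= @fisher_ratio_bound R n m M C.
  exact: divr_ge0 (mulr_ge0 (ler0n _ _) (sqr_ge0 _)) (sqr_ge0 m).
have rho_ge0 : 0 <= 1 + rho - 1 by rewrite addrC addKr ltW.
have be_rho : 0 <= 2 * be * rho := mulr_ge0 (mulr_ge0 (ler0n _ 2) (ltW be0)) (ltW rho0).
exact: addr_ge0 (mulr_ge0 heat_comp0 (ltW (powR_segment_bound_gt0 m M (1 + rho))))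
  (mulr_ge0 (mulr_ge0 be_rho rho_ge0) ratio0).
Qed.

Lemma ln_hyper_norm_step s e : 0 <= s -> 0 < e -> e <= 1 -> s + e ^+ 2 <= S ->
  ln_hyper_norm s <= ln_hyper_norm (s + e ^+ 2) + hyper_norm_constant * e ^+ 3.
Proof.
move=> s0 e0 e1 sS; have t0 : 0 <= e ^+ 2 by rewrite exprn_ge0// ltW.
have s'0 : 0 <= s + e ^+ 2 := addr_ge0 s0 t0.
pose q := S - (s + e ^+ 2); have q0 : 0 <= q by rewrite subr_ge0.
have se : s <= s + e ^+ 2 by rewrite lerDl.
have sE : s + e ^+ 2 - s = e ^+ 2 by rewrite addrC addKr.
have rB := hyper_exponentB rho be0 s0 s'0; rewrite sE in rB.
have rL := hyper_exponent_lipschitz be0 rho0 s0 se; rewrite sE in rL.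
have qC := heat_C11 q0 uC; have mJ := mean_functional_heat_comp mI s'0.
have be2 : 0 <= (2 * be)^-1 by rewrite invr_ge0 mulr_ge0// ltW.
have A0 := mean_powR_gt0 (mean_functional_heat_comp mI s0) m0 (heat_C11 t0 qC) (r s).
have := powR_norm_step mJ m0 qC (log_sobolev_heat mI be2 s'0 sob)
  (hyper_exponent_gt1 be0 rho0 s'0) (hyper_exponent_anti be0 rho0 s0 se)
  (hyper_exponent_le be0 rho0 s0) rL rB e0 e1 A0 heat_comp0
  (mean_heat_powR_le m0 qC (powC (exponentI s0)) s0 e0 e1).
rewrite (heat_semigroup t0 q0 (C11_bounded_continuous uC)).
by rewrite (_ : e ^+ 2 + q = S - s); last by rewrite /q; ring.
Qed.

End hyper_norm.

Lemma hypercontractivity_C11 be S a m M C u G : 0 < be -> log_sobolev (2 * be)^-1 I ->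
  0 <= S -> 1 < a -> 0 < m -> C11 m M C u G ->
  (improved_exponent be S a)^-1 * ln (I (fun x => heat S u x `^ improved_exponent be S a)) <=
  a^-1 * ln (I (heat S (fun x => u x `^ a))).
Proof.
move=> be0 sob S0 a1 m0 uC.
have beS : 0 < 1 + 2 * be * S by rewrite ltr_wpDr// !mulr_ge0// ltW.
pose rho := (a - 1) * (1 + 2 * be * S); have rho0 : 0 < rho by rewrite mulr_gt0// subr_gt0.
have [K powC] := powR_C3_on M (1 + rho) m0.
have step s e : 0 <= s -> 0 < e -> e <= 1 -> s + e ^+ 2 <= S ->
    - ln_hyper_norm be rho S u (s + e ^+ 2) <= - ln_hyper_norm be rho S u s + 0 * e ^+ 2 +
    hyper_norm_constant be rho m M C K * e ^+ 3.
  move=> s0 e0 e1 sS; have le_opp (y z w : R) : y <= z + w -> - z <= - y + w by lra.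
  by rewrite mul0r addr0; exact: le_opp (ln_hyper_norm_step be0 rho0 sob m0 uC powC s0 e0 e1 sS).
have := telescope_cubic_error S0 (hyper_norm_constant_ge0 be0 rho0 uC powC) step.
rewrite mul0r addr0 /ln_hyper_norm subrr subr0 !heat0 lerN2.
have -> : hyper_exponent be rho 0 = 1 + rho by rewrite /hyper_exponent mulr0 addr0 divr1.
by have -> : hyper_exponent be rho S = a by rewrite /hyper_exponent mulfK ?gt_eqF// addrC subrK.
Qed.

Lemma hypercontractivity_gt0 be S t a m M g : 0 < be -> log_sobolev (2 * be)^-1 I ->
  0 <= S -> S < t -> 1 < a -> 0 < m -> continuous g -> (forall x, m <= g x <= M) ->
  I (fun x => heat t g x `^ improved_exponent be S a) `^ (improved_exponent be S a)^-1 <=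
  I (heat t (fun x => g x `^ a)) `^ a^-1.
Proof.
move=> be0 sobI S0 St a1 m0 cg gmM; set b := improved_exponent be S a.
have ta0 : 0 < t - S by rewrite subr_gt0.
have a0 : 0 < a := lt_trans ltr01 a1.
have g0 x : 0 < g x by have /andP[mg _] := gmM x; exact: lt_le_trans mg.
have bg := bounded_continuous_of_bounds cg gmM.
have bga : bounded_continuous (fun x => g x `^ a).
  apply: (bounded_continuous_comp (f := fun s => s `^ a) cg gmM) => s /andP[ms _].
  by apply: continuous_powR; exact: lt_le_trans ms.
have [C [G uC]] := heat_smoothing ta0 cg gmM.
have mJ := mean_functional_heat_comp mI S0.
have Ipow_gt0 := mean_powR_gt0 mJ m0 uC a.
have jensen : I (heat S (fun x => heat (t - S) g x `^ a)) <= I (heat t (fun x => g x `^ a)).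
  rewrite -[in leRHS](subrK S t) [t - S + S]addrC -(heat_semigroup S0 (ltW ta0) bga).
  apply: (mean_le mJ (C11_powR_bounded_continuous m0 uC a)
    (heat_bounded_continuous (ltW ta0) bga)) => x; rewrite !heatE//.
  have [cgx [B gB]] := bounded_continuous_addl x bga.
  apply: (dmean_powR_ge (density_gauss n ta0) a1).
  - by move=> z; exact: ltW.
  - exact: continuous_addl.
  - by apply: (dintegrable_bounded (density_gauss n ta0) cgx gB).
have := hypercontractivity_C11 be0 sobI S0 a1 m0 uC.
rewrite (heat_semigroup S0 (ltW ta0) bg) [S + _]addrC subrK -/b => log_le.
have := mean_powR_gt0 mI m0 (heat_C11 S0 uC) b.
rewrite (heat_semigroup S0 (ltW ta0) bg) [S + _]addrC subrK => lhs_gt0.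
have norm_le (x y z : R) : 0 < x -> 0 < y -> y <= z -> b^-1 * ln x <= a^-1 * ln y ->
    x `^ b^-1 <= z `^ a^-1.
  move=> x0 y0 yz lnxy; apply: (@le_trans _ _ (y `^ a^-1)).
    by rewrite -ler_ln ?posrE ?powR_gt0// !ln_powR.
  by rewrite ge0_ler_powR ?invr_ge0 ?nnegrE ?(ltW a0) ?(ltW y0)// (le_trans (ltW y0)).
exact: norm_le lhs_gt0 Ipow_gt0 jensen log_le.
Qed.

(* [g] is truncated from below at [d^(1/a)]. *)
Lemma hypercontractivity_truncated be S t a d g : 0 < be -> log_sobolev (2 * be)^-1 I ->
  0 <= S -> S < t -> 1 < a -> 0 < d -> bounded_continuous g -> (forall x, 0 <= g x) ->
  I (fun x => heat t g x `^ improved_exponent be S a) `^ (improved_exponent be S a)^-1 <=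
  (I (heat t (fun x => g x `^ a)) + d) `^ a^-1.
Proof.
move=> be0 sobI S0 St a1 d0 bg g0; set b := improved_exponent be S a; have [cg [B gB]] := bg.
have t0 : 0 <= t := le_trans S0 (ltW St); have mH x := mean_functional_heat (n := n) x t0.
have mIH := mean_functional_heat_comp mI t0; have a0 : 0 < a := lt_trans ltr01 a1.
have b0 : 0 < b := lt_trans ltr01 (improved_exponent_gt1 be0 S0 a1).
have aV0 : 0 <= a^-1 by rewrite invr_ge0 ltW.
have bV0 : 0 <= b^-1 by rewrite invr_ge0 ltW.
have Hg0 x : 0 <= heat t g x by exact: (mean_ge0 (mH x) bg).
pose k := d `^ a^-1; have k0 : 0 < k by rewrite powR_gt0.
pose gk x := Num.max (g x) k; have gk0 x : 0 <= gk x by rewrite le_max g0.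
have cgk : continuous gk by apply: continuous_fun_max => //; exact: cst_continuous.
have gkI x : k <= gk x <= Num.max B k.
  rewrite /gk le_max lexx orbT/= ge_max !le_max lexx !orbT andbT.
  by rewrite (le_trans (ler_norm _) (gB x)).
have bgk := bounded_continuous_of_bounds cgk gkI.
have Hgk0 x : 0 <= heat t gk x by exact: (mean_ge0 (mH x) bgk).
have lower : I (fun x => heat t g x `^ b) <= I (fun x => heat t gk x `^ b).
  have bH := heat_bounded_continuous t0 bg; have bHk := heat_bounded_continuous t0 bgk.
  apply: (mean_le mI (bounded_continuous_powR b0 bH Hg0) (bounded_continuous_powR b0 bHk Hgk0)).
  move=> x; rewrite ge0_ler_powR ?nnegrE ?(ltW b0)//.
  by apply: (mean_le (mH x)) => // y; rewrite le_max lexx.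
have bga := bounded_continuous_powR a0 bg g0; have bgka := bounded_continuous_powR a0 bgk gk0.
have upper : I (heat t (fun x => gk x `^ a)) <= I (heat t (fun x => g x `^ a)) + d.
  have bd := @bounded_continuous_cst R n d.
  rewrite -[in leRHS](mean_cst mIH d) -(meanD mIH bga bd).
  apply: (mean_le mIH bgka (bounded_continuousD bga bd)) => x.
  have ka : k `^ a = d by rewrite -powRrM mulVf ?gt_eqF// powRr1// ltW.
  by rewrite /gk; case: (leP (g x) k) => _; rewrite ?ka ?lerDl ?lerDr ?powR_ge0// ltW.
have Igb0 := mean_ge0 mI (bounded_continuous_powR b0 (heat_bounded_continuous t0 bg) Hg0)
  (fun x => powR_ge0 _ _).
have Igka0 := mean_ge0 mIH bgka (fun x => powR_ge0 _ _).
apply: le_trans (le_trans (hypercontractivity_gt0 be0 sobI S0 St a1 k0 cgk gkI) _).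
  exact: (ge0_ler_powR bV0 Igb0 (le_trans Igb0 lower) lower).
exact: (ge0_ler_powR aV0 Igka0 (le_trans Igka0 upper) upper).
Qed.

Theorem hypercontractivity be S t a g : 0 < be -> log_sobolev (2 * be)^-1 I ->
  0 <= S -> S < t -> 1 < a -> bounded_continuous g -> (forall x, 0 <= g x) ->
  I (fun x => heat t g x `^ improved_exponent be S a) `^ (improved_exponent be S a)^-1 <=
  I (heat t (fun x => g x `^ a)) `^ a^-1.
Proof.
move=> be0 sobI S0 St a1 bg g0; have a0 : 0 < a := lt_trans ltr01 a1.
have mIH := mean_functional_heat_comp mI (le_trans S0 (ltW St)).
have bga := bounded_continuous_powR a0 bg g0; set T := I (heat t _).
have T0 : 0 <= T by exact: (mean_ge0 mIH bga (fun x => powR_ge0 _ _)).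
have cT : continuous (fun d => `|T + d| `^ a^-1).
  apply: (continuous_fun_comp (h := fun s => `|s| `^ a^-1)) => [|d].
    by apply: continuous_funD; [exact: cst_continuous|move=> d; exact: cvg_id].
  by apply: continuous_norm_powR; rewrite invr_gt0.
have := cvg_at_right_filter (cT 0); rewrite addr0 ger0_norm// => /cvgr_to_ge; apply.
near=> d; have d0 : 0 < d by near: d; exact: nbhs_right_gt.
rewrite (ger0_norm (addr_ge0 T0 (ltW d0))).
exact: (hypercontractivity_truncated be0 sobI S0 St a1 d0 bg g0).
Unshelve. all: by end_near.
Qed.

End hypercontractivity.

(** * Test densities for the log-Sobolev inequality *)

Section C11_differentiable.
Context {R : realType} {n : nat}.
Local Notation V := 'rV[R]_n.

Let dot_is_linear (v : V) : linear (dot v : V -> R).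
Proof. by move=> a x y; rewrite dotDr dotZr. Qed.

Lemma C11_differentiable m M C (F : V -> R) (G : V -> V) x : C11 m M C F G ->
  differentiable F x /\ forall v, derive F x v = dot (G x) v.
Proof.
move=> [C0 _ FG].
pose L : {linear V -> R} := HB.pack (dot (G x) : V -> R)
  (GRing.isLinear.Build R V R *%R (dot (G x)) (dot_is_linear (G x))).
have cL : continuous L by exact: continuous_dot.
have FL : F \o shift x = cst (F x) + L +o_ (0 : V) id.
  apply/eqaddoP => e e0; have C1 : 0 < C + 1 by rewrite ltr_wpDl.
  apply/nbhs_ballP; exists (e / (C + 1)) => /=; first by rewrite divr_gt0.
  move=> h; rewrite -ball_normE/= sub0r normrN => he.
  have -> : (F \o shift x - (cst (F x) + L)) h = F (x + h) - F x - dot (G x) h.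
    by rewrite !fctE /= opprD addrA [h + x]addrC.
  rewrite (le_trans (FG x h))// expr2 mulrA ler_wpM2r//.
  apply: (@le_trans _ _ ((C + 1) * `|h|)); first by rewrite ler_wpM2r// lerDl.
  by rewrite mulrC -ler_pdivlMr// ltW.
have dE := diff_unique cL FL.
have dF : differentiable F x by apply/diff_locallyP; rewrite dE; split.
by split=> // v; rewrite deriveE// dE.
Qed.

End C11_differentiable.

Section density_tilt.
Context {R : realType} {n : nat}.
Local Notation V := 'rV[R]_n.
Variables (nu : V -> R) (m M C : R) (F : V -> R) (G : V -> V).
Hypotheses (dnu : density nu) (nu0 : forall x, 0 < nu x) (m0 : 0 < m) (FC : C11 m M C F G).

Let mI := mean_functional_dmean dnu.
Let c := dmean nu F.
Let c0 : 0 < c := mean_gt0 m0 FC mI.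
Let F0 x : 0 < F x := C11_gt0 m0 FC x.
Let bF : bounded_continuous F := C11_bounded_continuous FC.

Let dintegrable_bc g : bounded_continuous g -> dintegrable nu g.
Proof. by move=> [cg [B gB]]; exact: (dintegrable_bounded dnu cg gB). Qed.

Definition density_tilt x : R := F x * nu x / dmean nu F.

Lemma density_tilt_gt0 x : 0 < density_tilt x.
Proof. by rewrite divr_gt0// mulr_gt0. Qed.

Lemma density_tilt_ratio x : density_tilt x / nu x = F x / dmean nu F.
Proof. by rewrite /density_tilt -/c; field; rewrite !gt_eqF. Qed.

Lemma continuous_density_tilt : continuous density_tilt.
Proof.
apply: continuous_funM; last exact: cst_continuous.
by apply: continuous_funM; [case: bF|exact: density_continuous].
Qed.

Lemma density_tilt_is_density : is_density density_tilt.
Proof.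
split=> [x|]; first exact/ltW/density_tilt_gt0.
rewrite iint_continuous; [|exact: continuous_density_tilt|by move=> x; exact/ltW/density_tilt_gt0].
have iF := dintegrable_bc (bounded_continuousZ c^-1 bF).
rewrite -[RHS](_ : (dmean nu (fun x => c^-1 * F x))%:E = _); last first.
  by rewrite (meanZ mI _ bF) mulVf ?gt_eqF.
rewrite -(dmean_EFin iF); apply: eq_integral => x _.
by rewrite /density_tilt -/c mulrAC [F x / c]mulrC.
Qed.

Lemma Lint_mul_density g : dintegrable nu g -> Lint (fun x => g x * nu x) = (dmean nu g)%:E.
Proof.
move=> ig; have [cg _] := ig; rewrite -(dmean_EFin ig) integralE /Lint.
have cgn : continuous (fun x => g x * nu x).
  by apply: continuous_funM => //; exact: density_continuous.
have pos_part (h : V -> R) : continuous h -> iint (fun x => (Num.max (h x) 0)%:E) =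
    (\int[lebesgue_rV n]_x (Num.max (h x) 0)%:E)%E.
  move=> ch; apply: (iint_continuous (g := fun x => Num.max (h x) 0)) => [|x].
    by apply: continuous_fun_max => //; exact: cst_continuous.
  by rewrite le_max lexx orbT.
rewrite (pos_part _ cgn) (pos_part _ (continuous_funN cgn)).
by congr (_ - _)%E; apply: eq_integral => x _; rewrite ?funeposE ?funenegE /= EFin_max.
Qed.

Lemma KL_density_tilt : KL density_tilt nu =
  ((dmean nu F)^-1 * (dmean nu (fun x => xlnx (F x)) - xlnx (dmean nu F)))%:E.
Proof.
have bx := C11_xlnx_bounded_continuous m0 FC.
have bxF := bounded_continuousB bx (bounded_continuousZ (ln c) bF).
have ik := dintegrable_bc (bounded_continuousZ c^-1 bxF).
rewrite /KL (_ : (fun x => _ * ln _) =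
  (fun x => c^-1 * (xlnx (F x) - ln c * F x) * nu x)); last first.
  apply/funext => x; rewrite density_tilt_ratio ln_div ?posrE// /density_tilt /xlnx -/c; ring.
rewrite (Lint_mul_density ik) (meanZ mI _ bxF) (meanB mI bx (bounded_continuousZ _ bF)).
by rewrite (meanZ mI _ bF) -/c /xlnx [ln c * c]mulrC.
Qed.

Lemma fisher_density_tilt : fisher density_tilt nu =
  ((dmean nu F)^-1 * dmean nu (fun x => (F x)^-1 * sqnorm (G x)))%:E.
Proof.
have [K lnC] := ln_C3_on M (ln c) m0.
have lnB a : m <= a <= M -> {for a, continuous (fun x => ln x - ln c)}.
  by move=> aI; exact: is_derive_continuous (C3_on_derive0 lnC aI).
have [B lnFB] := continuous_bounded_segment lnB.
have lnFC := C11_comp FC lnC (fun a aI => etrans (esym (ler_norml _ _)) (lnFB a aI)).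
have bfi := C11_inv_fisher_bounded_continuous m0 FC.
have bk := bounded_continuousZ c^-1 bfi; have ik := dintegrable_bc bk.
have integrandE x : density_tilt x * grad_sqnorm (fun y => ln (density_tilt y / nu y)) x =
    c^-1 * ((F x)^-1 * sqnorm (G x)) * nu x.
  have -> : (fun y => ln (density_tilt y / nu y)) = (fun y => ln (F y) - ln c).
    by apply/funext => y; rewrite density_tilt_ratio ln_div ?posrE.
  have -> : grad_sqnorm (fun y => ln (F y) - ln c) x = (F x)^-1 ^+ 2 * sqnorm (G x).
    rewrite -sqnormZ; apply: eq_bigr => i _.
    by rewrite /pderiv (C11_differentiable x lnFC).2 dotC dot_delta.
  by rewrite /density_tilt -/c; field; rewrite !gt_eqF.
rewrite /fisher (_ : (fun x => _) = (fun x => (c^-1 * ((F x)^-1 * sqnorm (G x)) * nu x)%:E));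
  last by apply/funext => x; rewrite integrandE.
rewrite iint_continuous => [||x].
- by rewrite (dmean_EFin ik) (meanZ mI _ bfi).
- by apply: continuous_funM; [case: bk|exact: density_continuous].
- rewrite mulr_ge0 ?(ltW (nu0 x))// mulr_ge0 ?invr_ge0 ?(ltW c0)// mulr_ge0 ?sqnorm_ge0//.
  by rewrite invr_ge0 ltW.
Qed.

End density_tilt.

Lemma LSI_log_sobolev (R : realType) n (nu : 'rV[R]_n -> R) be :
  (forall x, 0 < nu x) -> (forall x, differentiable nu x) -> is_density nu -> LSI nu be ->
  log_sobolev (2 * be)^-1 (dmean nu).
Proof.
move=> nu0 diff_nu is_dnu lsi m M C F G m0 FC.
have dnu : density nu.
  by split=> // x; exact: differentiable_continuous (diff_nu x).
have c0 := mean_gt0 m0 FC (mean_functional_dmean dnu).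
have diff_tilt x : differentiable (density_tilt nu F) x.
  have -> : density_tilt nu F = (F * nu) * cst (dmean nu F)^-1.
    by apply/funext => y; rewrite !fctE.
  apply: differentiableM; last exact: differentiable_cst.
  by apply: differentiableM; [exact: (C11_differentiable x FC).1|exact: diff_nu].
have := lsi _ (density_tilt_gt0 dnu nu0 m0 FC) diff_tilt (density_tilt_is_density dnu nu0 m0 FC).
rewrite (KL_density_tilt dnu nu0 m0 FC) (fisher_density_tilt dnu nu0 m0 FC) -EFinM lee_fin mulrCA.
by rewrite ler_pM2l ?invr_gt0// lerBlDl.
Qed.

(** * Contraction of density ratios *)

Section density_ratio.
Context {R : realType} {n : nat}.
Local Notation V := 'rV[R]_n.
Variable nu : V -> R.
Hypotheses (dnu : density nu) (nu0 : forall x, 0 < nu x).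
Implicit Types (w g h : V -> R) (p q : R).

Lemma ratio_ge0 w x : density w -> 0 <= w x / nu x.
Proof. by move=> dw; rewrite divr_ge0 ?(density_ge0 dw)// ltW. Qed.

Lemma continuous_ratio w : density w -> continuous (fun x => w x / nu x).
Proof. by move=> dw; apply: continuous_fun_div => //; exact: density_continuous. Qed.

Lemma dmean_ratio w g : dmean w g = dmean nu (fun x => g x * (w x / nu x)).
Proof. by apply: eq_Rintegral => x _; rewrite -mulrA divfK// gt_eqF. Qed.

Lemma dintegrable_ratio w g : density w -> dintegrable w g ->
  dintegrable nu (fun x => g x * (w x / nu x)).
Proof.
move=> dw [cg ig]; split; first exact: continuous_funM cg (continuous_ratio dw).
by apply: eq_integrable ig => // x _; rewrite -[in RHS]mulrA divfK// gt_eqF.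
Qed.

Lemma dintegrable_ratio1 w : density w -> dintegrable nu (fun x => w x / nu x).
Proof.
move=> dw; have := dintegrable_ratio dw (dintegrable_cst dw 1).
by under eq_fun do rewrite mul1r.
Qed.

Lemma dmean_ratio1 w : density w -> dmean nu (fun x => w x / nu x) = 1.
Proof.
move=> dw; have := dmean_ratio w (fun=> 1).
by under [in X in _ = X]eq_fun do rewrite mul1r; rewrite (dmean_cst dw).
Qed.

Lemma dmean_ratio_powR_ge1 w p : 1 < p -> density w ->
  dintegrable nu (fun x => (w x / nu x) `^ p) -> 1 <= dmean nu (fun x => (w x / nu x) `^ p).
Proof.
move=> p1 dw ip.
have := dmean_powR_ge dnu p1 (fun x => ratio_ge0 x dw) (continuous_ratio dw) ip.
by rewrite dmean_ratio1// powR1.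
Qed.

Section interpolation.
Variables (h : V -> R) (p q : R).
Hypotheses (p1 : 1 < p) (q1 : 1 < q) (h0 : forall x, 0 <= h x).
Hypotheses (ih : dintegrable nu h) (ihp : dintegrable nu (fun x => h x `^ p)).

Let p0 : 0 < p. Proof. exact: lt_trans p1. Qed.
Let q0 : 0 < q. Proof. exact: lt_trans q1. Qed.
Let r0 : 0 < q / (q - 1). Proof. by rewrite divr_gt0// subr_gt0. Qed.
Let qr : q^-1 + (q / (q - 1))^-1 = 1. Proof. by field; rewrite !gt_eqF ?subr_gt0. Qed.
Let pq0 : 0 < p / q. Proof. exact: divr_gt0. Qed.
Let qV0 : 0 < 1 - q^-1. Proof. by rewrite subr_gt0 invf_lt1. Qed.

Let split_powR :
  (fun x => h x `^ (1 + (p - 1) / q)) = (fun x => h x `^ (p / q) * h x `^ (1 - q^-1)).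
Proof.
apply/funext => x; have -> : 1 + (p - 1) / q = p / q + (1 - q^-1) by field; rewrite gt_eqF.
by rewrite powRD// (gt_eqF (addr_gt0 pq0 qV0)).
Qed.

Let powRp : (fun x => (h x `^ (p / q)) `^ q) = (fun x => h x `^ p).
Proof. by apply/funext => x; rewrite -powRrM divfK ?gt_eqF. Qed.

Let powR1q : (fun x => (h x `^ (1 - q^-1)) `^ (q / (q - 1))) = h.
Proof.
apply/funext => x; rewrite -powRrM (_ : (1 - q^-1) * (q / (q - 1)) = 1) ?powRr1//.
by field; rewrite !gt_eqF// subr_gt0.
Qed.

Let cont_powR r : 0 < r -> continuous (fun x => h x `^ r).
Proof. by move=> r_gt0; apply: continuous_fun_powR => //; case: ih. Qed.

Let ihq : dintegrable nu (fun x => (h x `^ (p / q)) `^ q). Proof. by rewrite powRp. Qed.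
Let ihr : dintegrable nu (fun x => (h x `^ (1 - q^-1)) `^ (q / (q - 1))).
Proof. by rewrite powR1q. Qed.

Lemma dintegrable_interpolation : dintegrable nu (fun x => h x `^ (1 + (p - 1) / q)).
Proof.
rewrite split_powR; exact: (dintegrable_hoelder dnu q0 r0 qr (cont_powR pq0) (cont_powR qV0)
  (fun x => powR_ge0 _ _) (fun x => powR_ge0 _ _) ihq ihr).
Qed.

Lemma dmean_interpolation : dmean nu (fun x => h x `^ (1 + (p - 1) / q)) <=
  dmean nu (fun x => h x `^ p) `^ q^-1 * dmean nu h `^ (q / (q - 1))^-1.
Proof.
have hoelder := dmean_hoelder dnu q0 r0 qr (cont_powR pq0) (cont_powR qV0)
  (fun x => powR_ge0 _ _) (fun x => powR_ge0 _ _) ihq ihr.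
by rewrite split_powR -[in leRHS]powRp -[X in _ * dmean nu X `^ _]powR1q; exact: hoelder.
Qed.

End interpolation.
End density_ratio.

Section conv_ratio.
Context {R : realType} {n : nat}.
Local Notation V := 'rV[R]_n.
Variables (nu : V -> R) (t : R).
Hypotheses (dnu : density nu) (t0 : 0 < t).
Implicit Types (w : V -> R) (y : V).

Definition conv_ratio w y : R := gauss_conv t w y / gauss_conv t nu y.

Lemma conv_ratio_ge0 w y : density w -> 0 <= conv_ratio w y.
Proof. by move=> dw; rewrite divr_ge0// gauss_conv_ge0. Qed.

Lemma continuous_conv_ratio w : density w -> continuous (conv_ratio w).
Proof.
move=> dw; apply: continuous_fun_div; [exact: continuous_gauss_conv|exact: continuous_gauss_conv|].
by move=> y; exact: gauss_conv_gt0.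
Qed.

End conv_ratio.

Section conv_ratio_contraction.
Context {R : realType} {n : nat}.
Local Notation V := 'rV[R]_n.
Local Notation leb := (lebesgue_rV n).
Variables (nu : V -> R) (be S t p : R).
Hypotheses (dnu : density nu) (nu0 : forall x, 0 < nu x).
Hypothesis sob : log_sobolev (2 * be)^-1 (dmean nu).
Hypotheses (be0 : 0 < be) (S0 : 0 < S) (St : S < t) (p1 : 1 < p).
Implicit Types (w f g : V -> R) (x y : V).

Local Notation theta := (1 + 2 * be * S).

Let t0 : 0 < t. Proof. exact: lt_trans St. Qed.
Let p0 : 0 < p. Proof. exact: lt_trans p1. Qed.
Let p10 : 0 < p - 1. Proof. by rewrite subr_gt0. Qed.
Let theta1 : 1 < theta. Proof. by rewrite ltrDl !mulr_gt0. Qed.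
Let theta0 : 0 < theta. Proof. exact: lt_trans theta1. Qed.
Let thetap0 : 0 < theta + p - 1. Proof. by rewrite -addrA addr_gt0. Qed.
Let dconv : density (gauss_conv t nu). Proof. exact: density_gauss_conv. Qed.

(* The duality step: [f^p nu_t <= f^(p-1) w_t] pointwise, and [w_t] is [w] tested against [P_t]. *)
Lemma dmean_heat_powR_le w f : density w -> bounded_continuous f -> (forall x, 0 <= f x) ->
  (forall y, f y <= conv_ratio nu t w y) ->
  dmean nu (heat t (fun y => f y `^ p)) <=
  dmean nu (fun x => heat t (fun y => f y `^ (p - 1)) x * (w x / nu x)).
Proof.
move=> dw bf f0 fle; have dcw := density_gauss_conv t0 dw.
have bfp := bounded_continuous_powR p0 bf f0; have bfp1 := bounded_continuous_powR p10 bf f0.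
rewrite -dmean_ratio// -(dmean_gauss_conv t0 dw bfp1) -(dmean_gauss_conv t0 dnu bfp).
have conv0 y : 0 < gauss_conv t nu y by exact: gauss_conv_gt0.
rewrite [leRHS](dmean_ratio conv0); have [cfp [B fpB]] := bfp; have [cfp1 [B1 fp1B]] := bfp1.
apply: (dmean_le dconv (dintegrable_bounded dconv cfp fpB)
  (dintegrable_ratio dconv conv0 dcw (dintegrable_bounded dcw cfp1 fp1B))) => y.
by rewrite -(mulr_powRB1 (f0 y) p0) mulrC ler_wpM2l ?powR_ge0.
Qed.

Let absorb (x b : R) : 0 <= x -> 0 <= b -> x <= x `^ (p / (p - 1))^-1 * b -> x <= b `^ p.
Proof.
rewrite le_eqVlt => /predU1P[<- _ _|x0 b0 x_le]; first exact: powR_ge0.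
have k0 : 0 < x `^ (p / (p - 1))^-1 by rewrite powR_gt0.
have : x `^ p^-1 <= b.
  rewrite -(ler_pM2l k0) (le_trans _ x_le)// -powRD_gt0//.
  rewrite (_ : (p / (p - 1))^-1 + p^-1 = 1) ?powRr1 ?(ltW x0)//.
  by field; rewrite !gt_eqF.
move=> /(ge0_ler_powR (ltW p0) (powR_ge0 _ _) b0).
by rewrite -powRrM mulVf ?gt_eqF// powRr1// ltW.
Qed.

Lemma heat_powR_contraction w f : density w -> dintegrable nu (fun x => (w x / nu x) `^ p) ->
  bounded_continuous f -> (forall x, 0 <= f x) -> (forall y, f y <= conv_ratio nu t w y) ->
  dmean nu (heat t (fun y => f y `^ p)) <=
  dmean nu (fun x => (w x / nu x) `^ p) `^ (p / (theta + p - 1)).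
Proof.
move=> dw ip bf f0 fle; set T := dmean nu (heat t _); set A := dmean nu (fun x => _ `^ p).
have mH x := mean_functional_heat (n := n) x (ltW t0); have mI := mean_functional_dmean dnu.
have fp0 y : 0 <= f y `^ (p - 1) := powR_ge0 _ _.
have bfp1 := bounded_continuous_powR p10 bf f0; have bP := heat_bounded_continuous (ltW t0) bfp1.
pose P := heat t (fun y => f y `^ (p - 1)); have P0 x : 0 <= P x := mean_ge0 (mH x) bfp1 fp0.
pose a := p / (p - 1); have a1 : 1 < a by rewrite ltr_pdivlMr// mul1r gtrBl.
pose b := improved_exponent be S a; pose b' := 1 + (p - 1) / theta.
have b0 : 0 < b := lt_trans ltr01 (improved_exponent_gt1 be0 (ltW S0) a1).
have b'0 : 0 < b' by rewrite ltr_wpDr// divr_ge0// ltW.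
have conjugate : b^-1 + b'^-1 = 1.
  have -> : b = (theta + p - 1) / (p - 1).
    by rewrite /b /improved_exponent /a; field; rewrite gt_eqF.
  have -> : b' = (theta + p - 1) / theta by rewrite -addrA mulrDl mulfV ?gt_eqF.
  by field; rewrite !gt_eqF.
have hyper : dmean nu (fun x => P x `^ b) `^ b^-1 <= T `^ a^-1.
  have powE : (fun y => (f y `^ (p - 1)) `^ a) = (fun y => f y `^ p).
    by apply/funext => y; rewrite -powRrM mulrC divfK ?gt_eqF.
  by have := hypercontractivity mI be0 sob (ltW S0) St a1 bfp1 fp0; rewrite powE.
have [cP [B PB]] := bounded_continuous_powR b0 bP P0.
have iPb := dintegrable_bounded dnu cP PB.
have h0 x := ratio_ge0 nu0 x dw; have ih := dintegrable_ratio1 dnu nu0 dw.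
have ihb := dintegrable_interpolation dnu p1 theta1 h0 ih ip.
have hoelder := dmean_hoelder dnu b0 b'0 conjugate (proj1 bP) (proj1 ih) P0 h0 iPb ihb.
have interpolation : dmean nu (fun x => (w x / nu x) `^ b') `^ b'^-1 <= A `^ (theta + p - 1)^-1.
  have := dmean_interpolation dnu p1 theta1 h0 ih ip.
  rewrite (dmean_ratio1 nu0 dw) powR1 mulr1 -/b' -/A => hb_le.
  have hb0 : 0 <= dmean nu (fun x => (w x / nu x) `^ b').
    by apply: (dmean_ge0 dnu) => x; exact: powR_ge0.
  have b'V0 : 0 <= b'^-1 by rewrite invr_ge0 ltW.
  have rootE (z : R) : (z `^ theta^-1) `^ b'^-1 = z `^ (theta + p - 1)^-1.
    by rewrite -powRrM -invfM /b' mulrDr mulr1 mulrCA mulfV ?gt_eqF// mulr1 addrA.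
  by rewrite -rootE; exact: (ge0_ler_powR b'V0 hb0 (powR_ge0 _ _) hb_le).
rewrite mulrC powRrM; apply: absorb; [|exact: powR_ge0|].
  apply: (mean_ge0 (mean_functional_heat_comp mI (ltW t0)) (bounded_continuous_powR p0 bf f0)).
  by move=> x; exact: powR_ge0.
apply: le_trans (dmean_heat_powR_le dw bf f0 fle) (le_trans hoelder _).
exact: ler_pM (powR_ge0 _ _) (powR_ge0 _ _) hyper interpolation.
Qed.

Theorem conv_ratio_contraction w : density w -> dintegrable nu (fun x => (w x / nu x) `^ p) ->
  (\int[leb]_y (conv_ratio nu t w y `^ p * gauss_conv t nu y)%:E <=
   (dmean nu (fun x => (w x / nu x) `^ p) `^ (p / (theta + p - 1)))%:E)%E.
Proof.
move=> dw ip; have r0 y := conv_ratio_ge0 dnu t0 y dw; have cr := continuous_conv_ratio dnu t0 dw.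
have cn0 y : 0 <= gauss_conv t nu y := gauss_conv_ge0 t0 dnu y.
pose f j y := Num.min (conv_ratio nu t w y) j%:R; have f0 j y : 0 <= f j y by rewrite le_min r0/=.
have cf j : continuous (f j) by apply: continuous_fun_min => //; exact: cst_continuous.
have bf j : bounded_continuous (f j).
  by apply: (@bounded_continuous_of_bounds _ _ _ 0 j%:R) => // y; rewrite f0 ge_min lexx orbT.
pose F j y : \bar R := (f j y `^ p * gauss_conv t nu y)%:E.
have F0 j y : [set: V] y -> (0 <= F j y)%E by rewrite lee_fin mulr_ge0// powR_ge0.
have mF j : measurable_fun setT (F j).
  apply: continuous_measurable_EFin; apply: continuous_funM; first exact: continuous_fun_powR.
  exact: continuous_gauss_conv.
have F_mono y : [set: V] y -> nondecreasing_seq (F ^~ y).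
  move=> _ i j ij; rewrite lee_fin ler_wpM2r// ge0_ler_powR ?nnegrE ?(ltW p0)//.
  by rewrite le_min !ge_min lexx /= ler_nat ij orbT.
have limF y : limn (F ^~ y) = (conv_ratio nu t w y `^ p * gauss_conv t nu y)%:E.
  apply/cvg_lim => //; apply: cvg_near_cst; near=> j; rewrite /F /f.
  suff /min_idPl -> : conv_ratio nu t w y <= j%:R by [].
  by near: j; exact: nbhs_infty_ger.
under eq_integral do rewrite -limF.
rewrite (monotone_convergence leb measurableT mF F0 F_mono); apply: lime_le.
  apply: ereal_nondecreasing_is_cvgn => i j ij.
  apply: ge0_le_integral; [by []|exact: F0|exact: mF|exact: mF|].
  by move=> y yT; exact: F_mono.
apply: nearW => j; have bfp := bounded_continuous_powR p0 (bf j) (f0 j).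
have [cfp [B fpB]] := bfp.
rewrite (dmean_EFin (dintegrable_bounded dconv cfp fpB)) (dmean_gauss_conv t0 dnu bfp) lee_fin.
by apply: heat_powR_contraction => // y; rewrite ge_min lexx.
Unshelve. all: by end_near.
Qed.

End conv_ratio_contraction.

(** * The proximal Langevin step *)

Section euclidean_norm.
Context {R : realType} {n : nat}.
Local Notation V := 'rV[R]_n.
Implicit Types (v w z : V) (a : R).

Lemma enorm_ge0 z : 0 <= enorm z. Proof. exact: sqrtr_ge0. Qed.

Lemma norm_le_enorm z : `|z| <= enorm z.
Proof. by rewrite -ler_sqr ?nnegrE ?enorm_ge0// sqr_enorm sqr_norm_le_sqnorm. Qed.

Lemma enorm0 : enorm (0 : V) = 0.
Proof. by rewrite /enorm big1 ?sqrtr0// => i _; rewrite mxE expr0n. Qed.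

Lemma enormZ a z : enorm (a *: z) = `|a| * enorm z.
Proof. by rewrite /enorm -[\sum_i _]/(sqnorm _) sqnormZ sqrtrM ?sqr_ge0// sqrtr_sqr. Qed.

Lemma sqr_dot_le v z : dot v z ^+ 2 <= sqnorm v * sqnorm z.
Proof.
have [z0|z0] := eqVneq (sqnorm z) 0.
  have -> : z = 0.
    apply/eqP; rewrite -normr_eq0 -sqrf_eq0; apply/eqP/le_anti.
    by rewrite sqr_ge0 andbT -z0 sqr_norm_le_sqnorm.
  by rewrite /dot big1 ?expr0n ?mulr_ge0 ?sqnorm_ge0// => i _; rewrite mxE mulr0.
have zgt0 : 0 < sqnorm z by rewrite lt_def z0 sqnorm_ge0.
have := sqnorm_ge0 (sqnorm z *: v - dot v z *: z).
rewrite sqnormB !sqnormZ dotZl dotZr (dotC z v).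
set d := dot v z; set a := sqnorm v; set b := sqnorm z => discriminant.
by rewrite -subr_ge0 -(pmulr_rge0 _ zgt0) -/b; lra.
Qed.

Lemma norm_dot_le_enorm v z : `|dot v z| <= enorm v * enorm z.
Proof.
rewrite -ler_sqr ?nnegrE ?mulr_ge0 ?enorm_ge0//.
by rewrite real_normK ?num_real// exprMn !sqr_enorm sqr_dot_le.
Qed.

Lemma ler_enormB v w : enorm (v - w) <= enorm v + enorm w.
Proof.
rewrite -ler_sqr ?nnegrE ?addr_ge0 ?enorm_ge0// sqr_enorm sqnormB sqrrD !sqr_enorm.
by have := norm_dot_le_enorm w v; rewrite ler_norml => /andP[]; lra.
Qed.

Lemma continuous_enorm_dist v : continuous (fun z => enorm (z - v)).
Proof.
apply: (continuous_fun_comp (h := @Num.sqrt R)) => [|x]; last exact: sqrt_continuous.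
exact: (continuous_addr (x := - v) (@continuous_sqnorm R n)).
Qed.

Definition bump v a z : R := Num.max (a - enorm (z - v)) 0.

Lemma continuous_bump v a : continuous (bump v a).
Proof.
apply: continuous_fun_max; last exact: cst_continuous.
apply: continuous_funD; first exact: cst_continuous.
by apply: continuous_funN; exact: continuous_enorm_dist.
Qed.

Lemma bump_ge0 v a z : 0 <= bump v a z.
Proof. by rewrite le_max lexx orbT. Qed.

Lemma bump_le v a z : 0 <= a -> bump v a z <= a.
Proof. by move=> a0; rewrite ge_max a0 andbT gerBl enorm_ge0. Qed.

Lemma bump_center v a : 0 <= a -> bump v a v = a.
Proof. by move=> a0; rewrite /bump subrr enorm0 subr0; apply/max_idPl. Qed.

Lemma bump_far v a z : a <= enorm (z - v) -> bump v a z = 0.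
Proof. by move=> far; apply/max_idPr; rewrite subr_le0. Qed.

Lemma continuous_rV (T : topologicalType) (F : T -> V) :
  (forall i, continuous (fun x => F x 0 i)) -> continuous F.
Proof.
move=> cF x; apply/cvg_ballP => e e0.
have near_coord : \forall y \near x, forall i, ball (F x 0 i) e (F y 0 i).
  by apply: filter_forall => i; exact: (cvg_ball (cF i x) e0).
by apply: filterS near_coord => y xy; split=> // i j; rewrite ord1.
Qed.

End euclidean_norm.

Section pla_map.
Context {R : realType} {n : nat}.
Local Notation V := 'rV[R]_n.

Lemma is_derive_line (F : V -> R) (y w : V) (s : R) : derivable F (y + s *: w) w ->
  is_derive s 1 (fun t : R => F (y + t *: w)) (derive F (y + s *: w) w).
Proof.
move=> dF; pose g (t : R) := F (y + t *: w).
have quotientE : (fun h : R => h^-1 *: ((g \o shift s) (h *: 1) - g s)) =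
    (fun h : R => h^-1 *: ((F \o shift (y + s *: w)) (h *: w) - F (y + s *: w))).
  by apply/funext => h; rewrite /g /= [h *: 1]mulr1 scalerDl addrCA.
by apply: DeriveDef; [move: dF; rewrite /derivable -quotientE|rewrite [RHS]/derive -quotientE].
Qed.

Lemma derive_grad (f : V -> R) x v : differentiable f x -> derive f x v = dot (grad f x) v.
Proof.
move=> df; rewrite deriveE// {1}(row_sum_delta v) linear_sum.
by apply: eq_bigr => i _; rewrite linearZ/= /grad mxE /pderiv deriveE// mulrC.
Qed.

Variables (f : V -> R) (L eps : R).
Hypotheses (df : forall x, differentiable f x)
  (ddf : forall v x, differentiable (fun y => derive f y v) x)
  (hess : forall x v w, `|derive (fun y => derive f y v) x w| <= L * enorm v * enorm w).

Definition pla_map (x : V) : V := x + eps *: grad f x.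

Lemma continuous_pla_map : continuous pla_map.
Proof.
apply: continuous_rV => i; under eq_fun do rewrite !mxE.
apply: continuous_funD; first exact: continuous_coord.
by apply: continuous_funZ => x; exact: differentiable_continuous (ddf _ x).
Qed.

Hypothesis L0 : 0 <= L.

Lemma grad_lipschitz x y : enorm (grad f x - grad f y) <= L * enorm (x - y).
Proof.
set v := grad f x - grad f y; set w := x - y.
have line (t : R) : Num.min 0 1 <= t <= Num.max 0 1 ->
    is_derive t 1 (fun s => derive f (y + s *: w) v)
      (derive (fun z => derive f z v) (y + t *: w) w).
  by move=> _; apply: (is_derive_line (F := fun z => derive f z v)); exact: diff_derivable.
have := lipschitz_of_derive line (fun t _ => hess (y + t *: w) v w).
rewrite subr0 normr1 mulr1 scale1r scale0r addr0 [y + w]addrC subrK !derive_grad//.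
rewrite (dotC (grad f x)) (dotC (grad f y)) -dotBr dot_self -sqr_enorm ger0_norm ?sqr_ge0//.
have [->|v0] := eqVneq (enorm v) 0; first by rewrite mulr_ge0 ?enorm_ge0.
by rewrite expr2 mulrAC ler_pM2r// lt_def v0 enorm_ge0.
Qed.

Lemma pla_map_expanding x y : 0 <= eps ->
  (1 - eps * L) * enorm (x - y) <= enorm (pla_map x - pla_map y).
Proof.
move=> eps0; have := ler_wpM2l eps0 (grad_lipschitz x y).
have := ler_enormB (pla_map x - pla_map y) (eps *: (grad f x - grad f y)).
have -> : pla_map x - pla_map y - eps *: (grad f x - grad f y) = x - y.
  by apply/rowP => i; rewrite /pla_map !mxE; ring.
by rewrite enormZ (ger0_norm eps0); lra.
Qed.

End pla_map.

Section expanding_map.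
Context {R : realType} {n : nat}.
Local Notation V := 'rV[R]_n.
Local Notation leb := (lebesgue_rV n).
Variables (T : V -> V) (c : R).
Hypotheses (cT : continuous T) (c0 : 0 < c)
  (expanding : forall x y, c * enorm (x - y) <= enorm (T x - T y)).
Implicit Types (s w phi : V -> R) (x y : V).

Lemma continuous_comp_map phi : continuous phi -> continuous (fun x => phi (T x)).
Proof. by move=> cphi x; apply: continuous_comp; [exact: cT|exact: cphi]. Qed.

(* Test against a bump around [T x]: its pull-back by [T] is concentrated near [x]. *)
Let density_le_of_comp s w : density s -> density w ->
  (forall phi, bounded_continuous phi -> (forall y, 0 <= phi y) ->
    dmean s (fun x => phi (T x)) = dmean w (fun x => phi (T x))) -> forall x, s x <= w x.
Proof.
move=> ds dw same_means x; rewrite leNgt; apply/negP => wx_lt.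
have cD : continuous (fun y => s y - w y).
  apply: continuous_funD; first exact: density_continuous.
  by apply: continuous_funN; exact: density_continuous.
have [d d0 near_x] : exists2 d : R, 0 < d & forall y, `|x - y| < d -> 0 < s y - w y.
  have := cvgr_gt _ (cD x) 0; rewrite subr_gt0 => /(_ _ wx_lt)/nbhs_ballP[d /= d0 dx].
  by exists d => // y xy; apply: dx; rewrite -ball_normE.
pose phi := bump (T x) (c * d); have cd0 : 0 < c * d by rewrite mulr_gt0.
have phiI y : 0 <= phi y <= c * d by rewrite bump_ge0 bump_le// ltW.
have bphi := bounded_continuous_of_bounds (@continuous_bump R n (T x) (c * d)) phiI.
have cphiT := continuous_comp_map (@continuous_bump R n (T x) (c * d)).
have iphi v (dv : density v) : dintegrable v (fun y => phi (T y)).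
  apply: (dintegrable_bounded dv cphiT (C := c * d)) => y.
  by have /andP[phi0 phi_le] := phiI (T y); rewrite ger0_norm.
pose k y := phi (T y) * (s y - w y).
have k0 y : 0 <= k y.
  have [far|near] := leP d (enorm (y - x)).
    by rewrite /k /phi bump_far ?mul0r// (le_trans _ (expanding y x))// ler_pM2l.
  rewrite mulr_ge0 ?bump_ge0// ltW// near_x// distrC.
  exact: le_lt_trans (norm_le_enorm _) near.
have kx : 0 < k x by rewrite /k /phi bump_center ?ltW// mulr_gt0// subr_gt0.
have := integral_continuous_gt0 (continuous_funM cphiT cD) k0 (ex_intro _ x kx).
have -> : (\int[leb]_y (phi (T y) * (s y - w y))%:E = 0)%E.
  have [_ is_] := iphi s ds; have [_ iw] := iphi w dw.
  under eq_integral do rewrite mulrBr EFinB.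
  rewrite (integralB measurableT is_ iw) (dmean_EFin (iphi s ds)) (dmean_EFin (iphi w dw)).
  by rewrite (same_means phi bphi (bump_ge0 _ _)) -EFinB subrr.
by rewrite ltxx.
Qed.

Lemma density_eq_of_comp s w : density s -> density w ->
  (forall phi, bounded_continuous phi -> (forall y, 0 <= phi y) ->
    dmean s (fun x => phi (T x)) = dmean w (fun x => phi (T x))) -> s = w.
Proof.
move=> ds dw same_means; apply/funext => x; apply/le_anti.
rewrite (density_le_of_comp ds dw same_means) (density_le_of_comp dw ds)//.
by move=> phi bphi phi0; rewrite same_means.
Qed.

End expanding_map.

Section pla_step.
Context {R : realType} {n : nat}.
Local Notation V := 'rV[R]_n.
Local Notation leb := (lebesgue_rV n).
Local Notation gam := (@gauss_density R n).
Variables (f : V -> R) (eps c : R).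
Local Notation T := (pla_map f eps).
Hypotheses (cT : continuous T) (eps0 : 0 < eps).
Implicit Types (rho sigma phi : V -> R).

Lemma pla_step_integral rho sigma phi : density rho -> density sigma ->
  pla_step f eps rho sigma -> continuous phi -> (forall y, 0 <= phi y) ->
  (\int[leb]_x (phi (T x) * sigma x)%:E = \int[leb]_y (phi y * gauss_conv eps rho y)%:E)%E.
Proof.
move=> drho dsigma step cphi phi0.
have [crho csigma] := (density_continuous drho, density_continuous dsigma).
have [rho0 sigma0] := (density_ge0 drho, density_ge0 dsigma).
rewrite -(integral_mul_gauss_conv eps0 drho cphi phi0) -iint_continuous; last 2 first.
- by apply: continuous_funM => //; exact: (continuous_comp_map cT).
- by move=> x; exact: mulr_ge0.
rewrite (step _ cphi phi0).
pose F (p : V * V) : \bar R := (phi (p.1 + p.2) * rho p.1 * gam eps p.2)%:E.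
have F0 p : (0 <= F p)%E by rewrite lee_fin !mulr_ge0.
have mF : measurable_fun setT F.
  apply/measurable_EFinP; apply: measurable_funM; last first.
    by apply: measurable_fun_continuous_comp_rV => //; exact: continuous_gauss.
  apply: measurable_funM; apply: measurable_fun_continuous_comp_rV => //.
  exact: measurable_funD_rV.
have iintF x : iint (fun z => F (x, z)) = (\int[leb]_z F (x, z))%E.
  apply: iint_continuous => [|z]; last by rewrite !mulr_ge0.
  apply: continuous_funM; last exact: continuous_gauss.
  by apply: continuous_funM; [exact: continuous_addl|exact: (@cst_continuous _ _ (rho x))].
under eq_fun do rewrite iintF.
by apply: iintE => [|x]; [exact: measurable_fun_fubini_tonelli_F|exact: integral_ge0].
Qed.

Variables (nu : V -> R).
Hypotheses (dnu : density nu) (nu0 : forall x, 0 < nu x) (stationary : pla_step f eps nu nu).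

Section expanding.
Hypotheses (c0 : 0 < c) (expanding : forall x y, c * enorm (x - y) <= enorm (T x - T y)).

(* Both sides have the same image under [T]: for the right-hand side this is stationarity of [nu]
   tested against [phi * conv_ratio nu eps rho]. *)
Lemma pla_step_density rho sigma : density rho -> density sigma -> pla_step f eps rho sigma ->
  sigma = (fun x => conv_ratio nu eps rho (T x) * nu x).
Proof.
move=> drho dsigma step; have cr := continuous_conv_ratio dnu eps0 drho.
have r0 y := conv_ratio_ge0 dnu eps0 y drho.
pose s x := conv_ratio nu eps rho (T x) * nu x.
have s0 x : 0 <= s x by rewrite mulr_ge0// ltW.
have cs : continuous s.
  by apply: continuous_funM; [exact: (continuous_comp_map cT)|exact: density_continuous].
have imageE phi : continuous phi -> (forall y, 0 <= phi y) ->
    (\int[leb]_x (phi (T x) * s x)%:E = \int[leb]_x (phi (T x) * sigma x)%:E)%E.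
  move=> cphi phi0; rewrite (pla_step_integral drho dsigma step cphi phi0).
  have := pla_step_integral dnu dnu stationary (continuous_funM cphi cr)
    (fun y => mulr_ge0 (phi0 y) (r0 y)).
  under eq_integral do rewrite -mulrA; move=> ->; apply: eq_integral => y _.
  by rewrite -mulrA divfK// gt_eqF// gauss_conv_gt0.
have ds : density s.
  split=> //; split=> //; rewrite iint_continuous//.
  have := imageE (fun=> 1) (@cst_continuous _ _ _) (fun=> ler01).
  by under eq_integral do rewrite mul1r; under [in RHS]eq_integral do rewrite mul1r;
    rewrite (integral_density dsigma).
apply: (density_eq_of_comp cT c0 expanding dsigma ds) => phi [cphi _] phi0.
by rewrite /dmean /Rintegral imageE.
Qed.

Variables (be p : R).
Hypotheses (sob : log_sobolev (2 * be)^-1 (dmean nu)) (be0 : 0 < be) (p1 : 1 < p).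

(* The contraction applies to any smoothing time below [eps]; three quarters of it are enough. *)
Lemma pla_step_contraction rho sigma : density rho -> density sigma -> pla_step f eps rho sigma ->
  dintegrable nu (fun x => (rho x / nu x) `^ p) ->
  dintegrable nu (fun x => (sigma x / nu x) `^ p) /\
  dmean nu (fun x => (sigma x / nu x) `^ p) <=
  dmean nu (fun x => (rho x / nu x) `^ p) `^ (p / (1 + 2 * be * (3 / 4 * eps) + p - 1)).
Proof.
move=> drho dsigma step irho; have p0 : 0 < p := lt_trans ltr01 p1.
have r0 y := conv_ratio_ge0 dnu eps0 y drho.
have crp : continuous (fun y => conv_ratio nu eps rho y `^ p).
  exact: continuous_fun_powR p0 (continuous_conv_ratio dnu eps0 drho) r0.
have -> : (fun x => (sigma x / nu x) `^ p) = (fun x => conv_ratio nu eps rho (T x) `^ p).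
  by apply/funext => x; rewrite (pla_step_density drho dsigma step) mulfK// gt_eqF.
have S0 : 0 < 3 / 4 * eps by rewrite mulr_gt0.
have S_lt : 3 / 4 * eps < eps by rewrite gtr_pMl// ltr_pdivrMr// mul1r ltr_nat.
have := conv_ratio_contraction dnu nu0 sob be0 S0 S_lt p1 drho irho.
rewrite -(pla_step_integral dnu dnu stationary crp (fun y => powR_ge0 _ _)) => le_power.
have is_ : dintegrable nu (fun x => conv_ratio nu eps rho (T x) `^ p).
  apply: (dintegrable_of_lty dnu (continuous_comp_map cT crp) (fun x => powR_ge0 _ _)).
  exact: le_lt_trans le_power (ltry _).
by split=> //; rewrite -lee_fin -(dmean_EFin is_).
Qed.

End expanding.
End pla_step.

(** * Renyi divergence *)

Section renyi.
Context {R : realType} {n : nat}.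
Local Notation V := 'rV[R]_n.
Local Notation leb := (lebesgue_rV n).
Implicit Types (rho nu mu : V -> R) (q : R).

Lemma powR_mul_div (q x y : R) : 0 <= x -> 0 < y -> x `^ q * y `^ (1 - q) = (x / y) `^ q * y.
Proof.
move=> x0 y0; have yV0 : 0 <= y^-1 by rewrite invr_ge0 ltW.
rewrite (powRM q x0 yV0) -(powR_inv1 (ltW y0)) -powRrM mulN1r addrC powRD_gt0// powRr1 ?ltW//.
by rewrite mulrA.
Qed.

Lemma ln_le_geometric_mean (x a b : R) : 0 < x -> 0 < a -> 0 < b ->
  x <= a `^ 2^-1 * b `^ 2^-1 -> ln x <= (ln a + ln b) / 2.
Proof.
move=> x0 a0 b0; rewrite -ler_ln ?posrE ?mulr_gt0 ?powR_gt0// lnM ?posrE ?powR_gt0//.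
by rewrite !ln_powR -mulrDr mulrC.
Qed.

Lemma triangle_weights (q m a b : R) : 1 < q -> m <= (a + b) / 2 ->
  (q - 1)^-1 * m <= (q - 2^-1) / (q - 1) * ((2 * q - 1)^-1 * a) + (2 * q - 1 - 1)^-1 * b.
Proof.
move=> q1 m_le; have [q10 q210] : 0 < q - 1 /\ 0 < 2 * q - 1 by lra.
have -> : 2 * q - 1 - 1 = 2 * (q - 1) by ring.
have -> : (q - 2^-1) / (q - 1) * ((2 * q - 1)^-1 * a) + (2 * (q - 1))^-1 * b =
    (q - 1)^-1 * ((a + b) / 2).
  by field; rewrite (gt_eqF q10) (gt_eqF q210).
by rewrite ler_pM2l// invr_gt0.
Qed.

Lemma renyi_integral q rho nu : 0 < q -> density rho -> density nu -> (forall x, 0 < nu x) ->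
  iint (fun x => (rho x `^ q * nu x `^ (1 - q))%:E) =
  (\int[leb]_x ((rho x / nu x) `^ q * nu x)%:E)%E.
Proof.
move=> q0 drho dnu nu0; have r0 x := ratio_ge0 nu0 x drho.
under eq_fun do rewrite (powR_mul_div q (density_ge0 drho _) (nu0 _)).
apply: iint_continuous => [|x]; last by rewrite mulr_ge0 ?powR_ge0 ?ltW.
apply: continuous_funM; last exact: density_continuous.
exact: continuous_fun_powR q0 (continuous_ratio dnu nu0 drho) r0.
Qed.

Lemma renyiE q rho nu : 0 < q -> density rho -> density nu -> (forall x, 0 < nu x) ->
  dintegrable nu (fun x => (rho x / nu x) `^ q) ->
  renyi q rho nu = ((q - 1)^-1 * ln (dmean nu (fun x => (rho x / nu x) `^ q)))%:E.
Proof. by move=> q0 drho dnu nu0 ir; rewrite /renyi renyi_integral// dmean_EFin. Qed.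

Lemma renyi_pinfty q rho nu : 0 < q -> density rho -> density nu -> (forall x, 0 < nu x) ->
  ~ dintegrable nu (fun x => (rho x / nu x) `^ q) -> renyi q rho nu = +oo%E.
Proof.
move=> q0 drho dnu nu0 not_ir; rewrite /renyi renyi_integral//.
have r0 x := ratio_ge0 nu0 x drho.
have cr := continuous_fun_powR q0 (continuous_ratio dnu nu0 drho) r0.
have : (0 <= \int[leb]_x ((rho x / nu x) `^ q * nu x)%:E)%E.
  by apply: integral_ge0 => x _; rewrite lee_fin mulr_ge0 ?powR_ge0 ?ltW.
case intE: (\int[leb]_x _)%E => [r| |]// _; case: not_ir.
by apply: (dintegrable_of_lty dnu cr) => [x|]; rewrite ?powR_ge0// intE ltry.
Qed.

Lemma renyi_gtNy q rho nu : 0 < q -> density rho -> density nu -> (forall x, 0 < nu x) ->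
  (-oo < renyi q rho nu)%E.
Proof.
move=> q0 drho dnu nu0.
have [ir|/renyi_pinfty->//] := pselect (dintegrable nu (fun x => (rho x / nu x) `^ q)).
by rewrite renyiE// ltNyr.
Qed.

Section triangle.
Variables (rho nu mu : V -> R) (q : R).
Hypotheses (drho : density rho) (dnu : density nu) (dmu : density mu).
Hypotheses (nu0 : forall x, 0 < nu x) (mu0 : forall x, 0 < mu x) (q1 : 1 < q).

Let q0 : 0 < q. Proof. exact: lt_trans q1. Qed.

(* Cauchy-Schwarz under [nu] for [(rho/mu)^q mu = (rho/nu)^q (nu/mu)^(q-1) nu]. *)
Lemma dmean_ratio_cauchy_schwarz :
  dintegrable nu (fun x => (rho x / nu x) `^ (2 * q)) ->
  dintegrable mu (fun x => (nu x / mu x) `^ (2 * q - 1)) ->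
  dintegrable mu (fun x => (rho x / mu x) `^ q) /\
  dmean mu (fun x => (rho x / mu x) `^ q) <=
  dmean nu (fun x => (rho x / nu x) `^ (2 * q)) `^ 2^-1 *
  dmean mu (fun x => (nu x / mu x) `^ (2 * q - 1)) `^ 2^-1.
Proof.
move=> irho inu; pose g x := (rho x / nu x) `^ q; pose h x := (nu x / mu x) `^ (q - 1).
have nm0 x : 0 < nu x / mu x by rewrite divr_gt0.
have g2E : (fun x => g x `^ 2) = (fun x => (rho x / nu x) `^ (2 * q)).
  by apply/funext => x; rewrite -powRrM [q * 2]mulrC.
have h2E : (fun x => h x `^ 2 * (nu x / mu x)) = (fun x => (nu x / mu x) `^ (2 * q - 1)).
  apply/funext => x; have -> : 2 * q - 1 = (q - 1) * 2 + 1 by ring.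
  by rewrite [RHS]powRD_gt0// [in RHS]powRrM powRr1// ltW.
have ghE : (fun x => g x * h x * (nu x / mu x)) = (fun x => (rho x / mu x) `^ q).
  apply/funext => x; rewrite -mulrA -[X in h x * X]powRr1 ?(ltW (nm0 x))//.
  rewrite -(powRD_gt0 _ _ (nm0 x)) subrK -powRM ?(ratio_ge0 nu0)//; last exact: ltW.
  by rewrite mulrA divfK// gt_eqF.
have ig2 : dintegrable nu (fun x => g x `^ 2) by rewrite g2E.
have ih2 : dintegrable nu (fun x => h x `^ 2).
  move: (inu); rewrite -h2E => /(dintegrable_ratio dnu nu0 dmu); congr (dintegrable nu _).
  by apply/funext => x; rewrite -mulrA -(invf_div (nu x)) mulfV ?mulr1// gt_eqF.
have g0 x : 0 <= g x := powR_ge0 _ _; have h0 x : 0 <= h x := powR_ge0 _ _.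
have cg : continuous g.
  exact: continuous_fun_powR q0 (continuous_ratio dnu nu0 drho) (fun x => ratio_ge0 nu0 x drho).
have ch : continuous h by exact: continuous_fun_powR_gt0 (continuous_ratio dmu mu0 dnu) nm0.
have [two0 half] : 0 < 2 :> R /\ 2^-1 + 2^-1 = 1 :> R by lra.
have igh := dintegrable_hoelder dnu two0 two0 half cg ch g0 h0 ig2 ih2.
have meanE : dmean nu (fun x => g x * h x) = dmean mu (fun x => (rho x / mu x) `^ q).
  by rewrite -ghE; exact: dmean_ratio.
have squareE : dmean nu (fun x => h x `^ 2) = dmean mu (fun x => (nu x / mu x) `^ (2 * q - 1)).
  by rewrite -h2E; exact: dmean_ratio.
split; first by rewrite -ghE; exact: (dintegrable_ratio dmu mu0 dnu igh).
rewrite -meanE -squareE -g2E.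
exact: (dmean_hoelder dnu two0 two0 half cg ch g0 h0 ig2 ih2).
Qed.

Theorem renyi_triangle :
  (renyi q rho mu <=
   ((q - 2^-1) / (q - 1))%:E * renyi (2 * q) rho nu + renyi (2 * q - 1) nu mu)%E.
Proof.
have [q2 q21] : 1 < 2 * q /\ 1 < 2 * q - 1 by move: q1; lra.
have [q20 q210] : 0 < 2 * q /\ 0 < 2 * q - 1 by lra.
have c0 : 0 < (q - 2^-1) / (q - 1) by rewrite divr_gt0//; lra.
have [irho|] := pselect (dintegrable nu (fun x => (rho x / nu x) `^ (2 * q))); last first.
  move=> /(renyi_pinfty q20 drho dnu nu0)->.
  by rewrite gt0_muley ?lte_fin// addye ?leey// gt_eqF// renyi_gtNy.
have [inu|] := pselect (dintegrable mu (fun x => (nu x / mu x) `^ (2 * q - 1))); last first.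
  move=> /(renyi_pinfty q210 dnu dmu mu0)->.
  by rewrite (renyiE q20 drho dnu nu0 irho) -EFinM addey ?leey.
have [im m_le] := dmean_ratio_cauchy_schwarz irho inu.
rewrite (renyiE q0 drho dmu mu0 im) (renyiE q20 drho dnu nu0 irho) (renyiE q210 dnu dmu mu0 inu).
have pos (z : R) : 1 <= z -> 0 < z by exact: lt_le_trans.
have m0 := pos _ (dmean_ratio_powR_ge1 dmu mu0 q1 drho im).
have a0 := pos _ (dmean_ratio_powR_ge1 dnu nu0 q2 drho irho).
have j0 := pos _ (dmean_ratio_powR_ge1 dmu mu0 q21 dnu inu).
rewrite -EFinM -EFinD lee_fin.
exact/(triangle_weights q1)/(ln_le_geometric_mean m0 a0 j0 m_le).
Qed.

End triangle.
End renyi.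

Section renyi_decay.
Context {R : realType} {n : nat}.
Local Notation V := 'rV[R]_n.

Lemma contraction_rate (b p : R) : 0 < b -> b < 2^-1 -> 2 <= p ->
  p / (1 + 3 / 2 * b + p - 1) <= expR (- (b / p)).
Proof.
move=> b0 b2 p2; have p0 : 0 < p by lra.
have y0 : 0 <= b / p by rewrite divr_ge0 ?ltW.
have y4 : b / p <= 4^-1 by rewrite ler_pdivrMr//; lra.
have -> : p / (1 + 3 / 2 * b + p - 1) = (1 + 3 / 2 * (b / p))^-1.
  by field; apply/andP; split; rewrite gt_eqF//; lra.
rewrite expRN lef_pV2 ?posrE ?expR_gt0//; last by lra.
have y2 : b / p <= 2^-1 by lra.
by apply: le_trans (expR_le_quadratic y0 y2) _; nra.
Qed.

Lemma ln_le_powR (x y r : R) : 0 < x -> 0 < y -> y <= x `^ r -> ln y <= r * ln x.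
Proof. by move=> x0 y0; rewrite -ln_powR ler_ln ?posrE ?powR_gt0. Qed.

Variables (f nu : V -> R) (eps c be p : R).
Local Notation T := (pla_map f eps).
Hypotheses (cT : continuous T) (c0 : 0 < c)
  (expanding : forall x y, c * enorm (x - y) <= enorm (T x - T y)).
Hypotheses (dnu : density nu) (nu0 : forall x, 0 < nu x) (stationary : pla_step f eps nu nu)
  (sob : log_sobolev (2 * be)^-1 (dmean nu)).
Hypotheses (be0 : 0 < be) (eps0 : 0 < eps) (eps_lt : eps < (2 * be)^-1) (p2 : 2 <= p).

Lemma pla_step_renyi rho sigma : density rho -> density sigma -> pla_step f eps rho sigma ->
  (renyi p sigma nu <= renyi p rho nu * (expR (- (be * eps / p)))%:E)%E.
Proof.
move=> drho dsigma step; have [p0 p1] : 0 < p /\ 1 < p by move: p2; lra.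
have [irho|] := pselect (dintegrable nu (fun x => (rho x / nu x) `^ p)); last first.
  by move=> /(renyi_pinfty p0 drho dnu nu0)->; rewrite gt0_mulye ?leey// lte_fin expR_gt0.
have [isigma le_power] := pla_step_contraction cT eps0 dnu nu0 stationary c0 expanding sob be0 p1
  drho dsigma step irho.
rewrite (renyiE p0 drho dnu nu0 irho) (renyiE p0 dsigma dnu nu0 isigma) -EFinM lee_fin.
rewrite -[leRHS]mulrA.
have rate : p / (1 + 2 * be * (3 / 4 * eps) + p - 1) <= expR (- (be * eps / p)).
  have -> : 2 * be * (3 / 4 * eps) = 3 / 2 * (be * eps) by field.
  apply: contraction_rate => //; first exact: mulr_gt0.
  by move: eps_lt; rewrite invfM ltr_pdivlMr// mulrC.
have A1 := dmean_ratio_powR_ge1 dnu nu0 p1 drho irho.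
have B0 := lt_le_trans ltr01 (dmean_ratio_powR_ge1 dnu nu0 p1 dsigma isigma).
apply: ler_wpM2l; first by rewrite invr_ge0 subr_ge0 ltW.
apply: le_trans (ln_le_powR (lt_le_trans ltr01 A1) B0 le_power) _.
rewrite [leRHS]mulrC; exact: (ler_wpM2r (ln_ge0 A1) rate).
Qed.

Theorem pla_renyi_decay (rho : nat -> V -> R) k : (forall i, density (rho i)) ->
  (forall i, pla_step f eps (rho i) (rho i.+1)) ->
  (renyi p (rho k) nu <= renyi p (rho 0%N) nu * (expR (- (be * eps * k%:R) / p))%:E)%E.
Proof.
move=> drho step; elim: k => [|k ih].
  by rewrite mulr0 oppr0 mul0r expR0 mule1.
apply: le_trans (pla_step_renyi (drho k) (drho k.+1) (step k)) _.
have -> : - (be * eps * k.+1%:R) / p = - (be * eps * k%:R) / p + - (be * eps / p).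
  by rewrite -natr1; ring.
by rewrite expRD EFinM muleA lee_pmul2r// lte_fin expR_gt0.
Qed.

End renyi_decay.

Theorem theorem2 (R : realType) (n : nat) (f : 'rV[R]_n -> R)
  (L eps beta q : R) (nu_eps : 'rV[R]_n -> R) (rho : nat -> 'rV[R]_n -> R) :
  (* f smooth (here: twice differentiable) with ||Hess f||_op <= L *)
  (forall x, differentiable f x) ->
  (forall v x, differentiable (fun y => derive f y v) x) ->
  0 <= L ->
  (forall x v w, `| derive (fun y => derive f y v) x w | <= L * enorm v * enorm w) ->
  (* nu = e^{-f} is a probability density *)
  is_density (fun x => expR (- f x)) ->
  (* step size 0 < eps < min(1/L, 1/(2 beta)) *)
  0 < beta -> 0 < eps -> eps * L < 1 -> eps < (2 * beta)^-1 ->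
  (* nu_eps: smooth positive stationary density of PLA, satisfying LSI(beta) *)
  (forall x, 0 < nu_eps x) -> (forall x, differentiable nu_eps x) ->
  is_density nu_eps -> pla_step f eps nu_eps nu_eps ->
  LSI nu_eps beta ->
  (* the PLA iterates rho_k (smooth densities) *)
  (forall k, is_density (rho k)) -> (forall k x, differentiable (rho k) x) ->
  (forall k, pla_step f eps (rho k) (rho k.+1)) ->
  1 < q ->
  forall k : nat,
    (renyi q (rho k) (fun x => expR (- f x))
     <= ((q - 2^-1) / (q - 1))%:E * renyi (2 * q) (rho 0%N) nu_eps
          * (expR (- (beta * eps * k%:R) / (2 * q)))%:E
        + renyi (2 * q - 1) nu_eps (fun x => expR (- f x)))%E.
Proof.
move=> df ddf L0 hess is_mu beta0 eps0 epsL eps_lt nu0 diff_nu is_nu stationary lsi is_rho.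
move=> diff_rho step q1 k.
have continuousP (g : 'rV[R]_n -> R) : (forall x, differentiable g x) -> continuous g.
  by move=> dg x; exact: differentiable_continuous.
have dmu : density (fun x => expR (- f x)).
  by split=> //; apply: continuous_fun_expR; apply: continuous_funN; exact: continuousP.
have dnu : density nu_eps by split=> //; exact: continuousP.
have drho i : density (rho i) by split=> //; exact: continuousP.
have c0 : 0 < 1 - eps * L by rewrite subr_gt0.
have expanding x y := pla_map_expanding df ddf hess L0 x y (ltW eps0).
have decay := pla_renyi_decay (continuous_pla_map ddf) c0 expanding dnu nu0 stationary
  (LSI_log_sobolev nu0 diff_nu is_nu lsi) beta0 eps0 eps_lt _ k drho step.
have weight0 : 0 <= (q - 2^-1) / (q - 1) by rewrite divr_ge0//; lra.
apply: le_trans (renyi_triangle (drho k) dnu dmu nu0 (fun x => expR_gt0 _) q1) _.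
by rewrite leeD2r// -muleA lee_wpmul2l ?lee_fin// decay//; lra.
Qed.
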